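(* Let $D\subset\mathbb{C}$ be a bounded domain and $p\in\partial D$. Assume that $\partial D$ is $C^2$-smooth near $p$. If $\psi$ is a $C^2$-defining function for $D$ near $p$ with $\frac{\partial\psi}{\partial z}(p)=1$, then for every positive integer $n$ $$\tilde K^{(n-1)}_{D,n}(z,z)\sim\frac{n!\,(n-1)!}{\pi}\,\frac{1}{(\psi(z))^{2n}}\approx\frac{1}{(\delta(z))^{2n}}\qquad\text{as } z\to p .$$
   Context: For a domain $D\subset\mathbb{C}$, let $\mathcal{O}(D)$ be the space of holomorphic functions on $D$ and $dA$ the area measure. For $\zeta\in D$ and a positive integer $n$, let $$AD(D,\zeta^n)=\Big\{f\in\mathcal{O}(D): f(\zeta)=f'(\zeta)=\cdots=f^{(n-1)}(\zeta)=0,\ \int_D|f'(z)|^2\,dA(z)<\infty\Big\},$$ a Hilbert space with inner product $\langle f,g\rangle=\int_D f'\,\overline{g'}\,dA$. The functional $f\mapsto f^{(n)}(\zeta)$ is continuous on it, and $M_{D,n}(\cdot,\zeta)\in AD(D,\zeta^n)$ is the unique function with $f^{(n)}(\zeta)=\langle f,M_{D,n}(\cdot,\zeta)\rangle$ for all $f\in AD(D,\zeta^n)$. The (unweighted) $n$-th order reduced Bergman kernel is $\tilde K_{D,n}(z,\zeta)=\frac{\partial}{\partial z}M_{D,n}(z,\zeta)$, and $\tilde K^{(q)}_{D,n}(z,\zeta)=\frac{\partial^q}{\partial z^q}\tilde K_{D,n}(z,\zeta)$ for integers $q\ge0$; $\tilde K^{(n-1)}_{D,n}(z,z)$ is the value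 of $\tilde K^{(n-1)}_{D,n}$ on the diagonal. A $C^2$-defining function for $D$ near $p$ is a real-valued $C^2$ function $\psi$ on a neighborhood $U$ of $p$ with $D\cap U=\{\psi<0\}$, $\partial D\cap U=\{\psi=0\}$ and nonvanishing gradient on $\partial D\cap U$. $\delta(z)$ is the Euclidean distance from $z$ to $\partial D$. For functions $f,g$ on $D$ (near $p$): $f\sim\lambda g$ as $z\to p$ means $f(z)/g(z)\to\lambda$ as $z\to p$; $f\approx g$ as $z\to p$ means that $f/g$ is bounded above and below by positive constants on the points of $D$ in some neighborhood of $p$. *)

(* Defs.v *)
From HB Require Import structures.
From mathcomp Require Import all_boot all_order all_algebra.
From mathcomp Require Import all_classical all_reals all_analysis.
From mathcomp Require Import complex.

Set Implicit Arguments.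
Unset Strict Implicit.
Unset Printing Implicit Defensive.

Import Order.TTheory GRing.Theory Num.Theory.
Import numFieldNormedType.Exports.

Local Open Scope classical_set_scope.
Local Open Scope ring_scope.
Local Open Scope complex_scope.

(* The complex numbers, as a numFieldType: they thus carry the topology and the
   normed space structure given by the modulus, and derivable _ _ 1, derive1 and
   derive1n at functions Cplx R -> Cplx R are the complex derivatives. *)
Definition Cplx (R : realType) : numFieldType := R[i].

Section ReducedBergmanKernel.
Context {R : realType}.
Implicit Types (D U : set (Cplx R)) (p z zeta : Cplx R).
Implicit Types (f g M : Cplx R -> Cplx R).
Implicit Types (h psi : Cplx R -> R).

Definition of_pair (w : R * R) : Cplx R := w.1 +i* w.2.

Definition area := (@lebesgue_measure R \x @lebesgue_measure R)%E.

Definition domain D := [/\ open D, D !=set0 & connected D].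

Definition boundary D : set (Cplx R) := closure D `\` interior D.

Definition holomorphic_on D f := forall z, D z -> derivable f z 1.

Definition AD D zeta (n : nat) f :=
  [/\ holomorphic_on D f,
      forall k : nat, (k < n)%N -> derive1n k f zeta = 0
    & (\int[area]_(w in of_pair @^-1` D)
         (Normc.normc (derive1 f (of_pair w)) ^+ 2)%:E < +oo)%E].

Definition AD_inner D f g : Cplx R :=
  let F w := derive1 f (of_pair w) * conjc (derive1 g (of_pair w)) in
  (\int[area]_(w in of_pair @^-1` D) complex.Re (F w))
    +i* (\int[area]_(w in of_pair @^-1` D) complex.Im (F w)).

Definition is_representer D n zeta M :=
  AD D zeta n M /\
  forall f, AD D zeta n f -> derive1n n f zeta = AD_inner D f M.

(* M_{D,n}(., zeta).  Functions are total here, so the representing function is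
   unique on D only; the values chosen outside D do not affect derivatives at
   points of the open set D. *)
Definition representer D n zeta : Cplx R -> Cplx R :=
  get (is_representer D n zeta).

Definition reduced_bergman D n z zeta : Cplx R :=
  derive1 (representer D n zeta) z.

Definition reduced_bergman_deriv D n (q : nat) z zeta : Cplx R :=
  derive1n q (fun w => reduced_bergman D n w zeta) z.

Definition partial_x h z : R :=
  'D_(1, 0) (h \o of_pair) (complex.Re z, complex.Im z).

Definition partial_y h z : R :=
  'D_(0, 1) (h \o of_pair) (complex.Re z, complex.Im z).

(* Wirtinger derivative: (d/dx - i d/dy) / 2. *)
Definition wirtinger h z : Cplx R := (partial_x h z -i* partial_y h z) / 2.

(* In C1_on and C2_on the set U is meant to be open. *)
Definition C1_on U h := forall z, U z ->
  [/\ derivable (h \o of_pair) (complex.Re z, complex.Im z) (1, 0),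
      derivable (h \o of_pair) (complex.Re z, complex.Im z) (0, 1),
      {for z, continuous h},
      {for z, continuous (partial_x h)}
    & {for z, continuous (partial_y h)}].

Definition C2_on U h :=
  [/\ C1_on U h, C1_on U (partial_x h) & C1_on U (partial_y h)].

(* Only the restriction of psi to U matters. *)
Definition C2_defining_on D p U psi :=
  [/\ open U /\ U p,
      C2_on U psi,
      D `&` U = [set z | U z /\ psi z < 0],
      boundary D `&` U = [set z | U z /\ psi z = 0]
    & forall z, boundary D z -> U z ->
        (partial_x psi z, partial_y psi z) <> (0, 0)].

Definition C2_defining D p psi := exists U, C2_defining_on D p U psi.

Definition C2_smooth_boundary_near D p := exists psi, C2_defining D p psi.

Definition boundary_dist D z : R :=
  inf [set Normc.normc (z - w : R[i]) | w in boundary D].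

Definition sim_at D p (lambda : Cplx R) f g :=
  f z / g z @[z --> within D (nbhs p)] --> lambda.

Definition approx_at D p (h1 h2 : Cplx R -> R) :=
  exists c1 c2 : R, [/\ 0 < c1, 0 < c2
    & \forall z \near within D (nbhs p), c1 <= h1 z / h2 z <= c2].

End ReducedBergmanKernel.

(* Main.v *)
(** For a representer M of f |-> f^(n)(zeta) one has K~^(n-1)(zeta, zeta) = M^(n)(zeta) = <M, M>,
    and <M, M> is the least constant K with |f^(n)(zeta)|^2 <= K <f, f> on AD(D, zeta^n).

    For zeta near p put k = - psi(zeta) and w = (z - zeta) / (z - zeta - k). Since
    d psi / dz (p) = 1, the first order expansion of psi gives, for every e > 0,
    {|w| < 1 - e} <= D <= {|w| <= 1 + e} once zeta is close to p. The Dirichlet integral is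
    conformally invariant, so both inclusions are tested on discs. If G is holomorphic on
    {|w| < r} and G ~ L w^(n-1) at 0, then |L|^2 pi r^(2n) / n <= int |G|^2; pulling f' back to
    {|w| < 1 - e} bounds K from above. The function w^n, whose energy on {|w| <= 1 + e} is
    n pi (1 + e)^(2n), bounds K from below. Both bounds are n! (n-1)! / (pi k^(2n)) up to
    factors tending to 1, and the distance from zeta to the boundary is comparable to k.

    The estimate on |L| comes from averaging int |G|^2 over rotations and the mean value
    property, so no polar coordinates are needed; the change of variables under w is obtained
    from translations, dilations and z |-> 1 / z, the last one because dA / |z|^2 is a Haar
    measure of the multiplicative group. *)
Require Import Defs.
From HB Require Import structures.
From mathcomp Require Import all_boot all_order all_algebra.
From mathcomp Require Import all_classical all_reals all_analysis measurable_realfun.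
From mathcomp Require Import complex ring lra.
Import Order.TTheory GRing.Theory Num.Theory.
Import numFieldNormedType.Exports.
Set Implicit Arguments.
Unset Strict Implicit.
Unset Printing Implicit Defensive.
Local Open Scope classical_set_scope.
Local Open Scope ring_scope.
Local Open Scope complex_scope.

(** To first order at zeta the domain is the half-plane {2 Re (z - zeta) < k}, which is exactly {|z
    - zeta| < |z - zeta - k|}; w maps it onto the unit disc and zeta to 0. This is the origin of w.
    The set {|w| < 1 - e} and the complement of {|w| <= 1 + e} are discs within distance k + k / e
    of zeta, so both inclusions can be read off near p, although the second one speaks of all of D.

    The estimates concern only the extremal constant. Since [representer] is a choice, the kernel
    equals that constant only once a representer is known to exist. It is a multiple of an element
    of least energy among those with n-th derivative 1. Finding this element takes the completeness
    of AD(D, zeta^n): limits in energy must be holomorphic and keep their derivatives at zeta.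
    Holomorphy being mere complex differentiability at each point, this rests on Goursat's theorem
    and Cauchy's estimate. Boundedness of D enters to provide an element with nonzero n-th
    derivative. *)

Section ComplexPlane.
Context {R : realType}.
Local Notation C := (Cplx R).
Implicit Types (z w : C) (f g : C -> C).

Lemma reD z w : complex.Re (z + w) = complex.Re z + complex.Re w.
Proof. by case: z w => [a b] [c d]. Qed.

Lemma imD z w : complex.Im (z + w) = complex.Im z + complex.Im w.
Proof. by case: z w => [a b] [c d]. Qed.

Lemma reN z : complex.Re (- z) = - complex.Re z.
Proof. by case: z => [a b]. Qed.

Lemma imN z : complex.Im (- z) = - complex.Im z.
Proof. by case: z => [a b]. Qed.

Lemma reM z w : complex.Re (z * w) =
  complex.Re z * complex.Re w - complex.Im z * complex.Im w.
Proof. by case: z w => [a b] [c d]. Qed.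

Lemma imM z w : complex.Im (z * w) =
  complex.Re z * complex.Im w + complex.Im z * complex.Re w.
Proof. by case: z w => [a b] [c d]. Qed.

Lemma cplx_ext z w :
  complex.Re z = complex.Re w -> complex.Im z = complex.Im w -> z = w.
Proof. by case: z w => [a b] [c d] /= -> ->. Qed.

(** The modulus as a real number: the norm of [Cplx R] takes its values in [Cplx R] itself, out of
    reach of real order arguments. *)
Definition cabs z : R := Normc.normc z.

Lemma cabsE z : cabs z = Num.sqrt (complex.Re z ^+ 2 + complex.Im z ^+ 2).
Proof. by case: z. Qed.

Lemma normE z : `|z| = (cabs z)%:C.
Proof. by []. Qed.

Lemma cabs_ge0 z : 0 <= cabs z.
Proof. by rewrite cabsE sqrtr_ge0. Qed.

Lemma cabs_sqr z : cabs z ^+ 2 = complex.Re z ^+ 2 + complex.Im z ^+ 2.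
Proof. by rewrite cabsE sqr_sqrtr// addr_ge0 ?sqr_ge0. Qed.

Lemma cabs0 : cabs 0 = 0.
Proof. by rewrite cabsE/= expr0n/= addr0 sqrtr0. Qed.

Lemma cabs1 : cabs 1 = 1.
Proof. by rewrite cabsE/= expr0n/= addr0 expr1n sqrtr1. Qed.

Lemma cabs_eq0 z : (cabs z == 0) = (z == 0).
Proof.
apply/eqP/eqP => [/Normc.eq0_normc //|->]; exact: cabs0.
Qed.

Lemma cabs_gt0 z : (0 < cabs z) = (z != 0).
Proof. by rewrite lt_neqAle cabs_ge0 andbT eq_sym cabs_eq0. Qed.

Lemma cabsM z w : cabs (z * w) = cabs z * cabs w.
Proof. exact: Normc.normcM. Qed.

Lemma cabsN z : cabs (- z) = cabs z.
Proof. exact: normcN. Qed.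

Lemma cabsB z w : cabs (z - w) = cabs (w - z).
Proof. by rewrite -cabsN opprB. Qed.

Lemma cabsV z : cabs z^-1 = (cabs z)^-1.
Proof. exact: Normc.normcV. Qed.

Lemma cabsX z n : cabs (z ^+ n) = cabs z ^+ n.
Proof. by elim: n => [|n IH]; rewrite ?expr0 ?cabs1// !exprS cabsM IH. Qed.

Lemma cabsD z w : cabs (z + w) <= cabs z + cabs w.
Proof. exact: le_normcD. Qed.

Lemma cabsBD z w : cabs (z - w) <= cabs z + cabs w.
Proof. by rewrite -(cabsN w) cabsD. Qed.

Lemma cabsBB u z w : cabs (z - w) <= cabs (z - u) + cabs (u - w).
Proof. by rewrite (le_trans _ (cabsD _ _))// addrA subrK. Qed.

Lemma re_cabs z : `|complex.Re z| <= cabs z.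
Proof. by rewrite cabsE -sqrtr_sqr ler_wsqrtr// lerDl sqr_ge0. Qed.

Lemma im_cabs z : `|complex.Im z| <= cabs z.
Proof. by rewrite cabsE -sqrtr_sqr ler_wsqrtr// lerDr sqr_ge0. Qed.

Lemma cabs_re_im z : cabs z <= `|complex.Re z| + `|complex.Im z|.
Proof.
rewrite -(@ler_pXn2r _ 2)// ?nnegrE ?cabs_ge0 ?addr_ge0//.
rewrite cabs_sqr sqrrD !real_normK ?num_real//.
by rewrite lerD2r lerDl mulrn_wge0// mulr_ge0.
Qed.

Lemma cabs_real (x : R) : cabs x%:C = `|x|.
Proof. by rewrite cabsE/= expr0n/= addr0 sqrtr_sqr. Qed.

(** Balls of [Cplx R] have complex radii; positivity forces the imaginary part of a radius to
    vanish, so real radii suffice. *)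
Lemma nbhs_cplxP z (A : set C) : nbhs z A <->
  exists2 e : R, 0 < e & forall w, cabs (w - z) < e -> A w.
Proof.
split.
  move=> /nbhs_ballP[e /= e0 zA]; have := e0; case: e e0 zA => e b.
  rewrite ltcE/= => /andP[/eqP -> e0] zA _; exists e => // w we; apply: zA.
  by rewrite -ball_normE/= distrC normE ltcR.
move=> [e e0 zA]; apply/nbhs_ballP; exists e%:C => /=; first by rewrite ltcR.
by move=> w; rewrite -ball_normE/= distrC normE ltcR => /zA.
Qed.

Lemma cvg_cplxP (T : Type) (F : set_system T) (FF : Filter F) (f : T -> C) (l : C) :
  f x @[x --> F] --> l <->
  forall e : R, 0 < e -> \forall x \near F, cabs (f x - l) < e.
Proof.
split=> [fl e e0|fl A].
  by apply: (fl [set y | cabs (y - l) < e]); apply/nbhs_cplxP; exists e.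
by move=> /nbhs_cplxP[e e0 eA]; apply: filterS (fl e e0) => x /eA.
Qed.

Lemma cvg_re (T : Type) (F : set_system T) (FF : Filter F) (f : T -> C) (l : C) :
  f x @[x --> F] --> l -> complex.Re (f x) @[x --> F] --> complex.Re l.
Proof.
move=> /cvg_cplxP fl; apply/cvgrPdist_lt => e e0.
apply: filterS (fl e e0) => x; apply: le_lt_trans.
by rewrite distrC -reN -reD re_cabs.
Qed.

Lemma cvg_im (T : Type) (F : set_system T) (FF : Filter F) (f : T -> C) (l : C) :
  f x @[x --> F] --> l -> complex.Im (f x) @[x --> F] --> complex.Im l.
Proof.
move=> /cvg_cplxP fl; apply/cvgrPdist_lt => e e0.
apply: filterS (fl e e0) => x; apply: le_lt_trans.
by rewrite distrC -imN -imD im_cabs.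
Qed.

Lemma cvg_re_im (T : Type) (F : set_system T) (FF : Filter F) (f : T -> C) (l : C) :
  complex.Re (f x) @[x --> F] --> complex.Re l ->
  complex.Im (f x) @[x --> F] --> complex.Im l ->
  f x @[x --> F] --> l.
Proof.
move=> /cvgrPdist_lt fr /cvgrPdist_lt fi; apply/cvg_cplxP => e e0.
have e20 : 0 < e / 2 by rewrite divr_gt0.
apply: filterS2 (fr _ e20) (fi _ e20) => x xr xi.
rewrite (le_lt_trans (cabs_re_im _))// reD imD reN imN (splitr e).
by rewrite ltrD// distrC.
Qed.

Lemma cvg_cabs (T : Type) (F : set_system T) (FF : Filter F) (f : T -> C) (l : C) :
  f x @[x --> F] --> l -> cabs (f x) @[x --> F] --> cabs l.
Proof.
move=> /cvg_cplxP fl; apply/cvgrPdist_lt => e e0.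
apply: filterS (fl e e0) => x; apply: le_lt_trans.
rewrite ler_norml; apply/andP; split.
  by rewrite lerNl opprB lerBlDl (le_trans _ (cabsD _ _))// addrC subrK.
by rewrite lerBlDl cabsB (le_trans _ (cabsD _ _))// addrC subrK.
Qed.

(** A division-free form of differentiability: the point [w = z] is not excluded, and errors can be
    added and composed directly. *)
Lemma is_deriveP f z (l : C) : is_derive z 1 f l <->
  forall e : R, 0 < e -> exists2 d : R, 0 < d & forall w, cabs (w - z) < d ->
    cabs (f w - f z - l * (w - z)) <= e * cabs (w - z).
Proof.
have key : (h^-1 *: (f (h *: (1 : C) + z) - f z) @[h --> (0:C)^'] --> l) <->
  forall e : R, 0 < e -> exists2 d : R, 0 < d & forall w, cabs (w - z) < d ->
    cabs (f w - f z - l * (w - z)) <= e * cabs (w - z).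
  split.
    move=> /cvg_cplxP H e e0; have [d d0 {}H] := (nbhs_cplxP _ _).1 (H e e0).
    exists d => // w wz; have [->|wz0] := eqVneq w z.
      by rewrite !subrr mulr0 subr0 !cabs0 mulr0.
    have wz1 : w - z != 0 by rewrite subr_eq0.
    have /= := H (w - z).
    rewrite subr0 => /(_ wz wz1); rewrite [_ *: 1]mulr1 subrK => /ltW.
    rewrite -(ler_pM2r (_ : 0 < cabs (w - z))) ?cabs_gt0// -cabsM mulrBl.
    by rewrite mulrAC [X in X * _]mulVf// mul1r.
  move=> H; apply/cvg_cplxP => e e0.
  (* Halving [e] turns the weak inequality of the hypothesis into the strict one of the limit. *)
  have [d d0 {}H] := H _ (divr_gt0 e0 (ltr0Sn R 1)).
  apply/nbhs_cplxP; exists d => // w; rewrite subr0 => wd w0.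
  rewrite [_ *: 1]mulr1.
  have := H (w + z); rewrite addrK => /(_ wd).
  rewrite -(ler_pM2l (_ : 0 < cabs w^-1)) ?cabs_gt0 ?invr_eq0// -cabsM mulrBr.
  rewrite [in X in _ <= X -> _]mulrCA -cabsM mulVf// cabs1 mulr1.
  rewrite [in X in _ - X]mulrCA mulVf// mulr1 => /le_lt_trans; apply.
  by rewrite ltr_pdivrMr// ltr_pMr// ltr1n.
split.
  move=> [fd fE]; apply/key; rewrite -fE.
  exact: fd.
move=> /key H; split; first by apply/cvg_ex; exists l.
exact: cvg_lim H.
Qed.

Definition cpt (x y : R) : C := x +i* y.

Definition cre (x : R) : C := cpt x 0.

Lemma re_cpt (x y : R) : complex.Re (cpt x y) = x. Proof. by []. Qed.

Lemma im_cpt (x y : R) : complex.Im (cpt x y) = y. Proof. by []. Qed.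

Lemma re_cre (x : R) : complex.Re (cre x) = x. Proof. by []. Qed.

Lemma im_cre (x : R) : complex.Im (cre x) = 0. Proof. by []. Qed.

Lemma re0 : complex.Re (0 : C) = 0. Proof. by []. Qed.

Lemma im0 : complex.Im (0 : C) = 0. Proof. by []. Qed.

Lemma re1 : complex.Re (1 : C) = 1. Proof. by []. Qed.

Lemma im1 : complex.Im (1 : C) = 0. Proof. by []. Qed.

Definition reimE := (reD, imD, reN, imN, reM, imM, re_cpt, im_cpt, re_cre, im_cre,
  re0, im0, re1, im1).

Lemma cre0 : cre 0 = 0. Proof. by []. Qed.

Lemma cre1 : cre 1 = 1. Proof. by []. Qed.

Lemma creD (x y : R) : cre (x + y) = cre x + cre y.
Proof. by apply: cplx_ext; rewrite !reimE ?addr0. Qed.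

Lemma creN (x : R) : cre (- x) = - cre x.
Proof. by apply: cplx_ext; rewrite !reimE ?oppr0. Qed.

Lemma creB (x y : R) : cre (x - y) = cre x - cre y.
Proof. by rewrite creD creN. Qed.

Lemma creM (x y : R) : cre (x * y) = cre x * cre y.
Proof. by apply: cplx_ext; rewrite !reimE; ring. Qed.

Lemma cpt_re_im z : cpt (complex.Re z) (complex.Im z) = z.
Proof. by case: z. Qed.

End ComplexPlane.

Arguments cabs : simpl never.
Arguments cpt : simpl never.
Arguments cre : simpl never.

(** * Integrals of complex-valued functions over a segment *)

Section ComplexIntegral.
Context {R : realType}.
Local Notation C := (Cplx R).
Local Notation mu := (@lebesgue_measure R).
Implicit Types (a b : R) (u : R -> R) (phi : R -> C).

(** Continuity is two-sided even at the endpoints: the integrands come from functions continuous at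
    these points in the whole plane, so the subspace topology can be avoided. *)
Definition cts_on (T : topologicalType) a b (phi : R -> T) :=
  forall t, a <= t <= b -> phi x @[x --> t] --> phi t.

Lemma cts_on_integrable a b u : cts_on a b u -> mu.-integrable `[a, b] (EFin \o u).
Proof.
move=> uc; apply: continuous_compact_integrable; first exact: segment_compact.
by apply: continuous_in_subspaceT => x; rewrite inE/= in_itv/= => /uc.
Qed.

Definition cint a b phi : C := cpt
  (\int[mu]_(t in `[a, b]) complex.Re (phi t))
  (\int[mu]_(t in `[a, b]) complex.Im (phi t)).

Lemma cts_on_re a b phi : cts_on a b phi -> cts_on a b (fun t => complex.Re (phi t)).
Proof. by move=> H t /H; exact: cvg_re. Qed.

Lemma cts_on_im a b phi : cts_on a b phi -> cts_on a b (fun t => complex.Im (phi t)).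
Proof. by move=> H t /H; exact: cvg_im. Qed.

Lemma cts_onB a b phi psi : cts_on a b phi -> cts_on a b psi ->
  cts_on a b (fun t => phi t - psi t).
Proof. by move=> H K t tab; apply: cvgB; [exact: H|exact: K]. Qed.

Lemma eq_cint a b phi psi : (forall t, a <= t <= b -> phi t = psi t) ->
  cint a b phi = cint a b psi.
Proof.
by move=> H; congr cpt; apply: eq_Rintegral => t;
  rewrite inE/= in_itv/= => /H ->.
Qed.

Lemma cintD a b phi psi : cts_on a b phi -> cts_on a b psi ->
  cint a b (fun t => phi t + psi t) = cint a b phi + cint a b psi.
Proof.
move=> H K; apply: cplx_ext; rewrite ?reD ?imD /cint !reimE -RintegralD//.
- by apply: eq_Rintegral => t _; rewrite reD.
- exact/cts_on_integrable/cts_on_re.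
- exact/cts_on_integrable/cts_on_re.
- by apply: eq_Rintegral => t _; rewrite imD.
- exact/cts_on_integrable/cts_on_im.
- exact/cts_on_integrable/cts_on_im.
Qed.

Lemma cint_cst a b (c : C) : a <= b -> cint a b (fun=> c) = cre (b - a) * c.
Proof.
move=> ab; rewrite /cint !Rintegral_cst//= lebesgue_measure_itv/= lte_fin.
apply: cplx_ext; rewrite !reimE ?mul0r ?subr0 ?addr0;
case: ltgtP ab => //= [_ _|-> _]; rewrite ?subrr ?mulr0 ?mul0r//;
by rewrite mulrC.
Qed.

Lemma Rint_split a b c u : a <= c -> c <= b -> cts_on a b u ->
  \int[mu]_(t in `[a, b]) u t =
  \int[mu]_(t in `[a, c]) u t + \int[mu]_(t in `[c, b]) u t.
Proof.
move=> ac cb uc; have ui := cts_on_integrable uc.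
rewrite -(Rintegral_itv_obnd_cbnd (r := c)).
  by rewrite -(Rintegral_itvB (x := c) ui)// ?bnd_simp// addrC subrK.
apply: integrableS ui => //; apply: subset_itvr.
by rewrite bnd_simp.
Qed.

Lemma cint_split a b c phi : a <= c -> c <= b -> cts_on a b phi ->
  cint a b phi = cint a c phi + cint c b phi.
Proof.
move=> ac cb H; apply: cplx_ext; rewrite ?reD ?imD /cint !reimE; apply: Rint_split => //.
  exact: cts_on_re.
exact: cts_on_im.
Qed.

Lemma Rint_bound a b u (M : R) : a <= b -> cts_on a b u ->
  (forall t, a <= t <= b -> `|u t| <= M) ->
  `|\int[mu]_(t in `[a, b]) u t| <= M * (b - a).
Proof.
move=> ab uc uM; rewrite (le_trans (le_normr_Rintegral _ (cts_on_integrable uc)))//.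
have -> : M * (b - a) = \int[mu]_(t in `[a, b]) M.
  rewrite Rintegral_cst//= lebesgue_measure_itv/= lte_fin.
  by case: ltgtP ab => //= ->; rewrite subrr.
apply: le_Rintegral => //.
- by apply: cts_on_integrable => t tab; apply: cvg_norm; exact: uc.
- by apply: cts_on_integrable => t tab; exact: cvg_cst.
Qed.

(** The factor 2 is the price of treating real and imaginary parts separately; Goursat's theorem and
    Cauchy's estimate tolerate it. *)
Lemma cint_bound a b phi (M : R) : a <= b -> cts_on a b phi ->
  (forall t, a <= t <= b -> cabs (phi t) <= M) ->
  cabs (cint a b phi) <= 2 * (M * (b - a)).
Proof.
move=> ab H HM; rewrite (le_trans (cabs_re_im _))// /cint !reimE mulr_natl mulr2n lerD//;
apply: Rint_bound => //; [exact: cts_on_re|move=> t /HM|exact: cts_on_im|move=> t /HM];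
  apply: le_trans; [exact: re_cabs|exact: im_cabs].
Qed.

End ComplexIntegral.

Arguments cint : simpl never.

(** * Goursat's theorem on rectangles *)

Section Goursat.
Context {R : realType}.
Local Notation C := (Cplx R).
Implicit Types (g : C -> C) (x y : R).

(* The integral of [g z dz] along the boundary of the rectangle. *)
Definition bdint g x1 x2 y1 y2 : C :=
  cint x1 x2 (fun x => g (cpt x y1) - g (cpt x y2)) +
  cpt 0 1 * cint y1 y2 (fun y => g (cpt x2 y) - g (cpt x1 y)).

Arguments bdint : simpl never.

Definition holo_rect g x1 x2 y1 y2 := forall x y,
  x1 <= x <= x2 -> y1 <= y <= y2 -> derivable g (cpt x y) (1 : C).

Lemma derivable_cvg g (z : C) : derivable g z 1 -> g x @[x --> z] --> g z.
Proof. by move=> /derivable1_diffP/differentiable_continuous. Qed.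

Lemma cvg_cplx_l x y : (cpt t y) @[t --> x] --> (cpt x y).
Proof. apply: cvg_re_im; [exact: cvg_id|exact: cvg_cst]. Qed.

Lemma cvg_cplx_r x y : (cpt x t) @[t --> y] --> (cpt x y).
Proof. apply: cvg_re_im; [exact: cvg_cst|exact: cvg_id]. Qed.

Lemma holo_rect_ctsx g x1 x2 y1 y2 y : holo_rect g x1 x2 y1 y2 -> y1 <= y <= y2 ->
  cts_on x1 x2 (fun x => g (cpt x y)).
Proof.
move=> gh yy x xx; apply: (cvg_comp _ _ (@cvg_cplx_l x y)).
by apply: derivable_cvg; exact: gh.
Qed.

Lemma holo_rect_ctsy g x1 x2 y1 y2 x : holo_rect g x1 x2 y1 y2 -> x1 <= x <= x2 ->
  cts_on y1 y2 (fun y => g (cpt x y)).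
Proof.
move=> gh xx y yy; apply: (cvg_comp _ _ (@cvg_cplx_r x y)).
by apply: derivable_cvg; exact: gh.
Qed.

Lemma sub_split (V : zmodType) (a b c : V) : a - b = (a - c) + (c - b).
Proof. by rewrite addrA subrK. Qed.

Lemma bdint_splitx g x1 x2 y1 y2 x : holo_rect g x1 x2 y1 y2 ->
  x1 <= x -> x <= x2 -> y1 <= y2 ->
  bdint g x1 x2 y1 y2 = bdint g x1 x y1 y2 + bdint g x x2 y1 y2.
Proof.
move=> gh xl xr yy; rewrite /bdint (cint_split xl xr); last first.
  by apply: cts_onB; apply: holo_rect_ctsx gh _; rewrite lexx yy.
have c1 : cts_on y1 y2 (fun y => g (cpt x2 y) - g (cpt x y)).
  by apply: cts_onB; apply: holo_rect_ctsy gh _; rewrite ?xl ?lexx ?(le_trans xl).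
have c2 : cts_on y1 y2 (fun y => g (cpt x y) - g (cpt x1 y)).
  by apply: cts_onB; apply: holo_rect_ctsy gh _; rewrite ?xl ?lexx ?(le_trans xl).
rewrite [X in _ + _ * X = _](_ : _ = cint y1 y2 (fun y => g (cpt x2 y) - g (cpt x y)) +
  cint y1 y2 (fun y => g (cpt x y) - g (cpt x1 y))); first by ring.
by rewrite -(cintD c1 c2); apply: eq_cint => t _; exact: sub_split.
Qed.

Lemma bdint_splity g x1 x2 y1 y2 y : holo_rect g x1 x2 y1 y2 ->
  y1 <= y -> y <= y2 -> x1 <= x2 ->
  bdint g x1 x2 y1 y2 = bdint g x1 x2 y1 y + bdint g x1 x2 y y2.
Proof.
move=> gh yl yr xx; rewrite /bdint (cint_split yl yr); last first.
  by apply: cts_onB; apply: holo_rect_ctsy gh _; rewrite lexx xx.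
have c1 : cts_on x1 x2 (fun x => g (cpt x y1) - g (cpt x y)).
  by apply: cts_onB; apply: holo_rect_ctsx gh _; rewrite ?yl ?lexx ?(le_trans yl).
have c2 : cts_on x1 x2 (fun x => g (cpt x y) - g (cpt x y2)).
  by apply: cts_onB; apply: holo_rect_ctsx gh _; rewrite ?yl ?lexx ?(le_trans yl).
rewrite [X in X + _ = _](_ : _ = cint x1 x2 (fun x => g (cpt x y1) - g (cpt x y)) +
  cint x1 x2 (fun x => g (cpt x y) - g (cpt x y2))); first by ring.
by rewrite -(cintD c1 c2); apply: eq_cint => t _; exact: sub_split.
Qed.

Lemma holo_rectS g x1 x2 y1 y2 x1' x2' y1' y2' : holo_rect g x1 x2 y1 y2 ->
  x1 <= x1' -> x2' <= x2 -> y1 <= y1' -> y2' <= y2 ->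
  holo_rect g x1' x2' y1' y2'.
Proof.
move=> gh a b c d x y /andP[xl xr] /andP[yl yr].
by apply: gh; rewrite ?(le_trans a) ?(le_trans _ b) ?(le_trans c) ?(le_trans _ d).
Qed.

(** Bisect in both directions: the four boundary integrals add up to the whole one, so they cannot
    all be smaller than [c / 4]. *)
Lemma bdint_quarter g x y (w h c : R) : 0 <= w -> 0 <= h ->
  holo_rect g x (x + w) y (y + h) -> c <= cabs (bdint g x (x + w) y (y + h)) ->
  exists s : R * R, [/\ x <= s.1, s.1 + w / 2 <= x + w, y <= s.2, s.2 + h / 2 <= y + h
    & c / 4 <= cabs (bdint g s.1 (s.1 + w / 2) s.2 (s.2 + h / 2))].
Proof.
move=> w0 h0 gh cA.
have w20 : 0 <= w / 2 by rewrite divr_ge0.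
have h20 : 0 <= h / 2 by rewrite divr_ge0.
have xm : x + w / 2 + w / 2 = x + w by rewrite -addrA -splitr.
have ym : y + h / 2 + h / 2 = y + h by rewrite -addrA -splitr.
have l1 : x <= x + w / 2 by rewrite lerDl.
have l2 : x + w / 2 <= x + w by rewrite -xm lerDl.
have l3 : y <= y + h / 2 by rewrite lerDl.
have l4 : y + h / 2 <= y + h by rewrite -ym lerDl.
have l5 := le_trans l1 l2; have l6 := le_trans l3 l4.
have E := bdint_splitx gh l1 l2 l6.
rewrite (bdint_splity (holo_rectS gh (lexx _) l2 (lexx _) (lexx _)) l3 l4 l1) in E.
rewrite (bdint_splity (holo_rectS gh l1 (lexx _) (lexx _) (lexx _)) l3 l4 l2) in E.
rewrite {}E in cA; apply: contrapT => /forallNP N.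
have {}N a b : x <= a -> a + w / 2 <= x + w -> y <= b -> b + h / 2 <= y + h ->
    cabs (bdint g a (a + w / 2) b (b + h / 2)) < c / 4.
  by move=> ? ? ? ?; rewrite ltNge; apply/negP => ?; apply: (N (a, b)).
have N1 := N x y (lexx _) l2 (lexx _) l4.
have N2 := N x (y + h / 2) (lexx _) l2 l3 _.
have N3 := N (x + w / 2) y l1 _ (lexx _) l4.
have N4 := N (x + w / 2) (y + h / 2) l1 _ l3 _.
rewrite ym xm in N2 N3 N4.
have := le_lt_trans cA (le_lt_trans (cabsD _ _) (ltrD (le_lt_trans (cabsD _ _)
  (ltrD N1 (N2 (lexx _)))) (le_lt_trans (cabsD _ _) (ltrD (N3 (lexx _)) (N4 (lexx _) (lexx _)))))).
move: c {cA N N1 N2 N3 N4} => c; lra.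
Qed.

(** The affine part of [g] at [z0] has boundary integral zero. The remainder is at most
    [e * (w + h)]; taking the difference of opposite sides doubles this and [cint_bound] doubles it
    again, whence the 4. *)
Lemma bdint_local g (z0 l : C) x y (w h e : R) : 0 <= w -> 0 <= h -> 0 <= e ->
  x <= complex.Re z0 <= x + w -> y <= complex.Im z0 <= y + h ->
  holo_rect g x (x + w) y (y + h) ->
  (forall z : C, x <= complex.Re z <= x + w -> y <= complex.Im z <= y + h ->
     cabs (g z - g z0 - l * (z - z0)) <= e * cabs (z - z0)) ->
  cabs (bdint g x (x + w) y (y + h)) <= 4 * e * (w + h) ^+ 2.
Proof.
move=> w0 h0 e0 zx zy gh H.
have xx : x <= x <= x + w by rewrite lexx lerDl.
have xx' : x <= x + w <= x + w by rewrite lexx lerDl w0.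
have yy : y <= y <= y + h by rewrite lexx lerDl.
have yy' : y <= y + h <= y + h by rewrite lexx lerDl h0.
have K : forall z : C, x <= complex.Re z <= x + w -> y <= complex.Im z <= y + h ->
     cabs (g z - g z0 - l * (z - z0)) <= e * (w + h).
  move=> z zxx zyy; rewrite (le_trans (H _ zxx zyy))// ler_wpM2l//.
  rewrite (le_trans (cabs_re_im _))// reD imD reN imN lerD// ler_norml.
    by move: zx zxx => /andP[? ?] /andP[? ?]; apply/andP; split; lra.
  by move: zy zyy => /andP[? ?] /andP[? ?]; apply/andP; split; lra.
(* The constant term of the affine part cancels between opposite sides. The linear term contributes
   [l] times the vector joining the two sides, which is subtracted here. *)
pose r1 (t : R) : C := g (cpt t y) - g (cpt t (y + h)) - l * (cpt 0 (- h)).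
pose r2 (t : R) : C := g (cpt (x + w) t) - g (cpt x t) - l * cre w.
have cc (c : C) (a b : R) : cts_on a b (fun=> c) by move=> t _; exact: cvg_cst.
have r1c : cts_on x (x + w) r1.
  apply: (@cts_onB _ _ _ _ (fun=> _)) => //.
  by apply: cts_onB; exact: holo_rect_ctsx gh _.
have r2c : cts_on y (y + h) r2.
  apply: (@cts_onB _ _ _ _ (fun=> _)) => //.
  by apply: cts_onB; exact: holo_rect_ctsy gh _.
have -> : bdint g x (x + w) y (y + h) =
    cint x (x + w) r1 + cpt 0 1 * cint y (y + h) r2.
  rewrite /bdint (_ : cint x _ _ = cint x (x + w) (fun t => r1 t + l * (cpt 0 (- h)))); last first.
    by apply: eq_cint => t _; rewrite subrK.
  rewrite (_ : cint y _ _ = cint y (y + h) (fun t => r2 t + l * cre w)); last first.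
    by apply: eq_cint => t _; rewrite subrK.
  rewrite (cintD r1c (cc _ _ _)) (cintD r2c (cc _ _ _)) !cint_cst ?lerDl//.
  rewrite [x + w]addrC addrK [y + h]addrC addrK mulrDr.
  set I1 := cint _ _ _; set I2 := cint _ _ _.
  (* The linear contributions of the two pairs of sides cancel, as [w (- i h) + i h w = 0]. *)
  have E : (cre w : C) * (l * (cpt 0 (- h))) + cpt 0 1 * (h%:C * (l * cre w)) = 0.
    by apply: cplx_ext; rewrite !reimE; ring.
  by rewrite addrACA E addr0.
pose ea z := g z - g z0 - l * (z - z0).
have r1b t : x <= t <= x + w -> cabs (r1 t) <= 2 * (e * (w + h)).
  move=> tx; have -> : r1 t = ea (cpt t y) - ea (cpt t (y + h)).
    rewrite /r1 /ea (_ : cpt 0 (- h) = cpt t y - cpt t (y + h)); first by ring.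
    by apply: cplx_ext; rewrite !reimE; ring.
  rewrite mulr_natl mulr2n (le_trans (cabsBD _ _))// lerD//; exact: K.
have r2b t : y <= t <= y + h -> cabs (r2 t) <= 2 * (e * (w + h)).
  move=> ty; have -> : r2 t = ea (cpt (x + w) t) - ea (cpt x t).
    rewrite /r2 /ea (_ : cre w = cpt (x + w) t - cpt x t); first by ring.
    by apply: cplx_ext; rewrite !reimE; ring.
  rewrite mulr_natl mulr2n (le_trans (cabsBD _ _))// lerD//; exact: K.
have B1 := cint_bound (_ : x <= x + w) r1c r1b.
have B2 := cint_bound (_ : y <= y + h) r2c r2b.
rewrite (le_trans (cabsD _ _))// cabsM (_ : cabs (cpt 0 1) = 1); last first.
  by rewrite cabsE/= expr0n/= add0r expr1n sqrtr1.
move: B1 B2; rewrite !lerDl => /(_ w0) B1 /(_ h0) B2.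
rewrite mul1r (le_trans (lerD B1 B2))// le_eqVlt; apply/orP; left; apply/eqP; ring.
Qed.

Lemma lt_exprn2 (a d : R) : 0 < d -> exists m : nat, a / 2 ^+ m < d.
Proof.
move=> d0; exists (Num.bound (a / d)).
rewrite ltr_pdivrMr ?exprn_gt0// mulrC -ltr_pdivrMr//.
have [a0|a0] := leP (a / d) 0; first by rewrite (le_lt_trans a0)// exprn_gt0.
rewrite (lt_le_trans (archi_boundP (ltW a0)))//.
by rewrite -natrX ler_nat ltnW// ltn_expl.
Qed.

Theorem goursat g x1 x2 y1 y2 : x1 <= x2 -> y1 <= y2 ->
  holo_rect g x1 x2 y1 y2 -> bdint g x1 x2 y1 y2 = 0.
Proof.
move=> xx yy gh; apply: contrapT => /eqP; rewrite -cabs_gt0 => c0.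
set c := cabs _ in c0.
pose w m := (x2 - x1) / 2 ^+ m; pose h m := (y2 - y1) / 2 ^+ m.
have w0 m : 0 <= w m by rewrite divr_ge0 ?exprn_ge0// subr_ge0.
have h0 m : 0 <= h m by rewrite divr_ge0 ?exprn_ge0// subr_ge0.
have wS m : w m.+1 = w m / 2 by rewrite /w exprSr invfM mulrA.
have hS m : h m.+1 = h m / 2 by rewrite /h exprSr invfM mulrA.
pose Q m (s : R * R) := [/\ x1 <= s.1, s.1 + w m <= x2, y1 <= s.2, s.2 + h m <= y2
  & c / 4 ^+ m <= cabs (bdint g s.1 (s.1 + w m) s.2 (s.2 + h m))].
(* [choice] needs a successor for every rectangle, hence the implication: one without property [Q]
   may be sent anywhere. *)
have step (ms : nat * (R * R)) : exists s' : R * R, Q ms.1 ms.2 ->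
  [/\ Q ms.1.+1 s', ms.2.1 <= s'.1, s'.1 + w ms.1.+1 <= ms.2.1 + w ms.1,
     ms.2.2 <= s'.2 & s'.2 + h ms.1.+1 <= ms.2.2 + h ms.1].
  case: ms => m [x y] /=; have [q|nq] := pselect (Q m (x, y)); last by exists (0, 0).
  have [/= a1 a2 a3 a4 a5] := q.
  have [] := @bdint_quarter g x y (w m) (h m) (c / 4 ^+ m) (w0 m) (h0 m) _ a5.
    exact: holo_rectS gh _ _ _ _.
  move=> s [b1 b2 b3 b4 b5]; exists s => _; rewrite /Q wS hS; split => //; split.
  - by rewrite (le_trans a1).
  - by rewrite (le_trans b2).
  - by rewrite (le_trans a3).
  - by rewrite (le_trans b4).
  - by rewrite exprSr invfM mulrA.
have [F HF] := choice step.
pose s := fix s m := if m is m'.+1 then F (m', s m') else (x1, y1).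
have sQ m : Q m (s m).
  elim: m => [|m IH]; last by have [] := HF (m, s m) IH.
  split => //=; rewrite /w/h !expr0 !divr1 ?[x1 + _]addrC ?[y1 + _]addrC ?subrK//.
have sM m : [/\ (s m).1 <= (s m.+1).1, (s m.+1).1 + w m.+1 <= (s m).1 + w m,
     (s m).2 <= (s m.+1).2 & (s m.+1).2 + h m.+1 <= (s m).2 + h m].
  by have [_ ? ? ? ?] := HF (m, s m) (sQ m).
have nest (u : nat -> R) (v : nat -> R) : (forall m, 0 <= v m) ->
    (forall m, u m <= u m.+1) -> (forall m, u m.+1 + v m.+1 <= u m + v m) ->
    exists l, forall m, u m <= l <= u m + v m.
  move=> v0 ui vi; exists (sup (range u)).
  have um : {homo u : m k / (m <= k)%N >-> m <= k}.
    by apply: homo_leq => //; exact: le_trans.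
  have vm k m : (m <= k)%N -> u k + v k <= u m + v m.
    elim: k => [|k IH]; first by rewrite leqn0 => /eqP ->.
    rewrite leq_eqVlt => /predU1P[->//|]; rewrite ltnS => /IH; exact: le_trans.
  have ub m : ubound (range u) (u m + v m).
    move=> _ [k _ <-]; have [mk|/ltnW km] := leqP m k.
      by rewrite (le_trans _ (vm _ _ mk))// lerDl.
    by rewrite (le_trans (um _ _ km))// lerDl.
  move=> m; apply/andP; split.
    apply: ub_le_sup; last by exists m.
    by exists (u 0%N + v 0%N); exact: ub.
  apply: ge_sup => //; by exists (u 0%N); exists 0%N.
have [a Ha] := nest (fun m => (s m).1) w w0 (fun m => let: And4 p _ _ _ := sM m in p)
  (fun m => let: And4 _ p _ _ := sM m in p).
have [b Hb] := nest (fun m => (s m).2) h h0 (fun m => let: And4 _ _ p _ := sM m in p)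
  (fun m => let: And4 _ _ _ p := sM m in p).
have da : derivable g (cpt a b) 1.
  have [/= p1 p2 p3 p4 _] := sQ 0%N; apply: gh.
    by have /andP[q1 q2] := Ha 0%N; rewrite (le_trans p1)// (le_trans q2).
  by have /andP[q1 q2] := Hb 0%N; rewrite (le_trans p3)// (le_trans q2).
pose T := (x2 - x1) + (y2 - y1).
(* This gives [4 e T^2 < c], while stage [m] yields [c / 4^m <= 4 e (T / 2^m)^2]. The added 1 covers
   a degenerate rectangle with [T = 0]. *)
pose e := c / (8 * T ^+ 2 + 1).
have T20 : 0 < 8 * T ^+ 2 + 1 by rewrite ltr_wpDl// mulr_ge0// sqr_ge0.
have e0 : 0 < e by rewrite divr_gt0.
have [d d0 Hd] := (is_deriveP _ _ _).1 (derivableP da) e e0.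
have [m Hm] := lt_exprn2 T d0.
have wh : w m + h m = T / 2 ^+ m by rewrite /w /h -mulrDl.
have [p1 p2 p3 p4 p5] := sQ m.
have := @bdint_local g (cpt a b) ('D_1 g (cpt a b)) (s m).1 (s m).2 (w m) (h m) e
  (w0 m) (h0 m) (ltW e0) (Ha m) (Hb m) (holo_rectS gh p1 p2 p3 p4).
apply/not_implyP; split; last first.
  move=> K; have := le_trans p5 K; rewrite wh exprMn exprVn -exprM mulnC exprM -[2 ^+ 2]natrX.
  rewrite [4 * e * _]mulrA ler_pM2r ?invr_gt0 ?exprn_gt0// leNgt => /negP; apply.
  have cE : c = 8 * (e * T ^+ 2) + e by rewrite /e; field; rewrite gt_eqF.
  move: (mulr_ge0 (ltW e0) (sqr_ge0 T)); rewrite [ltRHS]cE; lra.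
move=> z /andP[u1 u2] /andP[v1 v2]; apply: Hd.
  rewrite (le_lt_trans _ Hm)// -wh (le_trans (cabs_re_im _))// reD imD reN imN.
  have /andP[q1 q2] := Ha m; have /andP[r1 r2] := Hb m.
  by rewrite !reimE lerD// ler_norml; move: q1 q2 r1 r2 u1 u2 v1 v2; clear => *; apply/andP; split; lra.
Qed.

End Goursat.

(** * Rules for the complex derivative *)

Section ComplexDerivatives.
Context {R : realType}.
Local Notation C := (Cplx R).
Implicit Types (z w a l m : C) (f g h : C -> C).

Definition is_cd f z l := is_derive z (1 : C) f l.

Lemma cdP f z l : is_cd f z l <->
  forall e : R, 0 < e -> exists2 d : R, 0 < d & forall w, cabs (w - z) < d ->
    cabs (f w - f z - l * (w - z)) <= e * cabs (w - z).
Proof. exact: is_deriveP. Qed.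

Lemma cd_ex f z : derivable f z 1 -> is_cd f z (derive1 f z).
Proof. by move=> /derivableP; rewrite derive1E. Qed.

Lemma cd_derivable f z l : is_cd f z l -> derivable f z 1.
Proof. by case. Qed.

Lemma cd_val f z l : is_cd f z l -> derive1 f z = l.
Proof. by rewrite derive1E; case. Qed.

Lemma cd_id z : is_cd id z 1.
Proof. exact: is_derive_id. Qed.

Lemma cd_cst c z : is_cd (fun=> c) z 0.
Proof. exact: is_derive_cst. Qed.

Lemma cdD f g z l m : is_cd f z l -> is_cd g z m -> is_cd (fun w => f w + g w) z (l + m).
Proof. exact: is_deriveD. Qed.

Lemma cdB f g z l m : is_cd f z l -> is_cd g z m -> is_cd (fun w => f w - g w) z (l - m).
Proof. exact: is_deriveB. Qed.

Lemma cdM f g z l m : is_cd f z l -> is_cd g z m ->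
  is_cd (fun w => f w * g w) z (l * g z + f z * m).
Proof.
move=> fl gm; have H := is_deriveM fl gm; apply: (@is_derive_eq _ _ _ _ _ _ _ _ H).
by rewrite addrC; congr (_ + _); exact: mulrC.
Qed.

Lemma cdZ f z l c : is_cd f z l -> is_cd (fun w => c * f w) z (c * l).
Proof.
move=> fl; have := cdM (cd_cst c z) fl; by rewrite mul0r add0r.
Qed.

Lemma cdV f z l : f z != 0 -> is_cd f z l -> is_cd (fun w => (f w)^-1) z (- l / f z ^+ 2).
Proof.
move=> f0 [fd fE]; split; first exact: derivableV.
rewrite [LHS](deriveV f0 fd) fE; rewrite mulNr mulrC; exact: mulNr.
Qed.

Lemma cdX f z l n : is_cd f z l -> is_cd (fun w => f w ^+ n.+1) z (n.+1%:R * f z ^+ n * l).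
Proof.
move=> fl; elim: n => [|n IH].
  by rewrite expr0 mulr1 mul1r; under eq_fun do rewrite expr1.
under eq_fun do rewrite exprS.
have := cdM fl IH; congr is_cd; rewrite -[in RHS]natr1 exprS; ring.
Qed.

Lemma cd_comp f g z l m : is_cd f z l -> is_cd g (f z) m ->
  is_cd (fun w => g (f w)) z (m * l).
Proof.
move=> /cdP fl /cdP gm; apply/cdP => e e0.
have l0 : 0 < cabs l + 1 by rewrite ltr_wpDl// cabs_ge0.
have m0 : 0 < cabs m + 1 by rewrite ltr_wpDl// cabs_ge0.
have e2 : 0 < e / 2 by rewrite divr_gt0.
have [d1 d10 H1] := gm _ (divr_gt0 e2 l0).
have [d2 d20 H2] := fl _ (divr_gt0 e2 m0).
(* Tolerance 1 gives the Lipschitz bound [|f w - f z| <= (|l| + 1) |w - z|], which brings [f w] into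
   the range of the estimate for [g]. *)
have [d3 d30 H3] := fl _ (@ltr01 R).
exists (Num.min d2 (Num.min d3 (d1 / (cabs l + 1)))).
  by rewrite !lt_min d20 d30 divr_gt0.
move=> w; rewrite !lt_min => /and3P[w2 w3]; rewrite ltr_pdivlMr// => w1.
have fw : cabs (f w - f z) <= cabs (w - z) * (cabs l + 1).
  rewrite (_ : f w - f z = (f w - f z - l * (w - z)) + l * (w - z)); last by rewrite subrK.
  have := H3 _ w3; have := cabsD (f w - f z - l * (w - z)) (l * (w - z)).
  by rewrite cabsM; clear; lra.
have G := H1 _ (le_lt_trans fw w1).
rewrite (_ : _ - _ - _ = (g (f w) - g (f z) - m * (f w - f z)) +
  m * (f w - f z - l * (w - z))); last by ring.
rewrite (le_trans (cabsD _ _))// cabsM (splitr e) mulrDl lerD//.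
  rewrite (le_trans G)// (le_trans (ler_wpM2l (ltW (divr_gt0 e2 l0)) fw))//.
  by rewrite mulrCA divfK ?gt_eqF// mulrC.
rewrite (le_trans (ler_wpM2l (cabs_ge0 _) (H2 _ w2)))// mulrA ler_wpM2r ?cabs_ge0//.
by rewrite mulrA ler_pdivrMr// mulrC ler_pM2l// lerDl.
Qed.

Lemma cd_cvg f z l : is_cd f z l -> f x @[x --> z] --> f z.
Proof. by move=> /cd_derivable/derivable_cvg. Qed.

End ComplexDerivatives.

Section RealDerivatives.
Context {R : realType}.
Implicit Types (u : R -> R).

Lemma real_deriveP u (x l : R) : is_derive x 1 u l <->
  forall e : R, 0 < e -> exists2 d : R, 0 < d & forall y, `|y - x| < d ->
    `|u y - u x - l * (y - x)| <= e * `|y - x|.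
Proof.
have key : (h^-1 *: (u (h *: (1 : R) + x) - u x) @[h --> (0:R)^'] --> l) <->
  forall e : R, 0 < e -> exists2 d : R, 0 < d & forall y, `|y - x| < d ->
    `|u y - u x - l * (y - x)| <= e * `|y - x|.
  split.
    move=> /cvgrPdist_lt H e e0; have /nbhs_ballP[d /= d0 {}H] := H e e0.
    exists d => // w wz; have [->|wz0] := eqVneq w x.
      by rewrite !subrr mulr0 subr0 !normr0 mulr0.
    have wz1 : w - x != 0 by rewrite subr_eq0.
    have /= := H (w - x); rewrite -ball_normE/= sub0r normrN => /(_ wz wz1).
    rewrite [_ *: 1]mulr1 subrK => /ltW.
    rewrite -(ler_pM2r (_ : 0 < `|w - x|)) ?normr_gt0// -normrM mulrBl distrC.
    by rewrite mulrAC [X in X * _]mulVf// mul1r.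
  move=> H; apply/cvgrPdist_lt => e e0.
  have [d d0 {}H] := H _ (divr_gt0 e0 (ltr0Sn R 1)).
  apply/nbhs_ballP; exists d => //= w; rewrite -ball_normE/= sub0r normrN => wd w0.
  rewrite [_ *: 1]mulr1.
  have := H (w + x); rewrite addrK => /(_ wd).
  rewrite -(ler_pM2l (_ : 0 < `|w^-1|)) ?normr_gt0 ?invr_eq0// -normrM mulrBr.
  rewrite [in X in _ <= X -> _]mulrCA -normrM mulVf// normr1 mulr1.
  rewrite [in X in _ - X]mulrCA mulVf// mulr1 distrC => /le_lt_trans; apply.
  by rewrite ltr_pdivrMr// ltr_pMr// ltr1n.
split.
  by move=> [fd fE]; apply/key; rewrite -fE; exact: fd.
move=> /key H; split; first by apply/cvg_ex; exists l.
exact: cvg_lim H.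
Qed.

End RealDerivatives.

(** * The complex exponential *)

Section ComplexExponential.
Context {R : realType}.
Local Notation C := (Cplx R).

Definition cis (t : R) : C := cpt (cos t) (sin t).

Definition cexp (z : C) : C := cre (expR (complex.Re z)) * cis (complex.Im z).

Lemma cexpD (z w : C) : cexp (z + w) = cexp z * cexp w.
Proof.
by apply: cplx_ext; rewrite /cexp /cis !reimE expRD ?cosD ?sinD; ring.
Qed.

Lemma cabs_cis (t : R) : cabs (cis t) = 1.
Proof. by rewrite cabsE !reimE cos2Dsin2 sqrtr1. Qed.

Lemma cabs_cre (r : R) : cabs (cre r) = `|r|.
Proof. exact: cabs_real. Qed.

Lemma cabs_cexp (z : C) : cabs (cexp z) = expR (complex.Re z).
Proof. by rewrite cabsM cabs_cis mulr1 cabs_cre ger0_norm// expR_ge0. Qed.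

Lemma cexp0 : cexp 0 = 1.
Proof. by apply: cplx_ext; rewrite /cexp /cis !reimE expR0 cos0 sin0; ring. Qed.

Lemma cd_cexp0 : is_cd cexp 0 1.
Proof.
(* Six errors of size [k * cabs w] occur: three in the real part and three in the imaginary part. *)
apply/cdP => e e0; pose k := Num.min 1 (e / 6).
have k0 : 0 < k by rewrite lt_min ltr01 divr_gt0.
have k1 : k <= 1 by rewrite ge_min lexx.
have k6 : 6 * k <= e by rewrite mulrC -ler_pdivlMr// ge_min lexx orbT.
have [d1 d10 H1] := (real_deriveP _ _ _).1 (is_derive_expR (0 : R)) k k0.
have [d2 d20 H2] := (real_deriveP _ _ _).1 (is_derive_sin (0 : R)) k k0.
have [d3 d30 H3] := (real_deriveP _ _ _).1 (is_derive_cos (0 : R)) k k0.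
exists (Num.min (Num.min d1 d2) (Num.min d3 (k / 2))).
  by rewrite !lt_min d10 d20 d30 divr_gt0.
move=> w; rewrite subr0 !lt_min => /andP[/andP[w1 w2] /andP[w3 w4]].
pose x := complex.Re w; pose y := complex.Im w.
have xw : `|x| <= cabs w := re_cabs w; have yw : `|y| <= cabs w := im_cabs w.
have := H1 x; rewrite subr0 expR0 mul1r => /(_ (le_lt_trans xw w1)) E1.
have := H2 y; rewrite subr0 sin0 subr0 cos0 mul1r => /(_ (le_lt_trans yw w2)) E2.
have := H3 y; rewrite subr0 sin0 cos0 oppr0 mul0r subr0 => /(_ (le_lt_trans yw w3)) E3.
have x1 : `|expR x - 1| <= k.
  rewrite (_ : expR x - 1 = (expR x - 1 - x) + x); last by ring.
  rewrite (le_trans (ler_normD _ _))// (le_trans (lerD E1 (lexx _)))//.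
  rewrite -[X in _ + X]mul1r -mulrDl (@le_trans _ _ (2 * `|x|)) ?ler_wpM2r//; first by lra.
  by rewrite mulrC -ler_pdivlMr// (le_trans xw)// ltW.
have x2 : `|expR x| <= 2.
  rewrite (_ : expR x = (expR x - 1) + 1); last by ring.
  by rewrite (le_trans (ler_normD _ _))// normr1; lra.
rewrite cexp0 mul1r (le_trans (cabs_re_im _))// /cexp /cis !reimE -/x -/y.
rewrite (_ : _ - 1 - x = expR x * (cos y - 1) + (expR x - 1 - x)); last by ring.
rewrite (_ : _ - 0 - y = expR x * (sin y - y) + y * (expR x - 1)); last by ring.
have c0 := cabs_ge0 w.
have kx : k * `|x| <= k * cabs w by rewrite ler_wpM2l// ltW.
have ky : k * `|y| <= k * cabs w by rewrite ler_wpM2l// ltW.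
have A1 : `|expR x * (cos y - 1)| <= 2 * (k * cabs w).
  by rewrite normrM ler_pM// (le_trans E3).
have A2 : `|expR x * (sin y - y)| <= 2 * (k * cabs w).
  by rewrite normrM ler_pM// (le_trans E2).
have A3 : `|y * (expR x - 1)| <= k * cabs w by rewrite mulrC normrM ler_pM.
have := ler_normD (expR x * (cos y - 1)) (expR x - 1 - x).
have := ler_normD (expR x * (sin y - y)) (y * (expR x - 1)).
have : 6 * k * cabs w <= e * cabs w by rewrite ler_wpM2r.
by move: A1 A2 A3 E1 kx; rewrite -[6 * k * _]mulrA; clear; lra.
Qed.

Lemma cd_cexp (z : C) : is_cd cexp z (cexp z).
Proof.
have H : is_cd (fun w => cexp z * cexp (w - z)) z (cexp z * (1 * (1 - 0))).
  apply: cdZ; apply: (@cd_comp _ (fun w => w - z)); first exact: cdB (cd_id _) (cd_cst _ _).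
  rewrite subrr; exact: cd_cexp0.
move: H; rewrite subr0 !mulr1; congr is_cd; apply/funext => w.
by rewrite -cexpD addrC subrK.
Qed.

Lemma cvg_cis (t : R) : cis x @[x --> t] --> cis t.
Proof. apply: cvg_re_im; [exact: continuous_cos|exact: continuous_sin]. Qed.

End ComplexExponential.

Lemma cintB {R : realType} (a b : R) (phi psi : R -> Cplx R) :
  cts_on a b phi -> cts_on a b psi ->
  cint a b (fun t => phi t - psi t) = cint a b phi - cint a b psi.
Proof.
move=> H K; apply/eqP; rewrite eq_sym subr_eq; apply/eqP.
rewrite -(cintD (cts_onB H K) K); apply: eq_cint => t _.
exact/esym/subrK.
Qed.

(** * Integrals over circles and Cauchy's estimate *)

Section CircleMeans.
Context {R : realType}.
Local Notation C := (Cplx R).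
Implicit Types (z w a L : C) (f h : C -> C) (r : R).

Definition cdisc a r : set C := [set z | cabs (z - a) < r].

Lemma cdisc_center a r : 0 < r -> cdisc a r a.
Proof. by move=> r0; rewrite /cdisc/= subrr cabs0. Qed.

Lemma open_cdisc a r : open (cdisc a r).
Proof.
rewrite openE => z zr; apply/nbhs_cplxP; exists (r - cabs (z - a)).
  by rewrite subr_gt0.
move=> w; rewrite ltrBrDr => wz; apply: le_lt_trans wz.
exact: cabsBB.
Qed.

Lemma cdiscS a r z s : cabs (z - a) + s <= r -> cdisc z s `<=` cdisc a r.
Proof.
move=> H w wz; apply: lt_le_trans H; apply: (le_lt_trans (cabsBB z _ _)).
by rewrite addrC ltrD2l.
Qed.

(** With [z = a + r e^(it)] this is the integral of [h z dz / (i (z - a))], that is, [2 * pi] times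
    the mean of [h] over the circle. *)
Definition circ h a r : C := cint 0 (2 * pi) (fun t => h (a + cre r * cis t)).

Lemma cabs_circle a r t : 0 <= r -> cabs (a + cre r * cis t - a) = r.
Proof. by move=> r0; rewrite addrC addKr cabsM cabs_cis mulr1 cabs_cre ger0_norm. Qed.

Lemma cvg_circle a r t : (a + cre r * cis x) @[x --> t] --> a + cre r * cis t.
Proof.
apply: cvgD; first exact: cvg_cst.
by apply: cvgM; [exact: cvg_cst|exact: cvg_cis].
Qed.

Lemma circ_cts h a r : 0 <= r -> (forall z, cabs (z - a) = r -> derivable h z 1) ->
  cts_on 0 (2 * pi) (fun t => h (a + cre r * cis t)).
Proof.
move=> r0 H t _; apply: (cvg_comp _ _ (@cvg_circle a r t)).
by apply: derivable_cvg; apply: H; rewrite cabs_circle.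
Qed.

Let twopi_ge0 : 0 <= 2 * pi :> R.
Proof. by rewrite mulr_ge0// pi_ge0. Qed.

(* Goursat's theorem for [w |-> h (a + exp w)]: the two horizontal sides of the
   rectangle cancel by periodicity. *)
Lemma circ_const h a r1 r2 : 0 < r1 -> r1 <= r2 ->
  (forall z, r1 <= cabs (z - a) <= r2 -> derivable h z 1) ->
  circ h a r1 = circ h a r2.
Proof.
move=> r10 r12 H; have r20 := lt_le_trans r10 r12.
pose g w := h (a + cexp w).
have ln12 : ln r1 <= ln r2 by rewrite ler_ln.
have gh : holo_rect g (ln r1) (ln r2) 0 (2 * pi).
  move=> x y /andP[xl xr] _; apply: (@cd_derivable _ _ _ (derive1 h (a + cexp (cpt x y)) * (0 + cexp (cpt x y)))).
  apply: (@cd_comp _ (fun w => a + cexp w)).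
    by apply: cdD; [exact: cd_cst|exact: cd_cexp].
  apply: cd_ex; apply: H; rewrite addrC addKr cabs_cexp re_cpt.
  by rewrite -(lnK (x := r1))// -[X in _ && (_ <= X)](lnK (x := r2))// !ler_expR xl.
have := goursat ln12 twopi_ge0 gh; rewrite /bdint.
have per x : g (cpt x 0) - g (cpt x (2 * pi)) = 0.
  rewrite /g (_ : cexp (cpt x (2 * pi)) = cexp (cpt x 0)) ?subrr//.
  by rewrite /cexp /cis !re_cpt !im_cpt mulr_natl cos2pi sin2pi cos0 sin0.
rewrite (eq_cint (psi := fun=> 0)) => [|x _]; last exact: per.
rewrite cint_cst// mulr0 add0r => /eqP; rewrite mulf_eq0 => /orP[/eqP/(congr1 (@complex.Im R))/eqP|].
  by rewrite im_cpt im0 oner_eq0.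
have gE r t : 0 < r -> g (cpt (ln r) t) = h (a + cre r * cis t).
  by move=> r0; rewrite /g /cexp re_cpt im_cpt lnK.
have c1 : cts_on 0 (2 * pi) (fun y => h (a + cre r2 * cis y)).
  by apply: circ_cts; [exact: ltW|move=> z zr; apply: H; rewrite zr lexx r12].
have c2 : cts_on 0 (2 * pi) (fun y => h (a + cre r1 * cis y)).
  by apply: circ_cts; [exact: ltW|move=> z zr; apply: H; rewrite zr lexx r12].
rewrite (eq_cint (psi := fun y => h (a + cre r2 * cis y) - h (a + cre r1 * cis y))); last first.
  by move=> t _; rewrite !gE.
by rewrite (cintB c1 c2) subr_eq0 => /eqP.
Qed.

Lemma circ_bound h a r M : 0 <= r -> (forall z, cabs (z - a) = r -> derivable h z 1) ->
  (forall z, cabs (z - a) = r -> cabs (h z) <= M) ->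
  cabs (circ h a r) <= 4 * pi * M.
Proof.
move=> r0 hd hM; have := cint_bound twopi_ge0 (circ_cts r0 hd).
move=> /(_ M) H; apply: le_trans (H _) _.
  by move=> t _; apply: hM; rewrite cabs_circle.
by rewrite subr0 le_eqVlt; apply/orP; left; apply/eqP; ring.
Qed.

(** By [circ_const] the circle can be shrunk until [h] is close to [L] on it. Nothing is asked at
    [a] itself, so difference quotients are admissible. *)
Lemma circ_lim h a r L : 0 < r ->
  (forall z, 0 < cabs (z - a) <= r -> derivable h z 1) ->
  (forall e : R, 0 < e -> exists2 d : R, 0 < d &
     forall z, 0 < cabs (z - a) < d -> cabs (h z - L) <= e) ->
  circ h a r = cre (2 * pi) * L.
Proof.
move=> r0 hd hL; apply/eqP; rewrite -subr_eq0 -cabs_eq0 eq_le cabs_ge0 andbT.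
apply/ler_addgt0Pl => e e0; rewrite addr0.
have pi4 : 0 < 4 * pi :> R by rewrite mulr_gt0// pi_gt0.
have [d d0 H] := hL _ (divr_gt0 e0 pi4).
pose s := Num.min r (d / 2).
have s0 : 0 < s by rewrite lt_min r0 divr_gt0.
have sr : s <= r by rewrite ge_min lexx.
have sd : s < d by rewrite gt_min ltr_pdivrMr// ltr_pMr// ltr1n orbT.
rewrite -(@circ_const h a s r)//; last first.
  by move=> z /andP[z1 z2]; apply: hd; rewrite z2 (lt_le_trans s0).
have hds z : cabs (z - a) = s -> derivable h z 1.
  by move=> zs; apply: hd; rewrite zs s0.
have -> : circ h a s - cre (2 * pi) * L = circ (fun z => h z - L) a s.
  rewrite /circ cintB; [|exact: circ_cts (ltW s0) hds|by move=> t _; exact: cvg_cst].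
  by rewrite cint_cst// subr0.
apply: le_trans (circ_bound (M := e / (4 * pi)) (ltW s0) _ _) _.
- move=> z /hds hz; apply: cd_derivable; apply: cdB (cd_ex hz) (cd_cst _ _).
- by move=> z zs; apply: H; rewrite zs s0.
- by rewrite mulrC divfK// gt_eqF.
Qed.

(** [circ_lim] applied to [(f z - f a) / (z - a)] expresses [derive1 f a] as a mean over a circle
    without Cauchy's formula. On the circle of radius [r / 2] this quotient is at most [4 M / r],
    and [circ_bound] loses a further factor 2. *)
Lemma cauchy_estimate f a r M : 0 < r -> (forall z, cdisc a r z -> derivable f z 1) ->
  (forall z, cdisc a r z -> cabs (f z) <= M) ->
  cabs (derive1 f a) <= 8 * M / r.
Proof.
move=> r0 fd fM.
have ra := cdisc_center a r0.
have M0 : 0 <= M by rewrite (le_trans (cabs_ge0 _) (fM _ ra)).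
pose h z := (f z - f a) / (z - a).
have r20 : 0 < r / 2 by rewrite divr_gt0.
have rr : r / 2 < r by rewrite ltr_pdivrMr// ltr_pMr// ltr1n.
have hd z : 0 < cabs (z - a) <= r / 2 -> derivable h z 1.
  move=> /andP[z0 zr]; have za : z - a != 0 by rewrite -cabs_gt0.
  have fz := cd_ex (fd z (le_lt_trans zr rr)).
  exact: cd_derivable (cdM (cdB fz (cd_cst (f a) z))
    (cdV (f := fun z => z - a) za (cdB (cd_id z) (cd_cst a z)))).
have hL : circ h a (r / 2) = cre (2 * pi) * derive1 f a.
  apply: circ_lim => // e e0.
  have [d d0 H] := (cdP _ _ _).1 (cd_ex (fd _ ra)) e e0.
  exists d => // z /andP[z0 zd]; have za : z - a != 0 by rewrite -cabs_gt0.
  rewrite -(ler_pM2r z0) -cabsM mulrBl divfK//; exact: H.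
have := circ_bound (h := h) (a := a) (M := 4 * M / r) (ltW r20).
rewrite hL cabsM cabs_cre ger0_norm// => H.
have P : 0 < 2 * pi :> R by rewrite mulr_gt0// pi_gt0.
rewrite -(ler_pM2l P) (le_trans (H _ _))//.
- by move=> z zr; apply: hd; rewrite zr r20 lexx.
- move=> z zr; rewrite cabsM cabsV zr ler_pdivrMr// (_ : 4 * M / r * (r / 2) = 2 * M).
    have := cabsBD (f z) (f a); have := fM _ ra.
    have : cabs (f z) <= M by apply: fM; rewrite /cdisc/= zr.
    by clear; lra.
  by field; rewrite gt_eqF.
- by rewrite le_eqVlt; apply/orP; left; apply/eqP; field; rewrite gt_eqF.
Qed.

End CircleMeans.

(** * The mean value inequality *)

Section MeanValue.
Context {R : realType}.
Local Notation C := (Cplx R).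
Implicit Types (z w a L : C) (f g h : C -> C) (r : R).

(** The mean value theorem is false for complex values, so it is applied along the segment to a real
    functional [phi] of [f], to be taken as the real or the imaginary part. *)
Lemma mvi_part (phi : C -> R) f z w (K : R) :
  (forall x y : C, phi (x - y) = phi x - phi y) ->
  (forall (s : R) (x : C), phi (cre s * x) = s * phi x) ->
  (forall x : C, `|phi x| <= cabs x) ->
  (forall t : R, 0 <= t <= 1 -> derivable f (z + cre t * (w - z)) 1 /\
     cabs (derive1 f (z + cre t * (w - z))) <= K) ->
  `|phi (f w - f z)| <= K * cabs (w - z).
Proof.
move=> pB pZ pn fd; pose g t := z + cre t * (w - z).
pose u t := phi (f (g t)); pose du t := phi (derive1 f (g t) * (w - z)).
have gB s t : g s - g t = cre (s - t) * (w - z).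
  by rewrite /g creB; ring.
have ud (t : R) : 0 <= t <= 1 -> is_derive t 1 u (du t).
  move=> /fd[ft _]; apply/real_deriveP => e e0.
  have k0 : 0 < cabs (w - z) + 1 by rewrite ltr_wpDl// cabs_ge0.
  have [d d0 H] := (cdP _ _ _).1 (cd_ex ft) _ (divr_gt0 e0 k0).
  exists (d / (cabs (w - z) + 1)); first exact: divr_gt0.
  move=> s; rewrite ltr_pdivlMr// => st.
  have gst : cabs (g s - g t) < d.
    rewrite gB cabsM cabs_cre (le_lt_trans _ st)// ler_wpM2l//; lra.
  rewrite (_ : u s - u t - du t * (s - t) =
    phi (f (g s) - f (g t) - derive1 f (g t) * (g s - g t))).
    rewrite (le_trans (pn _))// (le_trans (H _ gst))// gB cabsM cabs_cre.
    rewrite mulrC -mulrA mulrC ler_wpM2r// mulrCA -[leRHS]mulr1 ler_wpM2l ?ltW//.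
    by rewrite ltr_pdivrMr//; lra.
  rewrite !pB /u; congr (_ - _); rewrite /du gB mulrCA pZ; exact: mulrC.
have ud' (t : R) : t \in `]0, 1[%R -> is_derive t 1 u (du t).
  by rewrite in_itv/= => /andP[t0 t1]; apply: ud; rewrite !ltW.
have uc : {within `[0, 1], continuous u}.
  apply: continuous_in_subspaceT => t; rewrite inE/= in_itv/= => /ud[/derivable1_diffP].
  by move=> /differentiable_continuous.
have [c] := MVT_segment (@ler01 R) ud' uc.
rewrite in_itv/= subr0 mulr1 => c01 E.
have g1 : g 1 = w by rewrite /g cre1 mul1r addrC subrK.
have g0 : g 0 = z by rewrite /g cre0 mul0r addr0.
have -> : phi (f w - f z) = du c by rewrite pB -E /u g1 g0.
have [_ Kc] := fd c c01.
by rewrite (le_trans (pn _))// cabsM ler_wpM2r// cabs_ge0.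
Qed.

Lemma mean_value_ineq f a r (K : R) :
  (forall z, cdisc a r z -> derivable f z 1 /\ cabs (derive1 f z) <= K) ->
  forall z w, cdisc a r z -> cdisc a r w -> cabs (f w - f z) <= 2 * (K * cabs (w - z)).
Proof.
move=> fd z w zr wr.
have sd (t : R) : 0 <= t <= 1 -> cdisc a r (z + cre t * (w - z)).
  move=> /andP[t0 t1].
  rewrite /cdisc/= (_ : _ - _ = cre (1 - t) * (z - a) + cre t * (w - a)); last first.
    by rewrite creB cre1; ring.
  rewrite (le_lt_trans (cabsD _ _))// !cabsM !cabs_cre !ger0_norm ?subr_ge0//.
  move: zr wr; rewrite /cdisc/=; set A := cabs _; set B := cabs _ => zr wr.
  (* One of the weights [1 - t] and [t] is positive; its term makes the sum strictly smaller than
     [r]. *)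
  have [t12|t12] := leP t (1 / 2).
    have : (1 - t) * A < (1 - t) * r by rewrite ltr_pM2l//; lra.
    have : t * B <= t * r by rewrite ler_wpM2l// ltW.
    by clear; lra.
  have : (1 - t) * A <= (1 - t) * r by rewrite ler_wpM2l ?subr_ge0// ltW.
  have : t * B < t * r by rewrite ltr_pM2l//; lra.
  by clear; lra.
rewrite (le_trans (cabs_re_im _))// mulr_natl mulr2n lerD//.
  apply: mvi_part => [x y|s x|x|t /sd/fd//]; rewrite ?reimE ?mul0r ?subr0//.
  exact: re_cabs.
apply: mvi_part => [x y|s x|x|t /sd/fd//]; rewrite ?reimE ?mul0r ?addr0//.
exact: im_cabs.
Qed.

End MeanValue.

(** * Derivatives of holomorphic functions and leading terms *)

Section HolomorphicDerivative.
Context {R : realType}.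
Local Notation C := (Cplx R).
Implicit Types (z w a h k L : C) (f g : C -> C) (r : R) (D : set C).

Definition cauchy_sq (u : nat -> C) := forall e : R, 0 < e ->
  exists N : nat, forall m n, (N <= m)%N -> (N <= n)%N -> cabs (u m - u n) <= e.

Lemma real_cauchy_cvg (u : nat -> R) :
  (forall e : R, 0 < e ->
    exists N : nat, forall m n, (N <= m)%N -> (N <= n)%N -> `|u m - u n| <= e) ->
  cvg (u @ \oo).
Proof.
move=> H; apply/cauchy_cvgP; apply: cauchy_exP => e e0.
have [|N HN] := H (e / 2); first by rewrite divr_gt0.
exists (u N); exists N => // n /= Nn; rewrite -ball_normE/=.
by rewrite (le_lt_trans (HN _ _ (leqnn N) Nn))// ltr_pdivrMr// ltr_pMr// ltr1n.
Qed.

Lemma cauchy_sq_cvg (u : nat -> C) : cauchy_sq u -> exists l : C, u x @[x --> \oo] --> l.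
Proof.
move=> H.
have cr : cvg ((fun n => complex.Re (u n)) @ \oo).
  apply: real_cauchy_cvg => e /H[N HN]; exists N => m n Nm Nn.
  by rewrite -reN -reD (le_trans (re_cabs _))// HN.
have ci : cvg ((fun n => complex.Im (u n)) @ \oo).
  apply: real_cauchy_cvg => e /H[N HN]; exists N => m n Nm Nn.
  by rewrite -imN -imD (le_trans (im_cabs _))// HN.
exists (cpt (lim ((fun n => complex.Re (u n)) @ \oo)) (lim ((fun n => complex.Im (u n)) @ \oo))).
by apply: cvg_re_im.
Qed.

Lemma cvg_seqP (u : nat -> C) (l : C) : u x @[x --> \oo] --> l <->
  forall e : R, 0 < e -> exists N : nat, forall n, (N <= n)%N -> cabs (u n - l) < e.
Proof.
split.
  by move=> /cvg_cplxP H e /H[N _ HN]; exists N => n Nn; exact: HN.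
by move=> H; apply/cvg_cplxP => e /H[N HN]; exists N.
Qed.

Lemma seq_lim_le (u : nat -> C) (l c : C) (M : R) (N : nat) :
  u x @[x --> \oo] --> l -> (forall n, (N <= n)%N -> cabs (u n - c) <= M) ->
  cabs (l - c) <= M.
Proof.
move=> /cvg_seqP ul uM; apply/ler_addgt0Pl => e e0.
have [N' H] := ul e e0; pose n := maxn N N'.
apply: (le_trans (cabsBB (u n) _ _)); apply: lerD.
  by rewrite cabsB; apply/ltW/H; rewrite leq_maxr.
by apply: uM; rewrite leq_maxl.
Qed.

Lemma invn_lt (d : R) : 0 < d -> exists n : nat, forall m, (n <= m)%N -> m.+1%:R^-1 < d.
Proof.
move=> d0; have /cvgrPdist_lt/(_ d d0)[N _ HN] := @cvg_harmonic R.
by exists N => m /HN /=; rewrite sub0r normrN ger0_norm.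
Qed.

(** By completeness the quotients converge along one sequence of increments; the Cauchy bound,
    uniform in the increment, extends the convergence to all increments. *)
Lemma cauchy_quotient f a r (K : R) : 0 < r -> 0 <= K ->
  (forall h k : C, 0 < cabs h < r -> 0 < cabs k < r ->
     cabs ((f (a + h) - f a) / h - (f (a + k) - f a) / k) <= K * (cabs h + cabs k)) ->
  derivable f a 1.
Proof.
move=> r0 K0 H; pose q (h : C) := (f (a + h) - f a) / h.
(* [n.+2] keeps these increments strictly inside the disc, already for [n = 0]. *)
pose s (n : nat) : C := cre (r / n.+2%:R).
have sE n : cabs (s n) = r / n.+2%:R.
  by rewrite cabs_cre ger0_norm// divr_ge0// ltW.
have sr n : 0 < cabs (s n) < r.
  by rewrite sE divr_gt0//= ltr_pdivrMr// ltr_pMr// ltr1n.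
have s0 (d : R) : 0 < d -> exists N : nat, forall n, (N <= n)%N -> cabs (s n) < d.
  move=> d0; have [N HN] := invn_lt (divr_gt0 d0 r0).
  exists N => n Nn; rewrite sE mulrC -ltr_pdivlMr//; apply: HN.
  exact: leq_trans Nn _.
have [l ql] : exists l : C, q (s n) @[n --> \oo] --> l.
  apply: cauchy_sq_cvg => e e0.
  have K2 : 0 < 2 * (K + 1) by rewrite mulr_gt0// ltr_wpDl.
  have [N HN] := s0 _ (divr_gt0 e0 K2).
  exists N => m n Nm Nn; apply: le_trans (H _ _ (sr m) (sr n)) _.
  have := HN m Nm; have := HN n Nn; rewrite !ltr_pdivlMr// => A B.
  have := cabs_ge0 (s m); have := cabs_ge0 (s n).
  move: A B; clear; move: (cabs _) (cabs _) => x y; lra.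
apply: (@cd_derivable _ _ _ l); apply/cdP => e e0.
have K2 : 0 < 2 * K + 1 by rewrite ltr_wpDl// mulr_ge0.
exists (Num.min r (e / (2 * K + 1))); first by rewrite lt_min r0 divr_gt0.
move=> w; rewrite lt_min => /andP[wr]; rewrite ltr_pdivlMr// => we.
have [->|wa] := eqVneq w a; first by rewrite !subrr mulr0 subr0 cabs0 mulr0.
have w0 : 0 < cabs (w - a) by rewrite cabs_gt0 subr_eq0.
have [N HN] := s0 _ w0.
have : cabs (l - q (w - a)) <= K * (cabs (w - a) + cabs (w - a)).
  apply: (seq_lim_le (N := N) ql) => n Nn.
  apply: le_trans (H _ _ (sr n) _) _; first by rewrite w0.
  by rewrite ler_wpM2l// lerD2r ltW// HN.
rewrite cabsB -(ler_pM2r w0) -cabsM mulrBl /q divfK -?cabs_gt0//.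
rewrite (_ : a + (w - a) = w); last by rewrite addrC subrK.
move=> /le_trans; apply; rewrite ler_wpM2r ?ltW//.
by move: we w0; clear; lra.
Qed.

(** Cauchy's estimate bounds a derivative by the function. Used on [f], then on the difference
    quotients [q h], then on [q h - q k], it shows in turn that [derive1 f] is bounded, Lipschitz,
    and has Cauchy difference quotients. *)
Lemma holomorphic_derive_disc f a r : 0 < r ->
  (forall z, cdisc a r z -> derivable f z 1) -> derivable (derive1 f) a 1.
Proof.
move=> r0 fd; have ra := cdisc_center a r0.
have /cvg_cplxP/(_ 1 ltr01)/nbhs_cplxP[d d0 fa1] := derivable_cvg (fd _ ra).
(* Four concentric discs of radii [s] to [4 * s] are used: each Cauchy estimate, and each shift by
   [h], costs a margin [s]. On the largest, [f] is bounded by continuity at [a]. *)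
pose s := Num.min r d / 4; pose M := cabs (f a) + 1.
have s0 : 0 < s by rewrite divr_gt0// lt_min r0.
have s4r : 4 * s <= r by rewrite /s mulrCA mulfV ?mulr1 ?ge_min ?lexx.
have s4d : 4 * s <= d by rewrite /s mulrCA mulfV ?mulr1 ?ge_min ?lexx ?orbT.
have M0 : 0 <= M by rewrite addr_ge0 ?cabs_ge0.
have fd4 z : cdisc a (4 * s) z -> derivable f z 1.
  by move=> H; apply: fd; exact: lt_le_trans H s4r.
have fM z : cdisc a (4 * s) z -> cabs (f z) <= M.
  move=> H; have /= := fa1 z (lt_le_trans H s4d).
  have := cabsD (f z - f a) (f a); rewrite subrK /M; lra.
pose K1 := 8 * M / s.
have K10 : 0 <= K1 by rewrite divr_ge0 ?(ltW s0)// mulr_ge0.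
have f1 z : cdisc a (3 * s) z -> cabs (derive1 f z) <= K1.
  move=> zs; have zS : cdisc z s `<=` cdisc a (4 * s).
    by apply: cdiscS; move: zs; rewrite /cdisc/=; lra.
  by apply: cauchy_estimate s0 _ _ => w /zS; [exact: fd4|exact: fM].
pose q h z := (f (z + h) - f z) / h.
have shift z h : cdisc a (2 * s) z -> cabs h < s -> cdisc a (3 * s) (z + h).
  move=> zs hs; rewrite /cdisc/= (_ : z + h - a = (z - a) + h); last by ring.
  apply: le_lt_trans (cabsD _ _) _; move: zs hs; rewrite /cdisc/=; lra.
have sub23 z : cdisc a (2 * s) z -> cdisc a (3 * s) z.
  by rewrite /cdisc/= => H; apply: lt_trans H _; lra.
have sub34 z : cdisc a (3 * s) z -> cdisc a (4 * s) z.
  by rewrite /cdisc/= => H; apply: lt_trans H _; lra.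
have sub12 z : cdisc a s z -> cdisc a (2 * s) z.
  by rewrite /cdisc/= => H; apply: lt_trans H _; lra.
have qd h z : h != 0 -> cabs h < s -> cdisc a (2 * s) z ->
    is_cd (q h) z ((derive1 f (z + h) - derive1 f z) / h).
  move=> h0 hs zs; rewrite /q.
  have A : is_cd (fun w => w + h) z 1.
    by have := cdD (cd_id z) (cd_cst h z); rewrite addr0.
  have B := cd_comp A (cd_ex (fd4 _ (sub34 _ (shift _ _ zs hs)))).
  have E := cdZ h^-1 (cdB B (cd_ex (fd4 _ (sub34 _ (sub23 _ zs))))).
  move: E; rewrite mulr1 mulrC; congr is_cd; apply/funext => w; exact: mulrC.
have qM h z : h != 0 -> cabs h < s -> cdisc a (2 * s) z -> cabs (q h z) <= 2 * K1.
  move=> h0 hs zs; rewrite cabsM cabsV ler_pdivrMr ?cabs_gt0//.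
  have := @mean_value_ineq _ f a (3 * s) K1 _ z (z + h) (sub23 _ zs) (shift _ _ zs hs).
  rewrite (_ : z + h - z = h); last by rewrite addrC addKr.
  rewrite mulrA; apply => w ws; split; [exact/fd4/sub34|exact: f1].
pose K2 := 8 * (2 * K1) / s.
have K20 : 0 <= K2 by apply: divr_ge0 (ltW s0); apply: mulr_ge0 => //; exact: mulr_ge0.
have subd z : cdisc a s z -> cdisc z s `<=` cdisc a (2 * s).
  by move=> zs; apply: cdiscS; move: zs; rewrite /cdisc/=; lra.
(* The derivative of [q h] is the difference quotient of [derive1 f], so bounding it makes
   [derive1 f] Lipschitz. *)
have f2 h z : cabs h < s -> cdisc a s z ->
    cabs (derive1 f (z + h) - derive1 f z) <= K2 * cabs h.
  move=> hs zs; have [->|h0] := eqVneq h 0.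
    by rewrite addr0 subrr cabs0 mulr0.
  rewrite -ler_pdivrMr ?cabs_gt0// -cabsV -cabsM -(cd_val (qd _ _ h0 hs (sub12 _ zs))).
  apply: cauchy_estimate s0 _ _ => w /(subd _ zs) ws.
    exact: cd_derivable (qd _ _ h0 hs ws).
  exact: qM.
pose K3 := 4 * K2.
(* The Lipschitz bound makes the derivative of [F] of order [|h|] on the disc of radius [2 |h|];
   hence [q h] tends to [derive1 f] uniformly, at linear rate. *)
have f3 h z : 0 < cabs h < s / 2 -> cdisc a s z ->
    cabs (q h z - derive1 f z) <= K3 * cabs h.
  move=> /andP[h0 hs] zs; pose F w := f w - derive1 f z * w.
  have hs2 : 2 * cabs h < s by rewrite mulrC -ltr_pdivlMr.
  have Fd w : cdisc z (2 * cabs h) w -> derivable F w 1 /\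
      cabs (derive1 F w) <= K2 * (2 * cabs h).
    rewrite /cdisc/= => wz.
    have := cdB (cd_ex (fd4 w _)) (cdZ (derive1 f z) (cd_id w)).
    rewrite mulr1 => /(_ _)[].
      apply/sub34/sub23/(subd _ zs); exact: lt_trans wz hs2.
    move=> A B; split => //; rewrite derive1E B.
    have := f2 (w - z) z (lt_trans wz hs2) zs.
    rewrite (_ : z + (w - z) = w); last by rewrite addrC subrK.
    by move=> /le_trans; apply; rewrite ler_wpM2l// ltW.
  have := mean_value_ineq Fd (cdisc_center z _) (_ : cdisc z (2 * cabs h) (z + h)).
  rewrite /cdisc/= (_ : z + h - z = h); last by rewrite addrC addKr.
  rewrite mulr_gt0// ltr_pMl// ltr1n => /(_ isT isT).
  rewrite (_ : F (z + h) - F z = (q h z - derive1 f z) * h); last first.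
    rewrite /F /q mulrBl divfK -?cabs_gt0//; ring.
  rewrite cabsM mulrA ler_pM2r// => /le_trans; apply.
  by rewrite /K3; lra.
pose K4 := 8 * K3 / s.
apply: (@cauchy_quotient _ _ (s / 2) K4); first exact: divr_gt0.
  by apply: divr_ge0 (ltW s0); apply: mulr_ge0 => //; exact: mulr_ge0.
move=> h k /andP[h0 hs] /andP[k0 ks].
have hs' : cabs h < s by apply: lt_trans hs _; rewrite ltr_pdivrMr// ltr_pMr// ltr1n.
have ks' : cabs k < s by apply: lt_trans ks _; rewrite ltr_pdivrMr// ltr_pMr// ltr1n.
have sa := cdisc_center a s0.
have h1 : h != 0 by rewrite -cabs_gt0.
have k1 : k != 0 by rewrite -cabs_gt0.
(* The derivative of [q h - q k] compares the quotients of [derive1 f] for [h] and [k], and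
   [q h - q k] is uniformly small by [f3]. *)
have qhk z : cdisc a (2 * s) z -> is_cd (fun w => q h w - q k w) z
    ((derive1 f (z + h) - derive1 f z) / h - (derive1 f (z + k) - derive1 f z) / k).
  by move=> zs; apply: cdB; exact: qd.
rewrite -(cd_val (qhk a (sub12 _ sa))).
rewrite /K4 (_ : _ * _ = 8 * (K3 * (cabs h + cabs k)) / s); last by ring.
apply: cauchy_estimate s0 _ _ => z zs; first exact: cd_derivable (qhk _ (sub12 _ zs)).
rewrite (_ : q h z - q k z = (q h z - derive1 f z) - (q k z - derive1 f z)); last by ring.
rewrite mulrDr; apply: le_trans (cabsBD _ _) _; apply: lerD; apply: f3 => //.
  by rewrite h0.
by rewrite k0.
Qed.

Lemma open_cdiscP D z : open D -> D z -> exists2 r : R, 0 < r & cdisc z r `<=` D.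
Proof.
by rewrite openE => /[apply] /nbhs_cplxP.
Qed.

Lemma holomorphic_derive D f : open D -> holomorphic_on D f -> holomorphic_on D (derive1 f).
Proof.
move=> oD fD z Dz; have [r r0 rD] := open_cdiscP oD Dz.
by apply: holomorphic_derive_disc r0 _ => w /rD/fD.
Qed.

Lemma holomorphic_derive1n D f (k : nat) : open D -> holomorphic_on D f -> holomorphic_on D (derive1n k f).
Proof.
by move=> oD fD; elim: k => [//|k IH]; rewrite derive1nS; exact: holomorphic_derive.
Qed.

Lemma eq_derive1 D f g z : open D -> D z -> (forall w, D w -> f w = g w) ->
  derive1 f z = derive1 g z.
Proof.
move=> oD Dz fg; rewrite !derive1E; apply: near_eq_derive.
by have [r r0 rD] := open_cdiscP oD Dz; apply/nbhs_cplxP; exists r => // w /rD/fg.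
Qed.

Lemma derive1n_lin D f g c (k : nat) z : open D -> holomorphic_on D f -> holomorphic_on D g -> D z ->
  derive1n k (fun w => f w + c * g w) z = derive1n k f z + c * derive1n k g z.
Proof.
move=> oD fD gD; elim: k z => [|k IH] z Dz //.
rewrite !derive1nS (eq_derive1 oD Dz IH).
have fk := holomorphic_derive1n (k := k) oD fD Dz.
have gk := holomorphic_derive1n (k := k) oD gD Dz.
exact: cd_val (cdD (cd_ex fk) (cdZ c (cd_ex gk))).
Qed.

(** That is, [f z = L (z - a)^m + o(|z - a|^m)]. Since [z = a] is allowed, it also fixes [f a]: it
    is [L] if [m = 0], and 0 otherwise. *)
Definition leading f a m L := forall e : R, 0 < e -> exists2 d : R, 0 < d &
  forall z, cabs (z - a) < d -> cabs (f z - L * (z - a) ^+ m) <= e * cabs (z - a) ^+ m.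

Lemma leading_primitive f a r m L : 0 < r -> (forall z, cdisc a r z -> derivable f z 1) ->
  f a = 0 -> leading (derive1 f) a m L -> leading f a m.+1 (L / m.+1%:R).
Proof.
move=> r0 fd fa H e e0.
(* The mean value inequality on the disc of radius [2 |z - a|] costs the factor [2 * 2 ^ m]. *)
have [d d0 {}H] := H (e / 2 ^+ m.+1) (divr_gt0 e0 (exprn_gt0 _ (ltr0Sn _ 1))).
exists (Num.min r d / 2); first by rewrite divr_gt0// lt_min r0.
move=> z; rewrite ltr_pdivlMr// lt_min => /andP[zr zd].
have [->|za] := eqVneq z a.
  by rewrite fa subrr cabs0 !expr0n/= !mulr0 subr0 cabs0.
have z0 : 0 < cabs (z - a) by rewrite cabs_gt0 subr_eq0.
pose c : C := L / m.+1%:R.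
pose F w := f w - c * (w - a) ^+ m.+1.
have Fd w : cdisc a (cabs (z - a) * 2) w -> derivable F w 1 /\
    cabs (derive1 F w) <= e / 2 ^+ m.+1 * (cabs (z - a) * 2) ^+ m.
  rewrite /cdisc/= => wz.
  have A : is_cd (fun w => w - a) w 1.
    by have := cdB (cd_id w) (cd_cst a w); rewrite subr0.
  have B := cdB (cd_ex (fd w (lt_trans wz zr))) (cdZ c (cdX m A)).
  split; first exact: cd_derivable B.
  rewrite (cd_val B) mulr1 mulrA divfK ?pnatr_eq0//.
  apply: le_trans (H _ (lt_trans wz zd)) _; rewrite ler_wpM2l//.
    by rewrite divr_ge0 ?ltW// exprn_ge0.
  by rewrite lerXn2r ?nnegrE ?cabs_ge0 ?ltW// mulr_gt0.
have zz : cdisc a (cabs (z - a) * 2) z by rewrite /cdisc/= ltr_pMr// ltr1n.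
have := mean_value_ineq Fd (cdisc_center a _) zz.
rewrite mulr_gt0// => /(_ isT).
rewrite {2}/F fa subrr expr0n/= mulr0 subr0 subr0 => /le_trans; apply.
rewrite exprMn !exprS le_eqVlt; apply/orP; left; apply/eqP; field.
by rewrite expf_neq0.
Qed.

(** Induction on [n]: the expansion of [derive1 f] is integrated by [leading_primitive], with no
    recourse to power series. *)
Lemma leading_taylor D f a n : open D -> D a -> holomorphic_on D f ->
  (forall k : nat, (k < n)%N -> derive1n k f a = 0) ->
  leading f a n (derive1n n f a / n`!%:R).
Proof.
move=> oD Da; elim: n f => [|n IH] f fD f0.
  rewrite fact0 divr1 => e e0.
  have /cvg_cplxP/(_ e e0)/nbhs_cplxP[d d0 H] := derivable_cvg (fD _ Da).
  by exists d => // z /H/ltW; rewrite !expr0 !mulr1.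
have [r r0 rD] := open_cdiscP oD Da.
have := IH (derive1 f) (holomorphic_derive oD fD).
have f0' (k : nat) : (k < n)%N -> derive1n k (derive1 f) a = 0.
  by move=> kn; rewrite -derive1Sn; exact: f0.
move=> /(_ f0')/(leading_primitive r0).
rewrite -derive1Sn factS natrM invfM mulrAC mulrA; apply; last exact: (f0 0%N).
by move=> z /rD/fD.
Qed.

End HolomorphicDerivative.

(** * Affine substitutions on the line *)

Section LineMeasure.
Context {R : realType}.
Local Notation mu := (@lebesgue_measure R).
Local Open Scope ereal_scope.

(** Uniqueness of Lebesgue measure: the right side is a measure with the correct value on []a, b]].
    For negative [c] the preimage is half-open at the other end, with the same length. *)
Lemma lebesgue_measure_affine (c t : R) (A : set R) : (c != 0)%R -> measurable A ->
  mu A = (`|c|%:E * mu ((fun x : R => (c * x + t)%R) @^-1` A))%E.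
Proof.
move=> c0 mA; pose T : measurableTypeR R -> measurableTypeR R := fun x : R => (c * x + t)%R.
have mT : measurable_fun setT T.
  by apply: measurable_funD => //; exact: measurable_funM.
have n0 : (0 <= `|c|)%R by [].
pose nu := mscale (NngNum n0) (pushforward mu T).
rewrite (_ : _ * _ = nu mT A)//.
apply: lebesgue_measure_unique => // X [[a b] _ <-].
change (mu `]a, b]%classic = `|c|%:E * mu (T @^-1` `]a, b]%classic)).
rewrite [LHS]lebesgue_measure_itv/= lte_fin.
have [cp|cn|/eqP] := ltgtP 0%R c; last by rewrite eq_sym (negbTE c0).
  rewrite (_ : T @^-1` _ = `]((a - t) / c)%R, ((b - t) / c)%R]%classic); last first.
    apply/seteqP; split => x; rewrite /T/= !in_itv/= ltr_pdivrMr// ler_pdivlMr//;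
    by rewrite ltrBlDr lerBrDr (mulrC c).
  rewrite lebesgue_measure_itv/= lte_fin ltr_pM2r ?invr_gt0// ltrD2r.
  case: ifPn => ab; last by rewrite mule0.
  rewrite gtr0_norm// -!EFinB -EFinM -mulrBl mulrC divfK//; congr (_%:E); ring.
rewrite (_ : T @^-1` _ = `[((b - t) / c)%R, ((a - t) / c)%R[%classic); last first.
  apply/seteqP; split => x; rewrite /T/= !in_itv/= ler_ndivrMr// ltr_ndivlMr// andbC;
  by rewrite ltrBlDr lerBrDr (mulrC c).
rewrite lebesgue_measure_itv/= lte_fin ltr_nM2r ?invr_lt0// ltrD2r.
case: ifPn => ab; last by rewrite mule0.
rewrite ltr0_norm// -!EFinB -EFinM -mulrBl mulNr mulrC divfK//; congr (_%:E); ring.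
Qed.

Lemma ge0_integral_affine (G : R -> \bar R) (c t : R) : (c != 0)%R ->
  measurable_fun setT G -> (forall x, 0 <= G x) ->
  \int[mu]_x G (c * x + t)%R = `|c|^-1%:E * \int[mu]_x G x.
Proof.
move=> c0 mG G0; pose T : measurableTypeR R -> measurableTypeR R := fun x : R => (c * x + t)%R.
have mT : measurable_fun setT T.
  by apply: measurable_funD => //; exact: measurable_funM.
have n0 : (0 <= `|c|)%R by [].
rewrite (eq_measure_integral (mscale (NngNum n0) (pushforward mu T)) (f := G)); last first.
  by move=> A mA _; exact: lebesgue_measure_affine.
rewrite ge0_integral_mscale// ge0_integral_pushforward// preimage_setT muleA -EFinM.
by rewrite mulVf ?normr_eq0// mul1e.
Qed.

Lemma measurable_invr : measurable_fun setT (fun x : R => x^-1%R).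
Proof.
rewrite (_ : setT = [set 0%R] `|` ~` [set 0%R]); last by rewrite setUv.
apply/measurable_funU => //; first exact: measurableC.
split; first exact: measurable_fun_set1.
apply: open_continuous_measurable_fun; first (rewrite (_ : ~` _ = [set x : R | x != 0%R]); [exact: open_neq|by apply/seteqP; split => x /= /eqP]).
by move=> x; rewrite inE/= => /eqP x0; exact: inv_continuous.
Qed.

End LineMeasure.

(** * Measurability in the plane *)

Section Plane.
Context {R : realType}.
Local Notation C := (Cplx R).
Local Notation M := (measurableTypeR R).
Local Notation area := (@area R).
Implicit Types (F : C -> \bar R) (u : C -> R) (A : set C).
Local Open Scope ereal_scope.

Definition plane_set A : set (M * M) := [set w | A (of_pair w)].

(** Always over the whole plane. Domains enter by extending the integrand by zero, so that a change
    of variables acts on the integrand alone. *)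
Definition aint F : \bar R := \int[area]_w F (of_pair w).

Definition pmeas F := measurable_fun [set: M * M] (fun w => F (of_pair w)).

(** Tested on real and imaginary parts, so that [Cplx R] needs no sigma-algebra of its own. *)
Definition cmeas d (X : measurableType d) (T : X -> C) :=
  measurable_fun setT (fun w => complex.Re (T w)) /\
  measurable_fun setT (fun w => complex.Im (T w)).

Section ComplexMeasurable.
Context d (X : measurableType d).
Implicit Types (S T : X -> C).

Lemma pmeas_comp F T : pmeas F -> cmeas T -> measurable_fun setT (F \o T).
Proof.
move=> mF [mr mi].
pose S (w : X) : M * M := (complex.Re (T w) : M, complex.Im (T w) : M).
have mS : measurable_fun setT S by exact: measurable_fun_pair.
rewrite (_ : F \o T = (fun w => F (of_pair w)) \o S).
  exact: measurableT_comp.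
by apply/funext => w /=; congr F; rewrite /of_pair/=; case: (T _).
Qed.

Lemma cmeas_cst (c : C) : cmeas (fun _ : X => c).
Proof. by split; exact: measurable_cst. Qed.

Lemma cmeasD S T : cmeas S -> cmeas T -> cmeas (fun z => S z + T z)%R.
Proof.
move=> [a b] [c e]; split; [under eq_fun do rewrite reD|under eq_fun do rewrite imD];
  exact: measurable_funD.
Qed.

Lemma cmeasM S T : cmeas S -> cmeas T -> cmeas (fun z => S z * T z)%R.
Proof.
move=> [a b] [c e]; split; [under eq_fun do rewrite reM|under eq_fun do rewrite imM].
  by apply: measurable_funB; exact: measurable_funM.
by apply: measurable_funD; exact: measurable_funM.
Qed.

Lemma reV (z : C) : (complex.Re (z^-1) = complex.Re z / cabs z ^+ 2)%R.
Proof. by rewrite cabs_sqr; case: z. Qed.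

Lemma imV (z : C) : (complex.Im (z^-1) = - complex.Im z / cabs z ^+ 2)%R.
Proof. by rewrite cabs_sqr; case: z => a b /=; rewrite mulNr. Qed.

Lemma measurable_cabs_sqr T : cmeas T -> measurable_fun setT (fun w => cabs (T w) ^+ 2)%R.
Proof.
move=> [a b]; under eq_fun do rewrite cabs_sqr.
by apply: measurable_funD; apply: measurable_funM.
Qed.

Lemma cmeasV T : cmeas T -> cmeas (fun z => (T z)^-1)%R.
Proof.
move=> mT; have [a b] := mT.
have c : measurable_fun setT (fun w => (cabs (T w) ^+ 2)^-1)%R.
  by apply: measurableT_comp; [exact: measurable_invr|exact: measurable_cabs_sqr].
split; [under eq_fun do rewrite reV|under eq_fun do rewrite imV];
  apply: measurable_funM => //; exact: measurable_funN.
Qed.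

End ComplexMeasurable.

Lemma cmeas_comp d d' (X : measurableType d) (Y : measurableType d') (T : Y -> C)
    (g : X -> Y) : cmeas T -> measurable_fun setT g -> cmeas (T \o g).
Proof.
move=> [a b] mg; split.
  exact: (measurableT_comp (f := fun y => complex.Re (T y)) a mg).
exact: (measurableT_comp (f := fun y => complex.Im (T y)) b mg).
Qed.

Lemma cmeas_of_pair : cmeas (of_pair : M * M -> C).
Proof. by split => /=; [exact: measurable_fst|exact: measurable_snd]. Qed.

(** The sigma-algebra of [area] is generated by rectangles; an open set is the union of the
    countably many rational boxes that it contains. *)
Lemma open_plane_set A : open A -> measurable (plane_set A).
Proof.
move=> oA; pose B (q : rat * rat * rat) : set C := [set z : C |
  (`|complex.Re z - ratr q.1.1| < ratr q.2)%R /\ (`|complex.Im z - ratr q.1.2| < ratr q.2)%R].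
have mB q : measurable (plane_set (B q)).
  rewrite (_ : plane_set (B q) = (`](ratr q.1.1 - ratr q.2)%R, (ratr q.1.1 + ratr q.2)%R[%classic : set M) `*`
     (`](ratr q.1.2 - ratr q.2)%R, (ratr q.1.2 + ratr q.2)%R[%classic : set M)).
    by apply: measurableX; exact: measurable_itv.
  by apply/seteqP; split => -[x y]; rewrite /plane_set /B/= !in_itv/= !ltr_distl.
rewrite (_ : plane_set A = \bigcup_(q : rat * rat * rat)
    (if `[< B q `<=` A >] then plane_set (B q) else set0)).
  apply: countable_bigcupT_measurable; first exact: countableP.
  by move=> q; case: ifPn.
apply/seteqP; split => [w Aw|w [q _]]; last first.
  by case: ifPn => // /asboolP BA; exact: BA.
have [r r0 rA] := open_cdiscP oA Aw.
(* The rational centre is within [r / 8] of the point in each coordinate and the half-side lies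
   between [r / 8] and [r / 4]: the box contains the point and stays within [3 r / 4] of it. *)
have r8 : (0 < r / 8)%R by rewrite divr_gt0.
have rat_near (x : R) : exists q : rat, (`|x - ratr q| < r / 8)%R.
  have /rat_in_itvoo[q] : (x - r / 8 < x + r / 8)%R by lra.
  by rewrite in_itv/= => /andP[q1 q2]; exists q; rewrite ltr_distl; apply/andP; split; lra.
have [q1 h1] := rat_near w.1; have [q2 h2] := rat_near w.2.
have /rat_in_itvoo[q3] : (r / 8 < r / 4)%R by lra.
rewrite in_itv/= => /andP[l3 u3].
exists (q1, q2, q3) => //; case: ifPn => [_|/asboolPn]; last first.
  move=> nBA; exfalso; apply: nBA; apply: subset_trans rA => z [/= z1 z2]; rewrite /cdisc/=.
  apply: (le_lt_trans (cabs_re_im _)); rewrite !reimE/=.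
  have := ler_distD (ratr q1) (complex.Re z) w.1; have := ler_distD (ratr q2) (complex.Im z) w.2.
  rewrite (distrC (ratr q1)) (distrC (ratr q2)); lra.
by split => /=; rewrite ?(lt_trans h1) ?(lt_trans h2).
Qed.

Lemma pmeas_cts A u : open A -> (forall z, A z -> u x @[x --> z] --> u z) ->
  measurable_fun (plane_set A) (fun w => u (of_pair w)).
Proof.
move=> oA uc; apply: (measurability _ (RGenOInfty.measurableE R)).
move=> _ [_ [a ->] <-]; rewrite preimage_itvoy.
rewrite (_ : _ `&` _ = plane_set (A `&` [set z | (a < u z)%R])); last by [].
apply: open_plane_set; rewrite openE => z [Az az].
have n1 : nbhs z A by move: oA; rewrite openE => /(_ _ Az).
have n2 : nbhs z [set x | (a < u x)%R] := cvgr_gt _ (uc _ Az) _ az.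
by apply: filterI => //; exact: n2.
Qed.

Lemma pmeas_patch A u : open A -> (forall z, A z -> u x @[x --> z] --> u z) ->
  pmeas ((fun z => (u z)%:E) \_ A).
Proof.
move=> oA uc; have mA := open_plane_set oA.
have : measurable_fun [set: M * M] ((fun w => (u (of_pair w))%:E) \_ (plane_set A)).
  apply/(measurable_restrictT _ mA); apply: measurableT_comp => //; exact: pmeas_cts.
by congr measurable_fun; apply/funext => w.
Qed.

End Plane.

(** * Behaviour of area under translation, multiplication and inversion *)

Section PlaneInvariance.
Context {R : realType}.
Local Notation C := (Cplx R).
Local Notation M := (measurableTypeR R).
Local Notation mu := (@lebesgue_measure R).
Local Notation area := (@area R).
Implicit Types (F G : C -> \bar R).
Local Open Scope ereal_scope.

Lemma aint_ge0 F : (forall z, 0 <= F z) -> 0 <= aint F.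
Proof. by move=> F0; exact: integral_ge0. Qed.

Lemma aintE1 F : pmeas F -> (forall z, 0 <= F z) ->
  aint F = \int[mu]_x \int[mu]_y F (cpt x y).
Proof.
by move=> mF F0; rewrite /aint (fubini_tonelli1 (fun w : M * M => F (of_pair w))).
Qed.

Lemma aintE2 F : pmeas F -> (forall z, 0 <= F z) ->
  aint F = \int[mu]_y \int[mu]_x F (cpt x y).
Proof.
by move=> mF F0; rewrite /aint (fubini_tonelli2 (fun w : M * M => F (of_pair w))).
Qed.

Lemma pmeas_mull (c : C) F : pmeas F -> pmeas (fun z => F (c * z)%R).
Proof.
move=> mF; apply: (pmeas_comp mF (T := fun w : M * M => (c * of_pair w)%R)).
by apply: cmeasM; [exact: cmeas_cst|exact: cmeas_of_pair].
Qed.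

Lemma pmeas_addl (c : C) F : pmeas F -> pmeas (fun z => F (c + z)%R).
Proof.
move=> mF; apply: (pmeas_comp mF (T := fun w : M * M => (c + of_pair w)%R)).
by apply: cmeasD; [exact: cmeas_cst|exact: cmeas_of_pair].
Qed.

Lemma aint_addl (b : C) F : pmeas F -> (forall z, 0 <= F z) ->
  aint (fun z => F (b + z)%R) = aint F.
Proof.
move=> mF F0; rewrite aintE1//; last exact: pmeas_addl.
pose H (x : R) := \int[mu]_y F (cpt x y).
have H0 x : 0 <= H x by apply: integral_ge0.
have mH : measurable_fun setT H.
  exact: (@measurable_fun_fubini_tonelli_F _ _ _ _ _ mu (fun w : M * M => F (of_pair w)) mF (fun w => F0 _)).
have E (x : R) : \int[mu]_y F (b + cpt x y)%R = H (1 * x + complex.Re b)%R.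
  have := @ge0_integral_affine R (fun y => F (cpt (1 * x + complex.Re b)%R y)) 1 (complex.Im b).
  rewrite oner_eq0 normr1 invr1 mul1e /H => <- //.
    apply: eq_integral => y _; congr F; apply: cplx_ext; rewrite !reimE; ring.
  apply: (pmeas_comp mF (T := fun y : M => cpt (1 * x + complex.Re b)%R y)).
  by split; [exact: measurable_cst|exact: measurable_id].
under eq_integral => x _ do rewrite E.
by rewrite ge0_integral_affine// ?oner_eq0// normr1 invr1 mul1e aintE1.
Qed.

(** Multiplication by [c = a + i b] is a composition of two maps changing one coordinate each: [x]
    becomes [a x - b y], then [y] becomes [(b / a) x + (k / a) y], where [k = a^2 + b^2]. The
    factors [a] and [k / a] multiply to [|c|^2]. *)
Lemma aint_mull_re (c : C) F : complex.Re c != 0%R -> pmeas F -> (forall z, 0 <= F z) ->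
  aint (fun z => F (c * z)%R) = ((cabs c ^+ 2)^-1)%:E * aint F.
Proof.
move=> c0 mF F0; set a := complex.Re c; set b := complex.Im c.
have k0 : (0 < a ^+ 2 + b ^+ 2)%R.
  by rewrite ltr_pwDl ?sqr_ge0// lt_neqAle sqr_ge0 eq_sym sqrf_eq0 c0.
set k := (a ^+ 2 + b ^+ 2)%R in k0.
pose G (z : C) := F (cpt (complex.Re z) (b / a * complex.Re z + k / a * complex.Im z))%R.
have mG : pmeas G.
  apply: (pmeas_comp mF (T := fun w : M * M => cpt w.1 (b / a * w.1 + k / a * w.2)%R)).
  split; first exact: measurable_fst.
  by apply: measurable_funD; apply: measurable_funM.
have G0 z : 0 <= G z by exact: F0.
have E1 : aint (fun z => F (c * z)%R) = `|a|^-1%:E * aint G.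
  rewrite aintE2//; last exact: pmeas_mull.
  have E y : \int[mu]_x F (c * cpt x y)%R = `|a|^-1%:E * \int[mu]_x G (cpt x y).
    rewrite -(@ge0_integral_affine R (fun x => G (cpt x y)) a (- b * y))//; last first.
      apply: (pmeas_comp mG (T := fun x : M => cpt x y)).
      by split; [exact: measurable_id|exact: measurable_cst].
    apply: eq_integral => x _; congr F; apply: cplx_ext; rewrite !reimE -/a -/b.
      by ring.
    by rewrite /k; field.
  under eq_integral => y _ do rewrite E.
  rewrite ge0_integralZl//.
  - by rewrite aintE2.
  - exact: (@measurable_fun_fubini_tonelli_G _ _ _ _ _ mu (fun w : M * M => G (of_pair w)) mG (fun w => G0 _)).
  - by move=> y _; exact: integral_ge0.
have E2 : aint G = `|k / a|^-1%:E * aint F.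
  rewrite aintE1//.
  have E x : \int[mu]_y G (cpt x y) = `|k / a|^-1%:E * \int[mu]_y F (cpt x y).
    rewrite -(@ge0_integral_affine R (fun y => F (cpt x y)) (k / a) (b / a * x))//.
    - by apply: eq_integral => y _; rewrite /G !reimE addrC.
    - by rewrite mulf_neq0 ?invr_eq0// gt_eqF.
    - apply: (pmeas_comp mF (T := fun y : M => cpt x y)).
      by split; [exact: measurable_cst|exact: measurable_id].
  under eq_integral => y _ do rewrite E.
  rewrite ge0_integralZl//.
  - by rewrite aintE1.
  - exact: (@measurable_fun_fubini_tonelli_F _ _ _ _ _ mu (fun w : M * M => F (of_pair w)) mF (fun w => F0 _)).
  - by move=> y _; exact: integral_ge0.
rewrite E1 E2 muleA -EFinM; congr (_%:E * _).
rewrite cabs_sqr -/a -/b -/k normrM normfV (gtr0_norm k0).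
by field; rewrite normr_eq0 c0 gt_eqF.
Qed.

Lemma aint_mull (c : C) F : c != 0%R -> pmeas F -> (forall z, 0 <= F z) ->
  aint (fun z => F (c * z)%R) = ((cabs c ^+ 2)^-1)%:E * aint F.
Proof.
move=> c0 mF F0; have [r0|] := eqVneq (complex.Re c) 0%R; last by move=> r0; exact: aint_mull_re.
(* A purely imaginary [c] is the product of [1 + i] and [c / (1 + i)], both with nonzero real
   part. *)
pose e : C := cpt 1 1; pose d := (c / e)%R.
have e2 : (cabs e ^+ 2 = 2)%R by rewrite cabs_sqr !reimE; ring.
have e0 : e != 0%R by rewrite -cabs_eq0 -sqrf_eq0 e2.
have cE : c = (d * e)%R by rewrite /d divfK.
have i0 : complex.Im c != 0%R.
  by apply: contra_neq c0 => i0; apply: cplx_ext; rewrite ?r0 ?i0.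
have d0 : complex.Re d != 0%R.
  rewrite /d reM reV imV e2 r0 !reimE mul0r sub0r mulNr mulrN opprK.
  by rewrite mulf_neq0// mul1r invr_eq0.
have e1 : complex.Re e != 0%R by rewrite re_cpt oner_eq0.
rewrite (_ : (fun z => _) = (fun z => F (e * (d * z))%R)); last first.
  by apply/funext => z; rewrite cE; congr F; ring.
rewrite (@aint_mull_re d (fun z => F (e * z)%R))//; last exact: pmeas_mull.
rewrite aint_mull_re// muleA -EFinM; congr (_%:E * _).
have -> : cabs c = (cabs d * cabs e)%R by rewrite -cabsM -cE.
by rewrite exprMn [RHS]invfM.
Qed.

Local Notation wgt z := ((cabs z ^+ 2)^-1%:E).

Lemma pmeas_wgt d (X : measurableType d) (T : X -> C) : cmeas T ->
  measurable_fun setT (fun w => wgt (T w)).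
Proof.
move=> mT; apply: measurableT_comp => //.
by apply: measurableT_comp; [exact: measurable_invr|exact: measurable_cabs_sqr].
Qed.

Lemma wgt_ge0 (z : C) : 0 <= wgt z.
Proof. by rewrite lee_fin invr_ge0 sqr_ge0. Qed.

Lemma pmeasM F G : pmeas F -> pmeas G -> pmeas (fun z => F z * G z).
Proof. exact: emeasurable_funM. Qed.

Lemma aintZl (c : \bar R) F : 0 <= c -> pmeas F -> (forall z, 0 <= F z) ->
  aint (fun z => c * F z) = c * aint F.
Proof. by move=> c0 mF F0; rewrite /aint ge0_integralZl. Qed.

(** The factor [|c|^2] lost by the area is regained by the weight: [dA / |z|^2] is the Haar measure
    of the multiplicative group. *)
Lemma aint_wgt_mull (c : C) F : c != 0%R -> pmeas F -> (forall z, 0 <= F z) ->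
  aint (fun z => F (c * z)%R * wgt z) = aint (fun z => F z * wgt z).
Proof.
move=> c0 mF F0.
have c2 : (0 < cabs c ^+ 2)%R by rewrite exprn_gt0// cabs_gt0.
pose G z := (cabs c ^+ 2)%:E * (F z * wgt z).
have mFw : pmeas (fun z => F z * wgt z).
  by apply: pmeasM => //; exact: pmeas_wgt cmeas_of_pair.
have Fw0 z : 0 <= F z * wgt z by rewrite mule_ge0// wgt_ge0.
have mG : pmeas G.
  by apply: (@pmeasM (cst _)); [exact: measurable_cst|].
have G0 z : 0 <= G z by rewrite mule_ge0// lee_fin ltW.
rewrite (_ : (fun z => _) = fun z => G (c * z)%R).
  rewrite aint_mull// /aint /G ge0_integralZl//; last by rewrite lee_fin ltW.
  by rewrite muleA -EFinM mulVf ?gt_eqF// mul1e.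
apply/funext => z; rewrite /G cabsM exprMn [RHS]muleCA -EFinM; congr (_ * _%:E).
by rewrite [X in _ = (_ * X)%R]invfM mulrA divff ?gt_eqF// mul1r.
Qed.

(** Tonelli's theorem is used below with [area] itself as a factor of a product; [sfarea] packs the
    required structure. *)
Lemma sigma_finite_area : sigma_finite setT (mu \x mu).
Proof.
have /sigma_finiteP[F [TF ndF Foo]] := @sigma_finiteT _ _ _ mu.
exists (fun n => F n `*` F n).
  rewrite -setXTT TF predeqE => -[x y]; split.
    move=> [/= [n _ Fnx] [k _ Gky]]; exists (maxn n k) => //; split.
    - by move: x Fnx; exact/subsetPset/ndF/leq_maxl.
    - by move: y Gky; exact/subsetPset/ndF/leq_maxr.
  by move=> [n _ []/= ? ?]; split; exists n.
move=> k; have [? ?] := Foo k.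
split; first exact: measurableX.
by rewrite [X in X < _]product_measure1E// lte_mul_pinfty// ge0_fin_numE.
Qed.

Definition sfarea : SigmaFiniteMeasure.type (M * M)%type R :=
  HB.pack (mu \x mu) (@Measure_isSigmaFinite.Build _ _ _ (mu \x mu) sigma_finite_area).

Lemma muleI_fin (x y k : \bar R) : k \is a fin_num -> k != 0 -> x * k = y * k -> x = y.
Proof.
case: k => [k| |]// _; rewrite eqe => k0 /(congr1 (fun t => t * (k^-1)%:E)).
by rewrite -!muleA -EFinM mulfV// !mule1.
Qed.

(* Haar-measure argument for the invariance of dA/|z|^2 under inversion: test against the
   indicator of a box on which the weight is bounded above and below. *)
Lemma aint_wgt_inv F : pmeas F -> (forall z, 0 <= F z) ->
  aint (fun z => F (z^-1)%R * wgt z) = aint (fun z => F z * wgt z).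
Proof.
move=> mF F0.
pose Q : set (M * M) := (`[1%R, 2%R]%classic : set M) `*` (`[0%R, 1%R]%classic : set M).
have mQ : measurable Q by apply: measurableX; exact: measurable_itv.
have aQ : area Q = 1.
  rewrite /Q [LHS]product_measure1E//.
  rewrite [X in X * _]lebesgue_measure_itv [X in _ * X]lebesgue_measure_itv/= !lte_fin ltr01 ltr1n -!EFinB -EFinM; congr (_%:E); ring.
pose phi (z : C) : \bar R := (\1_Q (complex.Re z, complex.Im z))%:E.
have phi0 z : 0 <= phi z by rewrite lee_fin.
have mphi : pmeas phi.
  apply: measurableT_comp => //.
  rewrite (_ : (fun w => _) = \1_Q); first exact: measurable_indic.
  by apply/funext => -[x y].
have phiE (w : M * M) : phi (of_pair w) = (\1_Q w)%:E by case: w.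
pose k := aint (fun z => phi z * wgt z).
have intQ : \int[area]_w (\1_Q w)%:E = 1.
  by rewrite integral_indic// setIT.
have mphiw : pmeas (fun z => phi z * wgt z).
  by apply: pmeasM => //; exact: pmeas_wgt cmeas_of_pair.
have Qsq (w : M * M) : Q w -> (1 <= cabs (of_pair w) ^+ 2 <= 5)%R.
  case: w => x y [/=]; rewrite !in_itv/= => /andP[x1 x2] /andP[y0 y1].
  rewrite cabs_sqr/=; apply/andP; split; nra.
have k1 : k <= 1.
  rewrite -intQ; apply: ge0_le_integral => //.
    by move=> w _; rewrite mule_ge0// wgt_ge0.
  move=> w _; rewrite phiE -EFinM lee_fin indicE; have [|_] := boolP (w \in Q); last by rewrite mul0r.
  by rewrite mul1r inE => /Qsq/andP[h _]; rewrite invf_le1// (lt_le_trans ltr01).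
have k0 : (5^-1)%:E <= k.
  rewrite -[leLHS]mule1 -intQ -ge0_integralZl//.
  apply: ge0_le_integral => //.
    by apply: emeasurable_funM => //; apply: measurableT_comp.
  move=> w _; rewrite phiE -!EFinM lee_fin indicE; have [|_] := boolP (w \in Q); last by rewrite mul0r mulr0.
  rewrite mul1r mulr1 inE => /Qsq/andP[h1 h5]; rewrite lef_pV2// posrE// (lt_le_trans ltr01)//.
have kfin : k \is a fin_num.
  rewrite ge0_fin_numE; first by rewrite (le_lt_trans k1)// ltry.
  by rewrite (le_trans _ k0)// lee_fin.
have kn0 : k != 0 by rewrite gt_eqF// (lt_le_trans _ k0)// lte_fin.
have Fi0 z : 0 <= F (z^-1)%R by [].
have mFi : pmeas (fun z => F (z^-1)%R).
  by apply: (pmeas_comp mF); apply: cmeasV; exact: cmeas_of_pair.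
have H0 (S : C -> \bar R) : (forall z, 0 <= S z) -> 0 <= aint (fun z => S z * wgt z).
  by move=> S0; apply: aint_ge0 => z; rewrite mule_ge0// wgt_ge0.
have mH (S : C -> \bar R) : pmeas S -> pmeas (fun z => S z * wgt z).
  by move=> mS; apply: pmeasM => //; exact: pmeas_wgt cmeas_of_pair.
(* In [F (1 / z) phi (z u)] the integral over [u] produces the factor [k]. Replacing [z] by [z / u]
   turns it into [phi z F (u / z)], which is [P2], and there the integral over [u] produces that of
   [F]. *)
pose P (w : (M * M) * (M * M)) := (F ((of_pair w.1)^-1)%R * wgt (of_pair w.1)) *
  (phi (of_pair w.1 * of_pair w.2)%R * wgt (of_pair w.2)).
pose P2 (w : (M * M) * (M * M)) := (phi (of_pair w.2) * wgt (of_pair w.2)) *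
  (F ((of_pair w.2)^-1 * of_pair w.1)%R * wgt (of_pair w.1)).
have m1 : cmeas (fun w : (M * M) * (M * M) => of_pair w.1 : C).
  exact: (cmeas_comp cmeas_of_pair (g := fst)).
have m2 : cmeas (fun w : (M * M) * (M * M) => of_pair w.2 : C).
  exact: (cmeas_comp cmeas_of_pair (g := snd)).
have mP : measurable_fun setT P.
  apply: emeasurable_funM; apply: emeasurable_funM; [|exact: pmeas_wgt| |exact: pmeas_wgt].
    by apply: (pmeas_comp mF); exact: cmeasV.
  by apply: (pmeas_comp mphi); exact: cmeasM.
have mP2 : measurable_fun setT P2.
  apply: emeasurable_funM; apply: emeasurable_funM; [|exact: pmeas_wgt| |exact: pmeas_wgt].
    exact: (pmeas_comp mphi).
  by apply: (pmeas_comp mF); apply: cmeasM => //; exact: cmeasV.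
have P0 w : 0 <= P w by rewrite !mule_ge0// wgt_ge0.
have P20 w : 0 <= P2 w by rewrite !mule_ge0// wgt_ge0.
(* As [0^-1 = 0], the origin has weight 0, and invariance is used only at nonzero factors. *)
have wgt0 : wgt (0 : C) = 0 by rewrite cabs0 expr0n/= invr0.
have E1 : aint (fun z => F (z^-1)%R * wgt z) * k = \int[area]_z \int[area]_u P (z, u).
  rewrite muleC -aintZl//; [|by rewrite (le_trans _ k0)// lee_fin|exact: mH|by move=> z; rewrite mule_ge0// wgt_ge0].
  apply: eq_integral => w _; rewrite /P/=; have [->|w0] := eqVneq (of_pair w : C) 0%R.
    by rewrite wgt0 !mule0; under eq_integral => u _ do rewrite mul0e; rewrite integral0.
  have -> : k = aint (fun z => phi (of_pair w * z)%R * wgt z) by rewrite aint_wgt_mull.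
  rewrite muleC -aintZl//.
  - by rewrite mule_ge0// wgt_ge0.
  - by apply: mH; exact: pmeas_mull.
  - by move=> z; rewrite mule_ge0// wgt_ge0.
have E2 : \int[area]_u \int[area]_z P (z, u) = \int[area]_u \int[area]_z P2 (u, z).
  apply: eq_integral => u _; rewrite /P /P2/=; have [->|u0] := eqVneq (of_pair u : C) 0%R.
    by apply: eq_integral => z _; rewrite wgt0 !mule0.
  pose G (v : C) := phi v * F (v^-1 * of_pair u)%R.
  have mG : pmeas G.
    apply: pmeasM => //; apply: (pmeas_comp mF (T := fun w : M * M => (of_pair w)^-1 * of_pair u)%R).
    by apply: cmeasM; [apply: cmeasV; exact: cmeas_of_pair|exact: cmeas_cst].
  have G0 z : 0 <= G z by rewrite mule_ge0.
  have := aint_wgt_mull u0 mG G0.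
  move=> /(congr1 (fun x => wgt (of_pair u) * x)).
  rewrite -!aintZl//; [|exact: wgt_ge0|exact: mH|by move=> z; rewrite mule_ge0// wgt_ge0|
    exact: wgt_ge0|by apply: mH; exact: pmeas_mull|by move=> z; rewrite mule_ge0// wgt_ge0].
  move=> H; transitivity (aint (fun z => wgt (of_pair u) * (G (of_pair u * z)%R * wgt z))).
    apply: eq_integral => z _; rewrite /G.
    have -> : ((of_pair u * of_pair z)^-1 * of_pair u = (of_pair z : C)^-1)%R.
      by rewrite invfM mulrAC mulVf// mul1r.
    by rewrite (mulrC (of_pair u)) muleCA [RHS]muleC -!muleA.
  rewrite H; apply: eq_integral => z _; rewrite /G.
  by rewrite [LHS]muleC -!muleA; congr (_ * _); rewrite muleCA.
have E3 : \int[area]_z \int[area]_u P2 (u, z) = aint (fun z => F z * wgt z) * k.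
  have hk0 (z : C) : 0 <= phi z * wgt z := mule_ge0 (phi0 z) (wgt_ge0 z).
  rewrite /k -(aintZl (H0 _ F0) mphiw hk0).
  apply: eq_integral => z _; rewrite /P2/=; have [->|z0] := eqVneq (of_pair z : C) 0%R.
    by rewrite wgt0 !mule0; under eq_integral => u _ do rewrite mul0e; rewrite integral0.
  have z1 : ((of_pair z : C)^-1 != 0)%R by rewrite invr_eq0.
  have W := aint_wgt_mull z1 mF F0.
  have K := aintZl (hk0 (of_pair z)) (mH _ (pmeas_mull (of_pair z)^-1%R mF))
    (fun u => mule_ge0 (F0 _) (wgt_ge0 u)).
  by rewrite W in K; rewrite [RHS]muleC; exact: K.
have E4 : aint (fun z => F (z^-1)%R * wgt z) * k = aint (fun z => F z * wgt z) * k.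
  have FP : \int[area]_z \int[area]_u P (z, u) = \int[area]_u \int[area]_z P (z, u).
    exact: (@fubini_tonelli _ _ _ _ _ sfarea sfarea P mP P0).
  have FP2 : \int[area]_u \int[area]_z P2 (u, z) = \int[area]_z \int[area]_u P2 (u, z).
    exact: (@fubini_tonelli _ _ _ _ _ sfarea sfarea P2 mP2 P20).
  by rewrite E1 FP E2 FP2 E3.
exact: muleI_fin kfin kn0 E4.
Qed.

(** Write [F] as [|z|^2 F] times the weight; inversion then gives the Jacobian [|z|^(-4)]. The
    weight vanishes at 0, so [F] must vanish there for this rewriting. *)
Lemma aint_inv F : pmeas F -> (forall z, 0 <= F z) -> F 0%R = 0 ->
  aint F = aint (fun z => F (z^-1)%R * ((cabs z ^+ 4)^-1)%:E).
Proof.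
move=> mF F0 Fz; pose G z := F z * (cabs z ^+ 2)%:E.
have mG : pmeas G.
  apply: pmeasM => //; apply: measurableT_comp => //.
  by apply: measurable_cabs_sqr; exact: cmeas_of_pair.
have G0 z : 0 <= G z by rewrite mule_ge0// lee_fin sqr_ge0.
rewrite (_ : F = fun z => G z * wgt z); last first.
  apply/funext => z; rewrite /G -muleA -EFinM; have [->|z0] := eqVneq z 0%R.
    by rewrite Fz mul0e.
  by rewrite mulfV ?mule1// expf_neq0// cabs_eq0.
rewrite -aint_wgt_inv//; congr aint; apply/funext => z.
rewrite -[RHS]muleA; congr (_ * _); rewrite -EFinM cabsV; congr (_%:E).
have [->|z0] := eqVneq z 0%R; first by rewrite cabs0 invr0 !expr0n/= invr0 !mul0r.
by field; rewrite cabs_eq0.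
Qed.

End PlaneInvariance.

(** * The area of a disc *)

Section ClosedDisc.
Context {R : realType}.
Local Notation C := (Cplx R).
Local Notation M := (measurableTypeR R).
Local Notation mu := (@lebesgue_measure R).
Local Open Scope ereal_scope.

(** Substitute [x = sin t]; the integrand becomes [2 cos^2 t], with primitive [t + sin t cos t]. *)
Lemma integral_half_disc :
  \int[mu]_(x in `[(-1)%R, 1%R]) (2 * Num.sqrt (1 - x ^+ 2))%:E = (pi : R)%:E.
Proof.
have p0 : (- (pi / 2) < pi / 2 :> R)%R by have := pi_gt0 R; lra.
have ds x : derivable (@sin R) x 1 by exact: derivable_sin.
have s1E : (@sin R)^`()%classic = cos :> (R -> R).
  by apply/funext => x; rewrite derive1E; apply: derive_val.
have scont (x : R) : sin y @[y --> x] --> sin x by exact: continuous_sin.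
have ccont (x : R) : cos y @[y --> x] --> cos x by exact: continuous_cos.
have := @integration_by_substitution_increasing R sin
   (fun x => (2 * Num.sqrt (1 - x ^+ 2))%R) (- (pi / 2)) (pi / 2).
rewrite sinN sin_pihalf s1E => ->.
- transitivity (\int[mu]_(x in `[(- (pi / 2))%R, (pi / 2)%R]) (2 * cos x ^+ 2)%:E).
    apply: eq_integral => x; rewrite inE/= in_itv/= => /cos_ge0_pihalf cx.
    congr (_%:E); change (2 * Num.sqrt (1 - sin x ^+ 2) * cos x = 2 * cos x ^+ 2)%R.
    by rewrite -cos2sin2 sqrtr_sqr ger0_norm// expr2 -mulrA.
  have dF (x : R) : is_derive x 1%R (fun x => x + sin x * cos x)%R (2 * cos x ^+ 2)%R.
    apply: is_derive_eq.
    by rewrite /GRing.scale/= -[in LHS](cos2Dsin2 x); ring.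
  rewrite (@continuous_FTC2 _ _ (fun x => x + sin x * cos x)%R)//.
  + rewrite sinN cosN sin_pihalf cos_pihalf -EFinB; congr (_%:E); lra.
  + apply: continuous_subspaceT => x; apply: cvgM; first exact: cvg_cst.
    by apply: cvgM; exact: ccont.
  + have cF (x : R) : (fun x => x + sin x * cos x)%R y @[y --> x] --> (x + sin x * cos x)%R.
      by apply: cvgD; [exact: cvg_id|apply: cvgM; [exact: scont|exact: ccont]].
    split; [move=> x _; exact: ex_derive|apply: cvg_at_right_filter; exact: cF|
      apply: cvg_at_left_filter; exact: cF].
  + by move=> x _; rewrite derive1E; apply: derive_val.
- exact: ltW.
- by move=> x y xi yi; rewrite ltr_sin.
- by move=> x _; exact: ccont.
- by apply/cvg_ex; exists (cos (- (pi / 2)))%R; apply: cvg_at_right_filter; exact: ccont.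
- by apply/cvg_ex; exists (cos (pi / 2))%R; apply: cvg_at_left_filter; exact: ccont.
- split; [move=> x _; exact: ds|apply: cvg_at_right_filter; exact: scont|
      apply: cvg_at_left_filter; exact: scont].
- apply: continuous_subspaceT => x; apply: cvgM; first exact: cvg_cst.
  have c1 : (fun y => 1 - y ^+ 2)%R y @[y --> x] --> (1 - x ^+ 2)%R.
    by apply: cvgB; [exact: cvg_cst|exact: exprn_continuous].
  by apply: (cvg_comp (fun y => 1 - y ^+ 2)%R Num.sqrt c1); exact: sqrt_continuous.
Qed.

Definition cball r : set C := [set z | (cabs z <= r)%R].

Lemma measurable_cball r : measurable (plane_set (cball r)).
Proof.
rewrite (_ : plane_set (cball r) = ~` plane_set [set z : C | (r < cabs z)%R]); last first.
  by apply/seteqP; split => w; rewrite /plane_set/cball/= leNgt => /negP.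
apply: measurableC; apply: open_plane_set; rewrite openE => z zr.
have cc : cabs x @[x --> z] --> cabs z by apply: (@cvg_cabs _ _ (nbhs z) _ id z); exact: cvg_id.
have n2 : nbhs z [set x | (r < cabs x)%R] := cvgr_gt _ cc _ zr.
exact: n2.
Qed.

Lemma pmeas_cball r (u : C -> R) : measurable_fun setT (fun w : M * M => u (of_pair w)) ->
  pmeas ((fun z => (u z)%:E) \_ (cball r)).
Proof.
move=> mu'; have mA := measurable_cball r.
have : measurable_fun [set: M * M] ((fun w => (u (of_pair w))%:E) \_ (plane_set (cball r))).
  apply/(measurable_restrictT _ mA); apply: measurableT_comp => //.
  exact: measurable_funTS.
by congr measurable_fun; apply/funext => w.
Qed.

Lemma patch_ge0 (A : set C) (u : C -> R) z : (forall z, (0 <= u z)%R) ->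
  0 <= ((fun z => (u z)%:E) \_ A) z.
Proof. by move=> u0; rewrite patchE; case: ifPn => // _; rewrite lee_fin. Qed.

Lemma integral_disc_slice (x : R) :
  \int[mu]_y ((fun=> 1%:E) \_ (cball 1%R)) (cpt x y) =
  ((fun x => (2 * Num.sqrt (1 - x ^+ 2))%:E) \_ `[(-1)%R, 1%R]%classic) x.
Proof.
rewrite patchE; case: ifPn.
  rewrite inE/= in_itv/= => /andP[x1 x2]; set s : R := Num.sqrt _.
  have x0 : (0 <= 1 - x ^+ 2)%R by nra.
  have s0 : (0 <= s)%R by exact: sqrtr_ge0.
  have s2 : (s ^+ 2 = 1 - x ^+ 2)%R by rewrite /s sqr_sqrtr.
  rewrite (_ : (fun y => _) = (fun=> 1) \_ `[(- s)%R, s]%classic).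
    rewrite -integral_mkcond integral_cst//= mul1e lebesgue_measure_itv/= lte_fin.
    by case: ltP => ss; rewrite -?EFinB; [congr (_%:E); ring|congr (_%:E); lra].
  apply/funext => y; rewrite !patchE; congr (if _ then _ else _).
  have E : (cabs (cpt x y) <= 1)%R = (`|y| <= s)%R.
    rewrite -(@ler_pXn2r _ 2 _ (cabs _))// ?nnegrE ?cabs_ge0//.
    rewrite -[in RHS](@ler_pXn2r _ 2)// ?nnegrE// cabs_sqr re_cpt im_cpt expr1n.
    by rewrite real_normK ?num_real// s2 lerBrDl.
  by apply/idP/idP => /set_mem h; apply/mem_set; move: h; rewrite /cball/= in_itv/= -ler_norml E.
rewrite notin_setE/= in_itv/= => nx.
rewrite integral0_eq// => y _; rewrite patchE; case: ifPn => //.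
rewrite inE /cball/= => h; exfalso; apply: nx.
by rewrite -ler_norml; apply: le_trans h; rewrite -[x](re_cpt x y) re_cabs.
Qed.

Lemma aint_disc1 : aint ((fun=> 1%:E) \_ (cball 1%R)) = (pi : R)%:E.
Proof.
rewrite aintE1; last 2 first.
- by apply: (@pmeas_cball 1%R (fun=> 1%R)); exact: measurable_cst.
- by move=> z; apply: (@patch_ge0 _ (fun=> 1%R)).
rewrite -integral_half_disc [RHS]integral_mkcond.
by apply: eq_integral => x _; exact: integral_disc_slice.
Qed.

Lemma aint_cball_scale (r : R) (u : C -> R) (v : C -> R) : (0 < r)%R ->
  measurable_fun setT (fun w : M * M => u (of_pair w)) -> (forall z, (0 <= u z)%R) ->
  (forall z, u (cre r * z)%R = v z) ->
  aint ((fun z => (u z)%:E) \_ (cball r)) = (r ^+ 2)%:E * aint ((fun z => (v z)%:E) \_ (cball 1%R)).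
Proof.
move=> r0 mu' u0 uv; have c0 : cre r != 0%R by rewrite -cabs_eq0 cabs_cre normr_eq0 gt_eqF.
have := aint_mull c0 (pmeas_cball r mu') (fun z => patch_ge0 _ z u0).
rewrite (_ : (fun z => _) = (fun z => (v z)%:E) \_ (cball 1%R)).
  move=> ->; rewrite muleA -EFinM cabs_cre (gtr0_norm r0) mulfV ?mul1e//.
  by rewrite expf_neq0// gt_eqF.
apply/funext => z; rewrite !patchE uv; congr (if _ then _ else _).
have E : (cabs (cre r * z) <= r)%R = (cabs z <= 1)%R.
  by rewrite cabsM cabs_cre (gtr0_norm r0) -[X in (_ <= X)%R]mulr1 ler_pM2l.
by apply/idP/idP => /set_mem h; apply/mem_set; move: h; rewrite /cball/= E.
Qed.

Lemma integral_expr_itv (j : nat) (a b : R) : (a <= b)%R ->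
  \int[mu]_(x in `[a, b]) (j.+1%:R * x ^+ j)%:E = (b ^+ j.+1 - a ^+ j.+1)%:E.
Proof.
rewrite le_eqVlt => /predU1P[->|ab]; first by rewrite set_itv1 integral_set1 subrr.
have dF (x : R) : is_derive x 1%R (fun x => x ^+ j.+1)%R (j.+1%:R * x ^+ j)%R.
  split; first exact: exprn_derivable.
  by rewrite exp_derive /GRing.scale/= mulr1.
have cX k (x : R) : (fun x => x ^+ k)%R y @[y --> x] --> (x ^+ k)%R.
  exact: exprn_continuous.
rewrite (@continuous_FTC2 _ _ (fun x => x ^+ j.+1)%R)//.
- apply: continuous_subspaceT => x; apply: cvgM; [exact: cvg_cst|exact: cX].
- split; [move=> x _; exact: ex_derive|apply: cvg_at_right_filter; exact: cX|
      apply: cvg_at_left_filter; exact: cX].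
- by move=> x _; rewrite derive1E; apply: derive_val.
Qed.

End ClosedDisc.

(** * Moments of the modulus on discs *)

Section DiscMoments.
Context {R : realType}.
Local Notation C := (Cplx R).
Local Notation M := (measurableTypeR R).
Local Notation mu := (@lebesgue_measure R).
Local Notation area := (@area R).
Local Open Scope ereal_scope.

Lemma measurable_cabs_pow j :
  measurable_fun setT (fun w : M * M => (cabs (of_pair w : C) ^+ 2) ^+ j)%R.
Proof. by apply: measurable_funX; exact: measurable_cabs_sqr cmeas_of_pair. Qed.

Lemma aint_cball_cst (r c : R) : (0 < r)%R -> (0 <= c)%R ->
  aint ((fun=> c%:E) \_ (@cball R r)) = (c * (pi * r ^+ 2))%:E.
Proof.
move=> r0 c0; rewrite (@aint_cball_scale _ r (fun=> c) (fun=> c))//.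
rewrite (_ : (fun=> _) \_ _ = fun z : C => c%:E * ((fun=> 1%:E) \_ (cball 1%R)) z); last first.
  by apply/funext => z; rewrite !patchE; case: ifPn => _; rewrite ?mule1 ?mule0.
rewrite aintZl//.
- by rewrite aint_disc1 -!EFinM; congr (_%:E); ring.
- by apply: (@pmeas_cball _ 1%R (fun=> 1%R)); exact: measurable_cst.
- by move=> z; apply: (@patch_ge0 _ _ (fun=> 1%R)).
Qed.

Let sqr_le_sqrt (x u : R) : (0 <= x)%R -> (0 <= u)%R -> (x ^+ 2 <= u)%R = (x <= Num.sqrt u)%R.
Proof.
move=> x0 u0; rewrite -[in RHS](@ler_pXn2r _ 2)// ?nnegrE ?sqrtr_ge0//.
by rewrite sqr_sqrtr.
Qed.

(** Layer-cake decomposition: integrating in [u] gives [1 - |z|^(2 i + 2)] on the unit disc, while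
    integrating in [z] gives [(i + 1) u^i] times the area [pi u] of the disc of radius [sqrt u]. *)
Let layer (i : nat) (x : (M * M) * M) : \bar R :=
  ((fun x : (M * M) * M => (i.+1%:R * x.2 ^+ i)%:E) \_
   [set x | (0 < x.2 :> R)%R /\ (x.2 <= 1 :> R)%R /\ (cabs (of_pair x.1 : C) ^+ 2 <= x.2)%R]) x.

Let measurable_layer i : measurable_fun setT (layer i).
Proof.
pose X := ((M * M) * M)%type.
have m2 : measurable_fun [set: X] (fun x => x.2 : R) by exact: measurable_snd.
have m1 : measurable_fun [set: X] (fun x => cabs (of_pair x.1 : C) ^+ 2)%R.
  by apply: measurable_cabs_sqr; exact: (cmeas_comp cmeas_of_pair (g := fst)).
apply/(measurable_restrictT (fun x : X => (i.+1%:R * x.2 ^+ i)%:E)).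
  rewrite (_ : [set x | _] = ((fun x : X => x.2 : R) @^-1` `]0%R, 1%R]%classic) `&`
     ((fun x : X => (x.2 : R) - cabs (of_pair x.1 : C) ^+ 2)%R @^-1` `[0%R, +oo[%classic)).
    apply: measurableI; rewrite -[X in measurable X]setTI.
      exact: (m2 measurableT _ (measurable_itv _)).
    exact: ((measurable_funB m2 m1) measurableT _ (measurable_itv _)).
  apply/seteqP; split => x; rewrite /= !in_itv/= subr_ge0 andbT.
    by move=> [-> [-> ->]].
  by move=> [/andP[-> ->] ->].
apply: measurableT_comp => //; apply: measurable_funTS.
by apply: measurable_funM => //; exact: measurable_funX.
Qed.

Let layer_ge0 i x : 0 <= layer i x.
Proof.
rewrite /layer patchE; case: ifPn => //; rewrite inE => -[/ltW x0 _].
by rewrite lee_fin mulr_ge0// exprn_ge0.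
Qed.

Let integral_layer_u i (z : M * M) :
  \int[mu]_u layer i (z, u) =
  ((fun z : C => (1 - (cabs z ^+ 2) ^+ i.+1)%:E) \_ (cball 1%R)) (of_pair z).
Proof.
set q := (cabs (of_pair z : C) ^+ 2)%R.
have q0 : (0 <= q)%R by exact: sqr_ge0.
rewrite patchE; case: ifPn.
  rewrite inE /cball/= => z1.
  have q1 : (q <= 1)%R by rewrite /q -(expr1n _ 2) lerXn2r ?nnegrE ?cabs_ge0.
  have := integral_expr_itv i q1; rewrite expr1n => <-.
  rewrite -integral_itv_obnd_cbnd; last first.
    apply: measurableT_comp => //; apply: measurable_funTS.
    by apply: measurable_funM => //; exact: measurable_funX.
  rewrite [in RHS]integral_mkcond.
  (* [layer] requires [0 < u], so the interval is closed at [q] exactly when [q > 0]; the integral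
     is the same in both cases. *)
  rewrite (_ : (fun u : R => layer i (z, u)) =
     (fun u : R => (i.+1%:R * u ^+ i)%:E) \_ (if (0 < q)%R then `[q, 1%R]%classic else `]q, 1%R]%classic)).
    case: ifPn => // qq; rewrite -!integral_mkcond integral_itv_obnd_cbnd//.
    apply: measurableT_comp => //; apply: measurable_funTS.
    by apply: measurable_funM => //; exact: measurable_funX.
  apply/funext => u; rewrite /layer !patchE/=; congr (if _ then _ else _).
  apply/idP/idP => /set_mem h; apply/mem_set; move: h => /=.
    move=> [u0 [u1 qu]]; case: ifPn => q00; rewrite /= in_itv/= ?qu ?u1//.
    by rewrite andbT (le_lt_trans _ u0)// leNgt.
  case: ifPn => q00; rewrite /= in_itv/= => /andP[a b]; split => //.
    exact: lt_le_trans a.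
    exact: le_lt_trans a.
  by split => //; exact: ltW.
rewrite notin_setE /cball/= => /negP; rewrite -ltNge => z1.
rewrite integral0_eq// => u _; rewrite /layer patchE; case: ifPn => //.
rewrite inE/= => -[_ [u1 qu]]; exfalso.
have : (1 < q)%R by rewrite /q -(expr1n _ 2) ltrXn2r ?nnegrE ?cabs_ge0// ltW.
by rewrite ltNge (le_trans qu).
Qed.

Let integral_layer_z i (u : M) :
  \int[area]_z layer i (z, u) = ((fun u => (pi * i.+1%:R / i.+2%:R * (i.+2%:R * u ^+ i.+1))%:E) \_ `]0%R, 1%R]%classic) (u : R).
Proof.
rewrite patchE; case: ifPn.
  rewrite inE/= in_itv/= => /andP[u0 u1].
  have u00 : (0 <= (u : R))%R by exact: ltW.
  transitivity (aint ((fun=> (i.+1%:R * (u : R) ^+ i)%:E) \_ (@cball R (Num.sqrt (u : R))))).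
    apply: eq_integral => z _; rewrite /layer !patchE/=; congr (if _ then _ else _).
    have E : (cabs (of_pair z : C) ^+ 2 <= u)%R = (cabs (of_pair z : C) <= Num.sqrt (u : R))%R.
      exact: sqr_le_sqrt (cabs_ge0 _) u00.
    apply/idP/idP => /set_mem h; apply/mem_set; move: h; rewrite /cball/= -E.
      by move=> [_ [_]].
    by move=> h; split.
  rewrite aint_cball_cst ?sqrtr_gt0//; last by rewrite mulr_ge0// exprn_ge0.
  rewrite sqr_sqrtr//; congr (_%:E); rewrite exprS; field.
  by rewrite -(natrD _ 2 i) pnatr_eq0.
rewrite notin_setE/= in_itv/= => /negP nu.
rewrite integral0_eq// => z _; rewrite /layer patchE; case: ifPn => //.
by rewrite inE/= => -[u0 [u1 _]]; move: nu; rewrite u0 u1.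
Qed.

(** The layers compute the complementary integral, of [1 - |z|^(2 j)], which is subtracted from the
    area [pi]. *)
Lemma aint_disc_moment (j : nat) :
  aint ((fun z : C => ((cabs z ^+ 2) ^+ j)%:E) \_ (cball 1%R)) = (pi / j.+1%:R)%:E.
Proof.
case: j => [|i].
  rewrite divr1 -aint_disc1; congr aint; congr (_ \_ _).
have mq := measurable_cabs_pow i.+1.
pose f1 := ((fun z : C => ((cabs z ^+ 2) ^+ i.+1)%:E) \_ (cball 1%R)).
pose f2 := ((fun z : C => (1 - (cabs z ^+ 2) ^+ i.+1)%:E) \_ (cball 1%R)).
have mf1 : pmeas f1 by exact: pmeas_cball.
have mf2 : pmeas f2.
  by apply: (pmeas_cball 1%R (u := fun z => 1 - (cabs z ^+ 2) ^+ i.+1)%R); exact: measurable_funB.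
have f10 z : 0 <= f1 z by rewrite /f1; apply: patch_ge0 => w; rewrite exprn_ge0// sqr_ge0.
have f20 z : 0 <= f2 z.
  rewrite /f2 patchE; case: ifPn => //; rewrite inE /cball/= => z1.
  by rewrite lee_fin subr_ge0 -exprM exprn_ile1 ?cabs_ge0.
have S : (pi : R)%:E = aint f1 + aint f2.
  rewrite -aint_disc1 /aint -ge0_integralD//; apply: eq_integral => w _.
  rewrite /f1 /f2 !patchE; case: ifPn => _; last by rewrite adde0.
  by rewrite -EFinD addrC subrK.
have f2E : aint f2 = (pi * i.+1%:R / i.+2%:R)%:E.
  transitivity (\int[area]_z \int[mu]_u layer i (z, u)).
    by apply: eq_integral => z _; rewrite integral_layer_u.
  have -> : \int[area]_z \int[mu]_u layer i (z, u) = \int[mu]_u \int[area]_z layer i (z, u).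
    exact: (@fubini_tonelli _ _ _ _ _ (@sfarea R) mu (layer i) (@measurable_layer i) (layer_ge0 i)).
  transitivity (\int[mu]_u ((fun u => (pi * i.+1%:R / i.+2%:R * (i.+2%:R * u ^+ i.+1))%:E) \_ `]0%R, 1%R]%classic) (u : R)).
    by apply: eq_integral => u _; exact: integral_layer_z.
  rewrite -integral_mkcond integral_itv_obnd_cbnd; last first.
    apply: measurableT_comp => //; apply: measurable_funTS.
    by apply: measurable_funM => //; apply: measurable_funM => //; exact: measurable_funX.
  under eq_integral => u _ do rewrite EFinM.
  rewrite ge0_integralZl//.
  - by rewrite integral_expr_itv// expr1n expr0n/= subr0 -EFinM mulr1.
  - apply: measurableT_comp => //; apply: measurable_funTS.
    by apply: measurable_funM => //; exact: measurable_funX.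
  - by move=> u; rewrite /= in_itv/= => /andP[u0 _]; rewrite lee_fin mulr_ge0// exprn_ge0.
  - by rewrite lee_fin !mulr_ge0// pi_ge0.
move: S; rewrite f2E -/f1; move: (aint f1) => [c| |]//= [S].
congr (_%:E); have -> : c = (pi - pi * i.+1%:R / i.+2%:R)%R by rewrite {1}S addrK.
rewrite -[i.+2%:R]natr1; field.
by rewrite -(natrD _ 1 i) natr1 pnatr_eq0.
Qed.

Lemma aint_cball_moment (r : R) (j : nat) : (0 < r)%R ->
  aint ((fun z : C => ((cabs z ^+ 2) ^+ j)%:E) \_ (cball r)) = (pi * r ^+ (2 * j.+1) / j.+1%:R)%:E.
Proof.
move=> r0.
have mq := measurable_cabs_pow j.
have q0 (z : C) : (0 <= (cabs z ^+ 2) ^+ j)%R by rewrite exprn_ge0// sqr_ge0.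
rewrite (@aint_cball_scale _ r _ (fun z => r ^+ (2 * j) * (cabs z ^+ 2) ^+ j)%R)//; last first.
  by move=> z; rewrite cabsM cabs_cre (gtr0_norm r0) -!exprM exprMn.
rewrite (_ : (fun z => _) \_ _ = fun z : C => (r ^+ (2 * j))%:E *
    ((fun z : C => ((cabs z ^+ 2) ^+ j)%:E) \_ (cball 1%R)) z); last first.
  by apply/funext => z; rewrite !patchE; case: ifPn => _; rewrite ?EFinM ?mule0.
rewrite aintZl//.
- by rewrite aint_disc_moment -!EFinM mulnS exprD; congr (_%:E); ring.
- by rewrite lee_fin exprn_ge0// ltW.
- exact: pmeas_cball.
- by move=> z; exact: patch_ge0.
Qed.

End DiscMoments.

(** * Lower bound of an energy by a leading coefficient *)

Section LeadingCoefficientBound.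
Context {R : realType}.
Local Notation C := (Cplx R).
Local Notation M := (measurableTypeR R).
Local Notation mu := (@lebesgue_measure R).
Local Notation area := (@area R).
Implicit Types (G : C -> C) (L z c : C) (j : nat).

Definition cconj z : C := cpt (complex.Re z) (- complex.Im z).

Lemma cabs_cconj z : cabs (cconj z) = cabs z.
Proof. by rewrite !cabsE !reimE sqrrN. Qed.

Lemma mul_cconj z : cconj z * z = cre (cabs z ^+ 2).
Proof. by apply: cplx_ext; rewrite !reimE ?cabs_sqr; ring. Qed.

(** This is [0 <= |z - c|^2]. The lower bound is affine in [z], so the mean value property evaluates
    its integral and no Cauchy-Schwarz inequality is needed. *)
Lemma sqr_cabs_ge z c : 2 * complex.Re (cconj c * z) - cabs c ^+ 2 <= cabs z ^+ 2.
Proof.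
rewrite !cabs_sqr !reimE.
by have := sqr_ge0 (complex.Re z - complex.Re c); have := sqr_ge0 (complex.Im z - complex.Im c); nra.
Qed.

Lemma cis_neq0 (t : R) : cis t != 0.
Proof. by rewrite -cabs_eq0 cabs_cis oner_eq0. Qed.

(* The mean over the circle of [G (w z) / w ^ j] is [L z ^ j]. *)
Lemma circle_sqr_ge G r j L z : (forall z, cdisc 0 r z -> derivable G z 1) ->
  leading G 0 j L -> cabs z < r ->
  (((2 * pi) * (cabs L ^+ 2 * (cabs z ^+ 2) ^+ j))%:E <=
   \int[mu]_(t in `[0%R, (2 * pi)%R]) (cabs (G (cis t * z)) ^+ 2)%:E)%E.
Proof.
move=> Gd GL zr; pose c := L * z ^+ j.
have r0 : 0 < r := le_lt_trans (cabs_ge0 z) zr.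
have zd w : cabs w <= 1 -> cdisc 0 r (w * z).
  rewrite /cdisc/= subr0 cabsM => w1; apply: le_lt_trans zr.
  by rewrite -[leRHS]mul1r ler_wpM2r// cabs_ge0.
(* Only singular at 0, where it tends to [|c|^2]; hence its mean over the unit circle is [|c|^2]. *)
pose h w := cconj c * (G (w * z) / w ^+ j).
have hd w : 0 < cabs (w - 0) <= 1 -> derivable h w 1.
  rewrite subr0 cabs_gt0 => /andP[w0 w1]; have Gw := cd_ex (Gd _ (zd _ w1)).
  have H1 := cd_comp (cdM (cd_id w) (cd_cst z w)) Gw.
  have H2 : derivable (fun w : C => (w ^+ j)^-1) w 1.
    case: (j) => [|i]; last first.
      by apply: cd_derivable; apply: cdV (cdX _ (cd_id w)); rewrite expf_neq0.
    rewrite (_ : (fun _ => _) = fun=> 1); first exact: cd_derivable (cd_cst _ _).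
    by apply/funext => x; rewrite expr0 invr1.
  exact: cd_derivable (cdZ _ (cdM H1 (cd_ex H2))).
have hL (e : R) : 0 < e -> exists2 d : R, 0 < d &
     forall w, 0 < cabs (w - 0) < d -> cabs (h w - cre (cabs c ^+ 2)) <= e.
  move=> e0; pose k := cabs c * cabs z ^+ j + 1.
  have k0 : 0 < k by rewrite ltr_wpDl// mulr_ge0 ?exprn_ge0 ?cabs_ge0.
  have [d d0 H] := GL _ (divr_gt0 e0 k0); pose m := cabs z + 1.
  have m0 : 0 < m by rewrite ltr_wpDl ?cabs_ge0.
  exists (d / m); first exact: divr_gt0.
  move=> w; rewrite subr0 cabs_gt0 => /andP[w0 wd].
  have := H (w * z); rewrite subr0 cabsM => /(_ _)/wrap[].
    move: wd; rewrite ltr_pdivlMr//; apply: le_lt_trans.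
    by rewrite ler_wpM2l ?cabs_ge0// lerDl.
  move=> Hw; rewrite /h -mul_cconj -mulrBr cabsM cabs_cconj.
  have wj : 0 < cabs w ^+ j by rewrite exprn_gt0// cabs_gt0.
  have -> : G (w * z) / w ^+ j - c = (G (w * z) - L * (w * z) ^+ j) / w ^+ j.
    by rewrite /c exprMn mulrBl [L * (w ^+ j * _)]mulrCA -[(w ^+ j * _) * _]mulrA [w ^+ j * _]mulrC divfK// expf_neq0.
  rewrite cabsM cabsV cabsX; move: Hw; rewrite exprMn (exprMn j (cabs w)) => Hw.
  rewrite mulrA ler_pdivrMr//; apply: (le_trans (ler_wpM2l (cabs_ge0 c) Hw)).
  rewrite (_ : cabs c * _ = (cabs c * cabs z ^+ j) * (e / k * cabs w ^+ j)); last by ring.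
  rewrite (_ : e * cabs w ^+ j = k * (e / k * cabs w ^+ j)); last by field; rewrite gt_eqF.
  by rewrite ler_wpM2r ?lerDl// mulr_ge0 ?(ltW wj)// divr_ge0 ?ltW.
have hc : cts_on 0 (2 * pi) (fun t => h (0 + cre 1 * cis t)).
  by apply: circ_cts => // w w1; apply: hd; rewrite w1 ltr01 lexx.
have := circ_lim ltr01 hd hL; rewrite -creM => /(congr1 (@complex.Re R)).
rewrite re_cre /circ /cint re_cpt => hI.
(* [q] is the affine minorant of [|G|^2]: on the unit circle, division by [w^j] does not change the
   modulus. *)
have hre := cts_on_re hc; pose q (t : R) := 2 * complex.Re (h (0 + cre 1 * cis t)) - cabs c ^+ 2.
have qc : cts_on 0 (2 * pi) q.
  move=> t /hre ht; apply: cvgB; last exact: cvg_cst.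
  by apply: cvgM => //; exact: cvg_cst.
have Gc : cts_on 0 (2 * pi) (fun t => cabs (G (cis t * z)) ^+ 2).
  move=> t _; apply: (@cvg_comp _ _ _ _ (fun x : R => x ^+ 2)); last exact: exprn_continuous.
  apply: (@cvg_cabs _ _ (nbhs t)); apply: (cvg_comp (fun t => cis t * z) G).
    by apply: cvgM; [exact: cvg_cis|exact: cvg_cst].
  by apply: derivable_cvg; apply: Gd; apply: zd; rewrite cabs_cis.
have qI : (\int[mu]_(t in `[0%R, (2 * pi)%R]) (q t)%:E = ((2 * pi) * (cabs L ^+ 2 * (cabs z ^+ 2) ^+ j))%:E)%E.
  rewrite -(fineK (integrable_fin_num _ (cts_on_integrable qc)))//; congr (_%:E).
  change (\int[mu]_(t in `[0%R, (2 * pi)%R]) q t = (2 * pi) * (cabs L ^+ 2 * (cabs z ^+ 2) ^+ j)).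
  rewrite /q RintegralB//; last 2 first.
  - apply: cts_on_integrable => t /hre ht; apply: cvgM => //; exact: cvg_cst.
  - by apply: cts_on_integrable => t _; exact: cvg_cst.
  rewrite RintegralZl//; last exact: cts_on_integrable.
  transitivity (2 * (2 * pi * cabs c ^+ 2) - cabs c ^+ 2 * (2 * pi)).
    congr (2 * _ - _); first exact: hI.
    by rewrite Rintegral_cst//= lebesgue_measure_itv/= lte_fin mulr_gt0 ?pi_gt0//= subr0.
  by rewrite /c cabsM cabsX exprMn -[cabs z ^+ j ^+ 2]exprM -[cabs z ^+ 2 ^+ j]exprM [(j * 2)%N]mulnC; ring.
rewrite -qI; apply: le_integral => //; [exact: cts_on_integrable|exact: cts_on_integrable|].
move=> t _; rewrite lee_fin /q /h add0r cre1 mul1r.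
apply: (le_trans (sqr_cabs_ge _ _)).
by rewrite cabsM cabsV cabsX cabs_cis expr1n invr1 mulr1.
Qed.

Lemma cmeas_cis : cmeas (cis : M -> C).
Proof.
split; apply: continuous_measurable_fun; [exact: continuous_cos|exact: continuous_sin].
Qed.

(** The moments are known for closed discs, whereas [G] is controlled on the open one; hence the
    smaller radius [s], which may be taken as close to [r] as desired. *)
Lemma leading_aint G (r s : R) j L : 0 < s -> s < r ->
  (forall z, cdisc 0 r z -> derivable G z 1) -> leading G 0 j L ->
  ((cabs L ^+ 2 * (pi * s ^+ (2 * j.+1) / j.+1%:R))%:E <=
   aint ((fun z => (cabs (G z) ^+ 2)%:E) \_ (cdisc 0 r)))%E.
Proof.
move=> s0 sr Gd GL; set S := (X in aint X).
have mS : pmeas S.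
  apply: pmeas_patch; first exact: open_cdisc.
  move=> z zr; apply: (@cvg_comp _ _ _ _ (fun x : R => x ^+ 2)); last exact: exprn_continuous.
  by apply: (@cvg_cabs _ _ (nbhs z)); apply: derivable_cvg; exact: Gd.
have S0 z : (0 <= S z)%E by apply: patch_ge0 => w; exact: sqr_ge0.
pose T : set M := `[0%R, (2 * pi)%R]%classic.
have mT : measurable T by exact: measurable_itv.
have muT : mu T = (2 * pi)%:E.
  by rewrite lebesgue_measure_itv/= lte_fin mulr_gt0 ?pi_gt0// -EFinB subr0.
pose P (w : M * (M * M)) := S (cis w.1 * of_pair w.2).
have mP : measurable_fun setT P.
  apply: (pmeas_comp mS (T := fun w : M * (M * M) => cis w.1 * of_pair w.2)); apply: cmeasM.
    exact: (cmeas_comp cmeas_cis (g := fst)).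
  exact: (cmeas_comp cmeas_of_pair (g := snd)).
pose PT (w : M * (M * M)) := (P w * (\1_T w.1)%:E)%E.
have mPT : measurable_fun setT PT.
  apply: emeasurable_funM => //; apply: measurableT_comp => //.
  by apply: measurableT_comp.
have PT0 w : (0 <= PT w)%E by apply: mule_ge0; [exact: S0|rewrite lee_fin].
have E1 : (\int[mu]_t \int[area]_z PT (t, z) = (2 * pi)%:E * aint S)%E.
  transitivity (\int[mu]_t (aint S * (\1_T t)%:E))%E.
    apply: eq_integral => t _; rewrite /PT /=.
    have := aint_mull (cis_neq0 t) mS S0; rewrite cabs_cis expr1n invr1 mul1e => <-.
    rewrite muleC -aintZl//; last exact: pmeas_mull.
    by apply: eq_integral => z _; rewrite muleC.
  rewrite ge0_integralZl//; [|by apply: measurableT_comp|exact: aint_ge0].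
  by rewrite integral_indic// setIT muleC; congr (_ * _)%E.
have E2 : (\int[mu]_t \int[area]_z PT (t, z) = \int[area]_z \int[mu]_t PT (t, z))%E.
  exact: (@fubini_tonelli _ _ _ _ _ mu (@sfarea R) PT mPT PT0).
have pi2 : 0 < 2 * pi :> R by rewrite mulr_gt0// pi_gt0.
have E3 : ((2 * pi * cabs L ^+ 2)%:E * aint ((fun z => ((cabs z ^+ 2) ^+ j)%:E) \_ (cball s))
   <= \int[area]_z \int[mu]_t PT (t, z))%E.
  have mq := @measurable_cabs_pow R j.
  have mc := @pmeas_cball R s (fun z => (cabs z ^+ 2) ^+ j) mq.
  have c0 z : (0 <= ((fun z : C => ((cabs z ^+ 2) ^+ j)%:E) \_ (cball s)) z)%E.
    by apply: patch_ge0 => w; rewrite exprn_ge0// sqr_ge0.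
  have k0 : (0 <= (2 * pi * cabs L ^+ 2)%:E)%E by rewrite lee_fin mulr_ge0 ?sqr_ge0// ltW.
  rewrite -aintZl//; apply: ge0_le_integral => //.
  - by move=> z _; rewrite mule_ge0.
  - by apply: emeasurable_funM => //; exact: measurable_cst.
  - exact: (@measurable_fun_fubini_tonelli_G _ _ _ _ _ mu PT mPT PT0).
  move=> z _; rewrite patchE; case: ifPn => [|_]; last first.
    by rewrite mule0; apply: integral_ge0.
  rewrite inE /cball/= => zs; have zr := le_lt_trans zs sr.
  have := circle_sqr_ge Gd GL zr; rewrite [in X in X -> _]mulrA EFinM => /le_trans; apply.
  rewrite le_eqVlt; apply/orP; left; apply/eqP; rewrite integral_mkcond; apply: eq_integral.
  move=> t _; rewrite /PT /P/= indicE patchE; case: ifPn => _; last by rewrite mule0.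
  rewrite mule1 /S patchE ifT// inE /cdisc/= subr0 cabsM cabs_cis mul1r//.
move: E3; rewrite -E2 E1 aint_cball_moment//.
by rewrite -EFinM -(mulrA (2 * pi)) EFinM lee_pmul2l.
Qed.

End LeadingCoefficientBound.

(** * Calculus of leading terms *)

Section LeadingTerm.
Context {R : realType}.
Local Notation C := (Cplx R).
Implicit Types (f g : C -> C) (L z a : C).

Lemma cvg_cX f z L n : f x @[x --> z] --> L -> f x ^+ n @[x --> z] --> L ^+ n.
Proof.
move=> fl; elim: n => [|n IH].
  rewrite expr0 (_ : (fun x => f x ^+ 0) = fun=> 1); last by apply/funext => x; rewrite expr0.
  exact: (cd_cvg (cd_cst (1 : C) z)).
rewrite exprS (_ : (fun x => f x ^+ n.+1) = fun x => f x * f x ^+ n); last by apply/funext => x; rewrite exprS.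
exact: (cvgM fl IH).
Qed.

(** The continuous factor [g] carries a leading term through a composition or a product, where only
    limits have to be multiplied. *)
Lemma leading_factor f a m L : leading f a m L ->
  exists g, [/\ g z @[z --> a] --> L, g a = L & forall z, f z = g z * (z - a) ^+ m].
Proof.
move=> H; pose g z := if z == a then L else f z / (z - a) ^+ m.
exists g; split; last 2 first.
- by rewrite /g eqxx.
- move=> z; rewrite /g; have [->|za] := eqVneq z a; last by rewrite divfK// expf_neq0 ?subr_eq0.
  apply/eqP; rewrite -subr_eq0 -cabs_eq0 eq_le cabs_ge0 andbT.
  apply/ler_addgt0Pl => e e0; rewrite addr0; have [d d0 Hd] := H e e0.
  have := Hd a; rewrite subrr cabs0 => /(_ d0)/le_trans; apply.
  by rewrite ler_piMr ?(ltW e0)// expr0n; case: (m) => //=.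
apply/(@cvg_cplxP _ _ (nbhs a)) => e e0; apply/nbhs_cplxP.
have [d d0 Hd] := H (e / 2) (divr_gt0 e0 (ltr0Sn _ 1)).
exists d => // z zd; rewrite /g; have [_|za] := eqVneq z a; first by rewrite subrr cabs0.
have zm : 0 < cabs (z - a) ^+ m by rewrite exprn_gt0// cabs_gt0 subr_eq0.
rewrite -(ltr_pM2r zm) -cabsX -cabsM mulrBl divfK ?expf_neq0 ?subr_eq0//.
apply: (le_lt_trans (Hd _ zd)); rewrite -cabsX ltr_pM2r ?cabsX//.
by rewrite ltr_pdivrMr// ltr_pMr// ltr1n.
Qed.

Lemma factor_leading f g a m r L : 0 < r -> g z @[z --> a] --> L ->
  (forall z, cabs (z - a) < r -> z != a -> f z = g z * (z - a) ^+ m) ->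
  f a = L * 0 ^+ m -> leading f a m L.
Proof.
move=> r0 /cvg_cplxP gL fg fa e e0; have /nbhs_cplxP[d d0 H] := gL e e0.
exists (Num.min r d); first by rewrite lt_min r0.
move=> z; rewrite lt_min => /andP[zr zd]; have [->|za] := eqVneq z a.
  rewrite subrr fa subrr cabs0 mulr_ge0 ?(ltW e0)// exprn_ge0//.
rewrite fg// -mulrBl cabsM cabsX ler_wpM2r ?exprn_ge0 ?cabs_ge0//.
exact/ltW/H.
Qed.

Lemma leading_uniq f a m L L' : leading f a m L -> leading f a m L' -> L = L'.
Proof.
move=> H H'; apply/eqP; rewrite -subr_eq0 -cabs_eq0 eq_le cabs_ge0 andbT.
apply/ler_addgt0Pl => e e0; rewrite addr0.
have e2 : 0 < e / 2 by rewrite divr_gt0.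
have [d d0 Hd] := H _ e2; have [d' d'0 Hd'] := H' _ e2.
pose t := Num.min d d' / 2; pose z := a + cre t.
have md : 0 < Num.min d d' by rewrite lt_min d0.
have t0 : 0 < t by rewrite divr_gt0.
have tm : t < Num.min d d' by rewrite ltr_pdivrMr// ltr_pMr// ltr1n.
have [td td'] : t < d /\ t < d' by move: tm; rewrite lt_min => /andP.
have za : z - a = cre t by rewrite /z addrC addKr.
have zt : cabs (z - a) = t by rewrite za cabs_cre gtr0_norm.
have tm0 : 0 < t ^+ m by rewrite exprn_gt0.
have := Hd z; have := Hd' z; rewrite zt => /(_ td') h' /(_ td) h.
rewrite -(ler_pM2r tm0) -{1}zt -cabsX -cabsM.
have -> : (L - L') * (z - a) ^+ m = (f z - L' * (z - a) ^+ m) - (f z - L * (z - a) ^+ m) by ring.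
by have := cabsBD (f z - L' * (z - a) ^+ m) (f z - L * (z - a) ^+ m); lra.
Qed.

Lemma leading_lower f a (k m : nat) L : (k < m)%N -> leading f a m L -> leading f a k 0.
Proof.
move=> km /leading_factor[g [gL ga fg]].
apply: (@factor_leading f (fun z => g z * (z - a) ^+ (m - k)) a k 1 0 ltr01).
- have [i mk] : exists i, (m - k = i.+1)%N by exists (m - k).-1%N; rewrite prednK// subn_gt0.
  have X := cd_cvg (cdX i (cdB (cd_id a) (cd_cst a a))).
  have Z : L * (a - a) ^+ i.+1 = 0 by rewrite subrr expr0n /= mulr0.
  rewrite mk -Z.
  exact: (cvgM gL X).
- by move=> z _ _; rewrite fg -mulrA -exprD subnK// ltnW.
- by rewrite mul0r fg subrr expr0n (gtn_eqF (leq_ltn_trans (leq0n k) km)) mulr0.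
Qed.

(** Converse of [leading_taylor], by strong induction and uniqueness of leading coefficients. It
    reads off the derivatives of the test function at its zero without differentiating
    repeatedly. *)
Lemma leading_derive1n D f a m L : open D -> D a -> holomorphic_on D f -> leading f a m L ->
  (forall k : nat, (k < m)%N -> derive1n k f a = 0) /\ derive1n m f a = m`!%:R * L.
Proof.
move=> oD Da fD H.
have Z : forall k : nat, (k < m)%N -> derive1n k f a = 0.
  move=> k; elim/ltn_ind: k => k IH km.
  have := leading_taylor oD Da fD (fun i ik => IH i ik (ltn_trans ik km)).
  move=> /leading_uniq/(_ (leading_lower km H))/eqP.
  by rewrite mulf_eq0 invr_eq0 pnatr_eq0 (gtn_eqF (fact_gt0 k)) orbF => /eqP.
split=> //; have <- := leading_uniq (leading_taylor oD Da fD Z) H.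
by rewrite mulrC divfK// pnatr_eq0 -lt0n fact_gt0.
Qed.

End LeadingTerm.

(** * Energy estimates transported by the Moebius map *)

Section Moebius.
Context {R : realType}.
Local Notation C := (Cplx R).
Local Notation M := (measurableTypeR R).
Local Notation area := (@area R).
Implicit Types (D : set C) (f : C -> C) (z w a zeta : C) (kap : R).

Lemma open_cneq a : open [set z : C | z != a].
Proof.
rewrite openE => z /= za; apply/nbhs_cplxP; exists (cabs (a - z)).
  by rewrite cabs_gt0 subr_eq0 eq_sym.
by move=> w wz; apply: contraTneq wz => ->; rewrite ltxx.
Qed.

Definition energy D f : \bar R :=
  (\int[area]_(w in of_pair @^-1` D) (Normc.normc (derive1 f (of_pair w)) ^+ 2)%:E)%E.

Lemma energyE D f : energy D f = aint ((fun z => (cabs (derive1 f z) ^+ 2)%:E) \_ D).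
Proof. by rewrite /energy integral_mkcond /aint; apply: eq_integral => w _. Qed.

Lemma energy_ge0 D f : (0 <= energy D f)%E.
Proof. by apply: integral_ge0 => w _; rewrite lee_fin sqr_ge0. Qed.

Lemma cvg_cabs_sqr f z : derivable f z 1 -> cabs (f x) ^+ 2 @[x --> z] --> cabs (f z) ^+ 2.
Proof.
move=> /derivable_cvg fz.
apply: (@cvg_comp _ _ _ _ (fun x : R => x ^+ 2)); last exact: exprn_continuous.
exact: (@cvg_cabs _ _ (nbhs z)).
Qed.

Lemma pmeas_energy D f : open D -> holomorphic_on D f ->
  pmeas ((fun z => (cabs (derive1 f z) ^+ 2)%:E) \_ D).
Proof.
move=> oD fD; apply: pmeas_patch => // z Dz.
exact/cvg_cabs_sqr/(holomorphic_derive oD fD).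
Qed.

Lemma aint_le (F G : C -> \bar R) : pmeas F -> pmeas G -> (forall z, 0 <= F z)%E ->
  (forall z, F z <= G z)%E -> (aint F <= aint G)%E.
Proof.
by move=> mF mG F0 FG; apply: ge0_le_integral => //.
Qed.

Lemma cabs_nat (k : nat) : cabs (k%:R : C) = k%:R.
Proof.
rewrite (_ : k%:R = cre k%:R); first by rewrite cabs_cre ger0_norm.
by elim: k => [|k IH]; [rewrite cre0|rewrite -!natr1 creD IH].
Qed.

(* The inverse of the Moebius map [z |-> (z - zeta) / (z - zeta - kap)]; the value at [w = 1],
   where the division gives [0], is the pole [zeta + kap]. *)
Definition moebius zeta kap w : C := zeta + cre kap + cre kap / (w - 1).

Lemma pmeas_moebius_wgt zeta kap (F : C -> \bar R) : pmeas F ->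
  pmeas (fun w => F (moebius zeta kap w) * (kap ^+ 2 / cabs (w - 1) ^+ 4)%:E)%E.
Proof.
move=> mF; have m1 : cmeas (fun w : M * M => of_pair w - 1 : C).
  by apply: cmeasD; [exact: cmeas_of_pair|exact: cmeas_cst].
apply: pmeasM.
  apply: (pmeas_comp mF (T := fun w : M * M => moebius zeta kap (of_pair w))).
  apply: cmeasD; first exact: cmeas_cst.
  by apply: cmeasM; [exact: cmeas_cst|exact: cmeasV].
apply: measurableT_comp => //; apply: measurable_funM => //.
apply: measurableT_comp; first exact: measurable_invr.
under eq_fun do rewrite (exprM _ 2 2).
by apply: measurable_funX; exact: measurable_cabs_sqr m1.
Qed.

(** The map is composed of a shift by -1, inversion, dilation by [kap] and a translation; the weight
    is the squared modulus of its derivative. The vanishing of [F] is the condition at 0 of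
    [aint_inv]. *)
Lemma aint_moebius zeta kap (F : C -> \bar R) : 0 < kap -> pmeas F ->
  (forall z, 0 <= F z)%E -> F (zeta + cre kap) = 0%E ->
  aint F = aint (fun w => F (moebius zeta kap w) * (kap ^+ 2 / cabs (w - 1) ^+ 4)%:E)%E.
Proof.
move=> k0 mF F0 Fa; have kn : cre kap != 0 by rewrite -cabs_eq0 cabs_cre normr_eq0 gt_eqF.
have kk : (0%:E <= (kap ^+ 2)%:E)%E by rewrite lee_fin sqr_ge0.
pose F1 z := F (zeta + cre kap + z); have mF1 : pmeas F1 by exact: pmeas_addl.
pose F2 z := F1 (cre kap * z); have mF2 : pmeas F2 by exact: pmeas_mull.
pose F3 z := (F2 (z^-1)%R * ((cabs z ^+ 4)^-1)%:E)%E.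
have mF3 : pmeas F3.
  apply: pmeasM; first by apply: (pmeas_comp mF2); apply: cmeasV; exact: cmeas_of_pair.
  apply: measurableT_comp => //; apply: measurableT_comp; first exact: measurable_invr.
  under eq_fun do rewrite (exprM _ 2 2).
  by apply: measurable_funX; exact: measurable_cabs_sqr cmeas_of_pair.
have F30 z : (0 <= F3 z)%E by rewrite mule_ge0// ?F0// lee_fin invr_ge0 exprn_ge0// cabs_ge0.
transitivity (aint F1); first by rewrite aint_addl.
transitivity ((kap ^+ 2)%:E * aint F2)%E.
  rewrite (aint_mull kn mF1 (fun=> F0 _)) muleA -EFinM cabs_cre gtr0_norm//.
  by rewrite mulfV ?mul1e// expf_neq0// gt_eqF.
rewrite (aint_inv mF2 (fun=> F0 _)); last by rewrite /F2 /F1 mulr0 addr0.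
rewrite -[aint _](aint_addl (-1)%R mF3 F30) -aintZl//; last exact: pmeas_addl.
congr aint; apply/funext => w; rewrite /F3 /F2 /F1 /moebius [(- 1 + w)%R]addrC muleCA.
by rewrite -EFinM.
Qed.

Lemma cd_moebius zeta kap w : w != 1 -> is_cd (moebius zeta kap) w (- cre kap / (w - 1) ^+ 2).
Proof.
move=> w1; have w10 : w - 1 != 0 by rewrite subr_eq0.
have := cdD (cd_cst (zeta + cre kap) w) (cdZ (cre kap) (cdV (f := fun w => w - 1) w10 (cdB (cd_id w) (cd_cst 1 w)))).
by congr is_cd; ring.
Qed.

Lemma cabs_lt1_neq1 w : cabs w < 1 -> w != 1.
Proof. by apply: contraTneq => ->; rewrite cabs1 ltxx. Qed.

Lemma moebiusE zeta kap w : w != 1 -> moebius zeta kap w = zeta + w * (cre kap / (w - 1)).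
Proof. by move=> w1; rewrite /moebius; field; rewrite subr_eq0. Qed.

Lemma moebius_energy_ge D f zeta kap (r s : R) n :
  open D -> holomorphic_on D f -> D zeta -> (0 < n)%N ->
  (forall k : nat, (k < n)%N -> derive1n k f zeta = 0) -> 0 < kap -> 0 < s -> s < r -> r <= 1 ->
  (forall w, cabs w < r -> D (moebius zeta kap w)) ->
  ((cabs (derive1n n f zeta) ^+ 2 * (pi * (kap * s) ^+ (2 * n) / (n`!%:R * n.-1`!%:R)))%:E
    <= energy D f)%E.
Proof.
case: n => // n oD fD Dz _ f0 k0 s0 sr r1 HD.
(* [a] is the value of [moebius] at [w = 1], where [aint_moebius] wants the integrand to vanish.
   Removing it from [D] leaves a lower bound for the energy. *)
pose a := zeta + cre kap; pose D' := D `&` [set z | z != a].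
have oD' : open D' by apply: openI => //; exact: open_cneq.
have f'D := holomorphic_derive oD fD.
have w1 w : cdisc 0 r w -> w != 1.
  by rewrite /cdisc/= subr0 => wr; apply: cabs_lt1_neq1; exact: lt_le_trans r1.
have wD w : cdisc 0 r w -> D (moebius zeta kap w).
  by rewrite /cdisc/= subr0; exact: HD.
pose G w := derive1 f (moebius zeta kap w) * (- cre kap / (w - 1) ^+ 2).
have Gd w : cdisc 0 r w -> derivable G w 1.
  move=> wr; have w10 : w - 1 != 0 by rewrite subr_eq0 w1.
  have H1 := cd_comp (cd_moebius zeta kap (w1 _ wr)) (cd_ex (f'D _ (wD _ wr))).
  have H2 := cdV (f := fun w => (w - 1) ^+ 2) (expf_neq0 2 w10) (cdX 1 (cdB (cd_id w) (cd_cst 1 w))).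
  exact: cd_derivable (cdM H1 (cdZ (- cre kap) H2)).
pose A := derive1n n.+1 f zeta / n`!%:R.
have lf : leading (derive1 f) zeta n A.
  rewrite /A derive1Sn; apply: (leading_taylor oD Dz f'D) => k kn.
  by rewrite -derive1Sn; exact: f0.
have [g [gA ga fg]] := leading_factor lf.
have r0 : 0 < r := lt_trans s0 sr.
have z0 : moebius zeta kap 0 = zeta by rewrite moebiusE ?mul0r ?addr0// eq_sym oner_eq0.
have n10 : (0 : C) != 1 by rewrite eq_sym oner_eq0.
pose L := A * (cre kap / (0 - 1)) ^+ n * (- cre kap / (0 - 1) ^+ 2).
have cL : cabs L = cabs A * kap ^+ n.+1.
  rewrite /L sub0r !cabsM cabsX cabsM !cabsV cabsX !cabsN cabs1 expr1n invr1 !mulr1.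
  by rewrite cabs_cre gtr0_norm// exprSr mulrA.
have lG : leading G 0 n L.
  apply: (@factor_leading _ G (fun w => g (moebius zeta kap w) * (cre kap / (w - 1)) ^+ n * (- cre kap / (w - 1) ^+ 2)) 0 n r L r0).
  - have w10 : (0 : C) - 1 != 0 by rewrite subr_eq0.
    have c1 : moebius zeta kap w @[w --> (0 : C)] --> zeta.
      by rewrite -[X in _ --> X]z0; exact: cd_cvg (cd_moebius zeta kap n10).
    have c2 : g (moebius zeta kap w) @[w --> (0 : C)] --> A := cvg_comp _ _ c1 gA.
    have c3 : (cre kap / (w - 1)) ^+ n @[w --> (0 : C)] --> (cre kap / (0 - 1)) ^+ n.
      apply: cvg_cX.
      exact: cd_cvg (cdZ (cre kap) (cdV (f := fun w => w - 1) w10 (cdB (cd_id (0 : C)) (cd_cst 1 (0 : C))))).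
    have c4 : - cre kap / (w - 1) ^+ 2 @[w --> (0 : C)] --> - cre kap / (0 - 1) ^+ 2.
      exact: cd_cvg (cdZ (- cre kap) (cdV (f := fun w => (w - 1) ^+ 2) (expf_neq0 2 w10) (cdX 1 (cdB (cd_id (0:C)) (cd_cst 1 (0:C)))))).
    exact: (cvgM (cvgM c2 c3) c4).
  - move=> w wr w0; rewrite /G fg {2}moebiusE ?w1//; rewrite addrC addKr exprMn subr0; ring.
  - by rewrite /G fg z0 ga subrr /L; case: (n) => [|i]; rewrite ?expr0 ?expr0n/= ?mulr0 ?mulr1 ?mul0r.
have := leading_aint s0 sr Gd lG.
(* The factor [1 / (n! (n-1)!)] arises as [1 / (n-1)!^2] from the Taylor coefficient of the
   derivative times [1 / n] from the moment. *)
rewrite cL (_ : _ * _ = cabs (derive1n n.+1 f zeta) ^+ 2 * (pi * (kap * s) ^+ (2 * n.+1) / ((n.+1)`!%:R * n`!%:R))); last first.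
  rewrite /A cabsM cabsV; rewrite cabs_nat factS natrM [in RHS]exprMn [(2 * _)%N]mulnC (exprM kap).
  move: (kap ^+ n.+1) (s ^+ _) (cabs _) => x y t; field.
  by rewrite (addrC 1) natr1 !pnatr_eq0 -!lt0n fact_gt0.
move=> /le_trans; apply.
pose F := (fun z => (cabs (derive1 f z) ^+ 2)%:E) \_ D'.
have mF : pmeas F.
  by apply: pmeas_patch => // z [Dz' _]; exact/cvg_cabs_sqr/(holomorphic_derive oD fD).
have F0 z : (0 <= F z)%E by apply: patch_ge0 => x; exact: sqr_ge0.
have Fa : F (zeta + cre kap) = 0%E.
  by rewrite /F patchE ifF//; apply/negbTE; rewrite notin_setE => -[_ /=]; rewrite eqxx.
have FD : (aint F <= energy D f)%E.
  rewrite energyE; apply: aint_le => //; first exact: pmeas_energy.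
  move=> z; rewrite /F !patchE; case: ifPn => [|_].
    by rewrite inE => -[Dz' _]; rewrite ifT// inE.
  by case: ifPn => // _; rewrite lee_fin sqr_ge0.
apply: le_trans FD; rewrite (aint_moebius k0 mF F0 Fa).
have wk w : (0 <= (kap ^+ 2 / cabs (w - 1) ^+ 4)%:E)%E.
  by rewrite lee_fin divr_ge0 ?exprn_ge0 ?cabs_ge0// ltW.
apply: aint_le.
- apply: pmeas_patch; first exact: open_cdisc.
  by move=> w /Gd; exact: cvg_cabs_sqr.
- exact: pmeas_moebius_wgt.
- by move=> w; apply: patch_ge0 => x; exact: sqr_ge0.
move=> w; rewrite patchE; case: ifPn => [|_]; last by rewrite mule_ge0.
rewrite inE => wr; have w10 : w - 1 != 0 by rewrite subr_eq0 w1.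
rewrite /F patchE ifT; last first.
  rewrite inE; split; first exact: wD.
  rewrite /= /moebius -subr_eq0 addrC addKr mulf_neq0 ?invr_eq0//.
  by rewrite -cabs_eq0 cabs_cre normr_eq0 gt_eqF.
rewrite -EFinM lee_fin /G cabsM cabsM cabsV cabsX cabsN cabs_cre gtr0_norm//.
rewrite le_eqVlt; apply/orP; left; apply/eqP.
by field; rewrite cabs_eq0.
Qed.

(** The hypothesis places the image of [D] in the disc of radius [rho]. It is met near [p] with
    [rho] close to 1 and, for any bounded [D], with a distant pole. *)
Lemma moebius_test D zeta kap (rho : R) n : open D -> D zeta -> (0 < n)%N -> 0 < kap -> 0 < rho ->
  (forall z, D z -> z != zeta + cre kap /\ cabs (z - zeta) <= rho * cabs (z - (zeta + cre kap))) ->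
  exists f, [/\ holomorphic_on D f, forall k : nat, (k < n)%N -> derive1n k f zeta = 0,
    cabs (derive1n n f zeta) = n`!%:R / kap ^+ n
    & (energy D f <= (n%:R * pi * rho ^+ (2 * n))%:E)%E].
Proof.
case: n => // n oD Dz _ k0 rho0 HD; pose a := zeta + cre kap.
pose u z := (z - zeta) / (z - a); pose f z := u z ^+ n.+1.
have kn : cre kap != 0 by rewrite -cabs_eq0 cabs_cre normr_eq0 gt_eqF.
have za z : D z -> z - a != 0 by move=> /HD[h _]; rewrite subr_eq0.
have ud z : D z -> is_cd u z (- cre kap / (z - a) ^+ 2).
  move=> /za h; have := cdM (cdB (cd_id z) (cd_cst zeta z)) (cdV (f := fun w => w - a) h (cdB (cd_id z) (cd_cst a z))).
  congr is_cd; rewrite /a in h *; field; exact: h.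
have fd z : D z -> is_cd f z (n.+1%:R * u z ^+ n * (- cre kap / (z - a) ^+ 2)).
  by move=> /ud; exact: cdX.
have fD : holomorphic_on D f by move=> z /fd/cd_derivable.
have fz0 : zeta - a = - cre kap by rewrite /a opprD addrA subrr sub0r.
have lf : leading f zeta n.+1 ((zeta - a)^-1 ^+ n.+1).
  apply: (@factor_leading _ f (fun z => (z - a)^-1 ^+ n.+1) zeta n.+1 1 _ ltr01).
  - apply: cvg_cX; exact: cd_cvg (cdV (f := fun w => w - a) (za _ Dz) (cdB (cd_id zeta) (cd_cst a zeta))).
  - by move=> z _ _; rewrite /f /u exprMn mulrC.
  - by rewrite /f /u subrr mul0r expr0n/= mulr0.
have [f0 fn] := leading_derive1n oD Dz fD lf.
exists f; split => //.
  by rewrite fn cabsM cabs_nat cabsX cabsV fz0 cabsN cabs_cre gtr0_norm// exprVn.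
rewrite energyE; set F := (X in aint X).
have mF : pmeas F by exact: pmeas_energy.
have F0 z : (0 <= F z)%E by apply: patch_ge0 => x; exact: sqr_ge0.
have Fa : F (zeta + cre kap) = 0%E.
  by rewrite /F patchE ifF//; apply/negbTE; rewrite notin_setE => /HD[/eqP].
rewrite (aint_moebius k0 mF F0 Fa).
(* The squared derivative of [w^(n+1)], whose integral over the disc is [(n+1)^2] times the moment
   [pi rho^(2n+2) / (n+1)]. *)
pose G : C -> \bar R := fun w => ((n.+1%:R ^+ 2)%:E * ((fun w : C => ((cabs w ^+ 2) ^+ n)%:E) \_ (cball rho)) w)%E.
have mq := @measurable_cabs_pow R n.
have mc := @pmeas_cball R rho (fun z => (cabs z ^+ 2) ^+ n) mq.
have c0 z : (0 <= ((fun z : C => ((cabs z ^+ 2) ^+ n)%:E) \_ (cball rho)) z)%E.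
  by apply: patch_ge0 => w; rewrite exprn_ge0// sqr_ge0.
have n0 : (0 <= ((n.+1%:R ^+ 2 : R))%:E)%E by rewrite lee_fin sqr_ge0.
have mG : pmeas G by apply: (@pmeasM _ (cst _)); [exact: measurable_cst|].
apply: (@le_trans _ _ (aint G)); last first.
  rewrite (aintZl n0 mc c0) aint_cball_moment// -EFinM lee_fin le_eqVlt; apply/orP; left; apply/eqP.
  by field; rewrite addrC natr1 pnatr_eq0.
apply: aint_le => //; first exact: pmeas_moebius_wgt.
  by move=> w; rewrite mule_ge0// lee_fin divr_ge0 ?exprn_ge0 ?cabs_ge0// ltW.
move=> w; rewrite /F patchE; case: ifPn => [|_]; last by rewrite mul0e /G mule_ge0.
rewrite inE => Dw; have [w1|w1] := eqVneq w 1.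
  by have [] := HD _ Dw; rewrite w1 /moebius subrr invr0 mulr0 addr0 eqxx.
have w10 : w - 1 != 0 by rewrite subr_eq0.
have wa : moebius zeta kap w - a = cre kap / (w - 1) by rewrite /moebius addrC addKr.
have wz : moebius zeta kap w - zeta = w * (cre kap / (w - 1)) by rewrite moebiusE// addrC addKr.
have uw : u (moebius zeta kap w) = w by rewrite /u wa wz mulfK// mulf_neq0// invr_eq0.
have wr : cball rho w.
  have [_] := HD _ Dw; rewrite -/a wz wa cabsM ler_pM2r// cabs_gt0 mulf_neq0// invr_eq0//.
rewrite /G patchE ifT ?inE// -!EFinM lee_fin (cd_val (fd _ Dw)) uw wa.
rewrite !cabsM cabs_nat cabsX cabsV cabsX cabsM cabsV cabsN cabs_cre gtr0_norm//.
rewrite le_eqVlt; apply/orP; left; apply/eqP.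
rewrite -[(cabs w ^+ 2) ^+ n]exprM [(2 * n)%N]mulnC exprM.
by field; rewrite cabs_eq0 w10 gt_eqF.
Qed.

End Moebius.

(** * Sesquilinear algebra of integrals *)

Section LinearCombinations.
Context d (T : measurableType d) (R : realType) (m : {measure set T -> \bar R}) (A : set T).
Hypothesis mA : measurable A.
Implicit Types (u v : T -> R).

Lemma integrable_lin u v (a : R) : m.-integrable A (EFin \o u) -> m.-integrable A (EFin \o v) ->
  m.-integrable A (EFin \o (fun x => u x + a * v x)).
Proof.
move=> uI vI; have := integrableD mA uI (integrableZl mA a vI).
by congr (_.-integrable _ _); apply/funext => x; rewrite /= EFinD EFinM.
Qed.

Lemma Rintegral_lin u v (a : R) : m.-integrable A (EFin \o u) -> m.-integrable A (EFin \o v) ->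
  \int[m]_(x in A) (u x + a * v x) = \int[m]_(x in A) u x + a * \int[m]_(x in A) v x.
Proof.
move=> uI vI; rewrite RintegralD//; first by rewrite RintegralZl.
have := integrableZl mA a vI.
by congr (_.-integrable _ _); apply/funext => x; rewrite /= EFinM.
Qed.

End LinearCombinations.

Section ConjugateProduct.
Context {R : realType}.
Implicit Types (a b c e : Cplx R).

Lemma re_mul_conjc a b : complex.Re (a * conjc b) =
  complex.Re a * complex.Re b + complex.Im a * complex.Im b.
Proof. by case: a b => [p q] [s t] /=; rewrite mulrN opprK. Qed.

Lemma im_mul_conjc a b : complex.Im (a * conjc b) =
  complex.Im a * complex.Re b - complex.Re a * complex.Im b.
Proof. by case: a b => [p q] [s t] /=; rewrite mulrN addrC. Qed.

Lemma re_mul_conjcC a b : complex.Re (a * conjc b) = complex.Re (b * conjc a).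
Proof. by rewrite !re_mul_conjc; ring. Qed.

Lemma im_mul_conjcC a b : complex.Im (a * conjc b) = - complex.Im (b * conjc a).
Proof. by rewrite !im_mul_conjc; ring. Qed.

Lemma sqr_cabs_lin a c b : cabs (a + c * b) ^+ 2 = cabs a ^+ 2
  + (2 * complex.Re c) * complex.Re (a * conjc b)
  + (2 * complex.Im c) * complex.Im (a * conjc b) + cabs c ^+ 2 * cabs b ^+ 2.
Proof.
rewrite !cabs_sqr re_mul_conjc im_mul_conjc !reimE.
move: (complex.Re a) (complex.Im a) (complex.Re b) (complex.Im b) (complex.Re c) (complex.Im c).
by move=> *; ring.
Qed.

Lemma re_lin_conjc a c b e : complex.Re ((a + c * b) * conjc e) =
  complex.Re (a * conjc e) + complex.Re c * complex.Re (b * conjc e)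
    + (- complex.Im c) * complex.Im (b * conjc e).
Proof.
rewrite !re_mul_conjc im_mul_conjc !reimE.
move: (complex.Re a) (complex.Im a) (complex.Re b) (complex.Im b) (complex.Re c) (complex.Im c).
by move: (complex.Re e) (complex.Im e) => *; ring.
Qed.

Lemma im_lin_conjc a c b e : complex.Im ((a + c * b) * conjc e) =
  complex.Im (a * conjc e) + complex.Re c * complex.Im (b * conjc e)
    + complex.Im c * complex.Re (b * conjc e).
Proof.
rewrite !im_mul_conjc re_mul_conjc !reimE.
move: (complex.Re a) (complex.Im a) (complex.Re b) (complex.Im b) (complex.Re c) (complex.Im c).
by move: (complex.Re e) (complex.Im e) => *; ring.
Qed.

Lemma sqr_cabs_lin_le a c b : cabs (a + c * b) ^+ 2 <=
  cabs a ^+ 2 + cabs a ^+ 2 + 2 * cabs c ^+ 2 * cabs b ^+ 2.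
Proof.
rewrite -mulrA -exprMn -cabsM; have := cabsD a (c * b); have := cabs_ge0 (a + c * b).
move: (cabs (_ + _)) (cabs a) (cabs (c * _)) => x s t.
by have := sqr_ge0 (s - t); nra.
Qed.

Lemma mul_conjc_le a b : `|complex.Re (a * conjc b)| <= cabs a ^+ 2 + cabs b ^+ 2 /\
  `|complex.Im (a * conjc b)| <= cabs a ^+ 2 + cabs b ^+ 2.
Proof.
rewrite re_mul_conjc im_mul_conjc !cabs_sqr.
move: (complex.Re a) (complex.Im a) (complex.Re b) (complex.Im b) => p q s t.
have k (x y : R) : `|x * y| <= (x ^+ 2 + y ^+ 2) / 2.
  by rewrite ler_norml; have := sqr_ge0 (x - y); have := sqr_ge0 (x + y); rewrite !expr2 => *; apply/andP; split; nra.
have [a1 a2 a3 a4] := And4 (k p s) (k q t) (k q s) (k p t).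
have [n1 n2] := (ler_normD (p * s) (q * t), ler_normB (q * s) (p * t)).
by have [??] := (sqr_ge0 p, sqr_ge0 q); have [??] := (sqr_ge0 s, sqr_ge0 t); split; lra.
Qed.

Lemma cvg_mul_conjc (f g : Cplx R -> Cplx R) z : f x @[x --> z] --> f z -> g x @[x --> z] --> g z ->
  complex.Re (f x * conjc (g x)) @[x --> z] --> complex.Re (f z * conjc (g z)) /\
  complex.Im (f x * conjc (g x)) @[x --> z] --> complex.Im (f z * conjc (g z)).
Proof.
move=> fz gz; have [fr fi] := (cvg_re _ fz, cvg_im _ fz).
have [gr gi] := (cvg_re _ gz, cvg_im _ gz).
rewrite re_mul_conjc im_mul_conjc; split.
  rewrite (_ : (fun x => _) = fun x => complex.Re (f x) * complex.Re (g x) + complex.Im (f x) * complex.Im (g x)).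
    exact: cvgD (cvgM fr gr) (cvgM fi gi).
  by apply/funext => x; rewrite re_mul_conjc.
rewrite (_ : (fun x => _) = fun x => complex.Im (f x) * complex.Re (g x) - complex.Re (f x) * complex.Im (g x)).
  exact: cvgB (cvgM fi gr) (cvgM fr gi).
by apply/funext => x; rewrite im_mul_conjc.
Qed.

End ConjugateProduct.

Section LinearFunctional.
Context (R : realType) (X : Type) (Int : (X -> R) -> Prop) (I : (X -> R) -> R).
Hypothesis Int_lin : forall u v a, Int u -> Int v -> Int (fun x => u x + a * v x).
Hypothesis I_lin : forall u v a, Int u -> Int v -> I (fun x => u x + a * v x) = I u + a * I v.
Local Notation C := (Cplx R).
Implicit Types (a b e : X -> C) (c : C).

Local Notation sq a := (fun x => cabs (a x) ^+ 2).
Local Notation re a b := (fun x => complex.Re (a x * conjc (b x))).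
Local Notation im a b := (fun x => complex.Im (a x * conjc (b x))).
Local Notation ip a b := (cpt (I (re a b)) (I (im a b))).

(** Only linearity of [I] on the class [Int] is used here, which keeps the algebra of the inner
    product apart from measure theory. *)
Lemma functional_sqr_lin a b c : Int (sq a) -> Int (sq b) -> Int (re a b) -> Int (im a b) ->
  I (sq (fun x => a x + c * b x)) =
  I (sq a) + 2 * complex.Re (cconj c * ip a b) + cabs c ^+ 2 * I (sq b).
Proof.
move=> aI bI rI iI; have I1 := Int_lin (2 * complex.Re c) aI rI.
have I2 := Int_lin (2 * complex.Im c) I1 iI.
under eq_fun do rewrite sqr_cabs_lin.
rewrite (I_lin _ I2 bI) (I_lin _ I1 iI) (I_lin _ aI rI).
rewrite reM !re_cpt !im_cpt; ring.
Qed.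

Lemma functional_conj a b : Int (re a b) -> Int (im a b) -> ip b a = cconj (ip a b).
Proof.
move=> rI iI; rewrite /cconj re_cpt im_cpt; congr cpt.
  by under eq_fun do rewrite re_mul_conjcC.
(* Linearity is available for [u + a v] only, so [- u] is written as [u + (-2) u]. *)
have := I_lin (-2) iI iI; rewrite (_ : (fun x => _ + _) = im b a) => [->|]; first by ring.
by apply/funext => x; rewrite im_mul_conjcC; ring.
Qed.

Lemma functional_lin a b e c : Int (re a e) -> Int (im a e) -> Int (re b e) -> Int (im b e) ->
  ip (fun x => a x + c * b x) e = ip a e + c * ip b e.
Proof.
move=> ra ia rb ib; have I1 := Int_lin (complex.Re c) ra rb.
have I2 := Int_lin (complex.Re c) ia ib.
under [fun x => complex.Re _]eq_fun do rewrite re_lin_conjc.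
under [fun x => complex.Im _]eq_fun do rewrite im_lin_conjc.
rewrite (I_lin _ I1 ib) (I_lin _ ra rb) (I_lin _ I2 rb) (I_lin _ ia ib).
by apply: cplx_ext; rewrite !reimE; ring.
Qed.

Lemma functional_self a : Int (im a a) -> ip a a = cre (I (sq a)).
Proof.
move=> iI; congr cpt.
  by congr I; apply/funext => x; rewrite re_mul_conjc cabs_sqr !expr2.
have := I_lin (-1) iI iI; rewrite mulN1r subrr => <-; congr I.
by apply/funext => x; rewrite im_mul_conjc; ring.
Qed.

End LinearFunctional.

(** * The Dirichlet inner product *)

Section InnerProduct.
Context {R : realType}.
Local Notation C := (Cplx R).
Local Notation M := (measurableTypeR R).
Local Notation area := (@area R).
Variables (D : set C) (oD : open D).
Implicit Types (f g h : C -> C) (z zeta c : C) (w : R * R) (n : nat).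

Local Notation P := (of_pair @^-1` D).
Local Notation lin f c g := (fun x : C => f x + c * g x).

Lemma cd_lin f c g z : holomorphic_on D f -> holomorphic_on D g -> D z ->
  is_cd (lin f c g) z (derive1 f z + c * derive1 g z).
Proof. by move=> fD gD Dz; exact: cdD (cd_ex (fD _ Dz)) (cdZ c (cd_ex (gD _ Dz))). Qed.

Lemma holomorphic_lin f c g : holomorphic_on D f -> holomorphic_on D g ->
  holomorphic_on D (lin f c g).
Proof. by move=> fD gD z Dz; exact: cd_derivable (cd_lin c fD gD Dz). Qed.

Let mP : measurable (P : set (M * M)).
Proof. exact: open_plane_set. Qed.

Definition finite_energy f := holomorphic_on D f /\ (energy D f < +oo)%E.

Let Int (u : R * R -> R) := area.-integrable P (EFin \o u).

Let I (u : R * R -> R) : R := \int[area]_(w in P) u w.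

Let Int_lin u v a : Int u -> Int v -> Int (fun w => u w + a * v w).
Proof. by move=> uI vI; apply: integrable_lin. Qed.

Let I_lin u v a : Int u -> Int v -> I (fun w => u w + a * v w) = I u + a * I v.
Proof. by move=> uI vI; apply: Rintegral_lin. Qed.

Let eq_I u v : (forall w, P w -> u w = v w) -> I u = I v.
Proof. by move=> uv; apply: eq_Rintegral => w; rewrite inE => /uv. Qed.

Let Int_dom (u : C -> R) v : (forall z, D z -> u x @[x --> z] --> u z) ->
  Int v -> (forall w, `|u (of_pair w)| <= v w) -> Int (fun w => u (of_pair w)).
Proof.
move=> uc vI uv; apply: (le_integrable mP _ _ vI) => [|w _].
  by apply: measurableT_comp => //; exact: pmeas_cts.
by rewrite /= lee_fin (le_trans (uv w)) ?ler_norm.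
Qed.

Local Notation dv f := (fun w : R * R => derive1 f (of_pair w)).

Let sq_Int f : finite_energy f -> Int (fun w => cabs (dv f w) ^+ 2).
Proof.
move=> [fD foo]; apply/integrableP; split.
  apply: measurableT_comp => //; apply: (pmeas_cts (u := fun z => cabs (derive1 f z) ^+ 2) oD).
  by move=> z Dz; exact/cvg_cabs_sqr/(holomorphic_derive oD fD).
apply: le_lt_trans foo; rewrite le_eqVlt; apply/orP; left; apply/eqP.
by apply: eq_integral => w _; rewrite /= ger0_norm// sqr_ge0.
Qed.

Let ip_Int f g : finite_energy f -> finite_energy g ->
  Int (fun w => complex.Re (dv f w * conjc (dv g w))) /\
  Int (fun w => complex.Im (dv f w * conjc (dv g w))).
Proof.
move=> fF gF; have V := Int_lin 1 (sq_Int fF) (sq_Int gF).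
have fD := holomorphic_derive oD fF.1; have gD := holomorphic_derive oD gF.1.
have c z (Dz : D z) := cvg_mul_conjc (derivable_cvg (fD _ Dz)) (derivable_cvg (gD _ Dz)).
split.
  apply: (Int_dom (u := fun z => complex.Re (derive1 f z * conjc (derive1 g z))) _ V).
    by move=> z Dz; exact: (c z Dz).1.
  by move=> w; rewrite mul1r; exact: (mul_conjc_le _ _).1.
apply: (Int_dom (u := fun z => complex.Im (derive1 f z * conjc (derive1 g z))) _ V).
  by move=> z Dz; exact: (c z Dz).2.
by move=> w; rewrite mul1r; exact: (mul_conjc_le _ _).2.
Qed.

(** Significant only for finite energy: [fine] sends [+oo] to 0. *)
Definition nrg f : R := fine (energy D f).

Lemma nrg_ge0 f : 0 <= nrg f.
Proof. by rewrite fine_ge0// energy_ge0. Qed.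

Lemma energy_nrg f : finite_energy f -> energy D f = (nrg f)%:E.
Proof. by move=> [_ foo]; rewrite fineK// ge0_fin_numE// energy_ge0. Qed.

Lemma finite_energy_lin f c g : finite_energy f -> finite_energy g -> finite_energy (lin f c g).
Proof.
move=> fF gF; have hD := @holomorphic_lin f c g fF.1 gF.1; split => //.
have fI := sq_Int fF; have gI := sq_Int gF.
have := Int_lin (2 * cabs c ^+ 2) (Int_lin 1 fI fI) gI.
move=> /integrableP[m]; apply: le_lt_trans; apply: ge0_le_integral => //.
- by move=> w _; rewrite lee_fin sqr_ge0.
- apply: measurableT_comp => //; apply: (pmeas_cts (u := fun z => cabs (derive1 (lin f c g) z) ^+ 2) oD).
  by move=> z Dz; apply: cvg_cabs_sqr; exact: (holomorphic_derive oD hD).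
- exact: measurableT_comp.
move=> w Pw; rewrite /= lee_fin -/(cabs _).
rewrite (le_trans _ (ler_norm _))// (cd_val (cd_lin c fF.1 gF.1 Pw)).
rewrite mul1r; exact: sqr_cabs_lin_le.
Qed.

Lemma nrg_lin f c g : finite_energy f -> finite_energy g ->
  nrg (lin f c g) = nrg f + 2 * complex.Re (cconj c * AD_inner D f g) + cabs c ^+ 2 * nrg g.
Proof.
move=> fF gF; have [rI iI] := ip_Int fF gF.
have := functional_sqr_lin Int_lin I_lin c (sq_Int fF) (sq_Int gF) rI iI => <-.
by apply: eq_I => w Pw; rewrite -(cd_val (cd_lin c fF.1 gF.1 Pw)).
Qed.

Lemma AD_inner_conj f g : finite_energy f -> finite_energy g ->
  AD_inner D g f = cconj (AD_inner D f g).
Proof. by move=> fF gF; have [rI iI] := ip_Int fF gF; exact: (functional_conj I_lin rI iI). Qed.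

Lemma AD_inner_lin f c g h : finite_energy f -> finite_energy g -> finite_energy h ->
  AD_inner D (lin f c g) h = AD_inner D f h + c * AD_inner D g h.
Proof.
move=> fF gF hF.
have [rf jf] := ip_Int fF hF; have [rg jg] := ip_Int gF hF.
have := functional_lin Int_lin I_lin c rf jf rg jg => <-.
by congr cpt; apply: eq_I => w Pw; rewrite -(cd_val (cd_lin c fF.1 gF.1 Pw)).
Qed.

Lemma AD_inner_self f : finite_energy f -> AD_inner D f f = cre (nrg f).
Proof. by move=> fF; have [rI iI] := ip_Int fF fF; exact: (functional_self I_lin iI). Qed.

End InnerProduct.

(** * Sequences that are Cauchy in energy *)

Section EnergyLimits.
Context {R : realType}.
Local Notation C := (Cplx R).
Local Notation M := (measurableTypeR R).
Local Notation area := (@area R).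
Variables (D : set C) (oD : open D).
Implicit Types (f g h : C -> C) (z w zeta c : C) (n : nat) (F : nat -> C -> C).

Local Notation lin f c g := (fun x : C => f x + c * g x).

Lemma eq_energy f g : (forall z, D z -> derive1 f z = derive1 g z) -> energy D f = energy D g.
Proof. by move=> fg; apply: eq_integral => w; rewrite inE => Dw; rewrite fg. Qed.

(** With [kap = r], the map sends [|w| < 1/2] into the disc of radius [r] about [zeta], because
    [|w| < |w - 1|] there. The value [s = 1/4] is one choice below 1/2. *)
Lemma energy_derive1n f zeta (r : R) n : holomorphic_on D f -> cdisc zeta r `<=` D -> 0 < r ->
  (0 < n)%N -> (forall k : nat, (k < n)%N -> derive1n k f zeta = 0) ->
  ((cabs (derive1n n f zeta) ^+ 2 * (pi * (r * 4^-1) ^+ (2 * n) / (n`!%:R * n.-1`!%:R)))%:E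
    <= energy D f)%E.
Proof.
move=> fD rD r0 n0 fz; apply: (@moebius_energy_ge _ D f zeta r (2^-1)) => //.
- by apply: rD; exact: cdisc_center.
- by rewrite ltf_pV2 ?posrE// ltr_nat.
- by rewrite invf_le1// ler1n.
move=> w w2; have w1 : w != 1.
  by apply: cabs_lt1_neq1; apply: lt_trans w2 _; rewrite invf_lt1// ltr1n.
apply: rD; rewrite /cdisc/= moebiusE// addrC addKr cabsM cabsM cabsV cabs_cre gtr0_norm//.
have h : 2^-1 < cabs (w - 1).
  have := cabsBB w 1 0; rewrite !subr0 cabs1 cabsB; lra.
have h0 : 0 < cabs (w - 1) by apply: lt_trans h; rewrite invr_gt0.
rewrite mulrA ltr_pdivrMr// mulrC ltr_pM2l//; exact: lt_trans h.
Qed.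

(** Subtracting the constant [f z] supplies the vanishing required by the case [n = 1] and leaves
    the energy unchanged. *)
Lemma energy_derive1 f z (r : R) : holomorphic_on D f -> cdisc z r `<=` D -> 0 < r ->
  ((cabs (derive1 f z) ^+ 2 * (pi * (r * 4^-1) ^+ 2))%:E <= energy D f)%E.
Proof.
move=> fD rD r0; have Dz := rD _ (cdisc_center z r0).
pose g := lin f (-1) (fun=> f z).
have cD : holomorphic_on D (fun=> f z) by move=> w _; exact: cd_derivable (cd_cst _ _).
have gD : holomorphic_on D g by exact: holomorphic_lin.
have g' w : D w -> derive1 g w = derive1 f w.
  move=> Dw; rewrite (cd_val (cd_lin (-1) fD cD Dw)) (cd_val (cd_cst _ _)).
  by rewrite mulr0 addr0.
have := energy_derive1n gD rD r0 (ltn0Sn 0).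
change (1.-1)%N with 0%N; rewrite derive1n1 g'// muln1 factS fact0 muln1 mulr1 divr1 (eq_energy g').
by apply; case=> // _; rewrite derive1n0 /g mulN1r subrr.
Qed.

Lemma energy_small z (r e : R) : cdisc z r `<=` D -> 0 < r -> 0 < e ->
  exists2 d : R, 0 < d & forall f, holomorphic_on D f -> (energy D f <= d%:E)%E ->
    forall w, cdisc z (r / 2) w -> cabs (derive1 f w) <= e.
Proof.
move=> rD r0 e0; have k0 : 0 < pi * (r / 2 * 4^-1) ^+ 2 :> R.
  by rewrite mulr_gt0 ?pi_gt0// exprn_gt0// !mulr_gt0.
exists (e ^+ 2 * (pi * (r / 2 * 4^-1) ^+ 2)); first by rewrite mulr_gt0// exprn_gt0.
move=> f fD fd w wr; have r20 : 0 < r / 2 by rewrite divr_gt0.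
have wD : cdisc w (r / 2) `<=` D.
  by apply: subset_trans rD; apply: cdiscS; move: wr; rewrite /cdisc/=; lra.
have := le_trans (energy_derive1 fD wD r20) fd.
by rewrite lee_fin ler_pM2r// ler_pXn2r// nnegrE ?cabs_ge0 ?ltW.
Qed.

Definition energy_cauchy F := forall d : R, 0 < d -> exists N : nat, forall j k,
  (N <= j)%N -> (N <= k)%N -> (energy D (lin (F j) (-1) (F k)) <= d%:E)%E.

Section Limit.
Variable F : nat -> C -> C.
Hypothesis FD : forall k, holomorphic_on D (F k).
Hypothesis FC : energy_cauchy F.

Let dF j k z : D z -> derive1 (lin (F j) (-1) (F k)) z = derive1 (F j) z - derive1 (F k) z.
Proof. by move=> Dz; rewrite (cd_val (cd_lin (-1) (@FD j) (@FD k) Dz)) mulN1r. Qed.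

Let unif z (r e : R) : cdisc z r `<=` D -> 0 < r -> 0 < e -> exists N : nat, forall j k,
  (N <= j)%N -> (N <= k)%N -> forall w, cdisc z (r / 2) w ->
    cabs (derive1 (lin (F j) (-1) (F k)) w) <= e.
Proof.
move=> rD r0 e0; have [d d0 H] := energy_small rD r0 e0.
have [N HN] := FC d0; exists N => j k Nj Nk; apply: H (HN _ _ Nj Nk).
by apply: holomorphic_lin.
Qed.

(** Energy controls derivatives only; the mean value inequality turns this into control of
    increments, so convergence at one point spreads to nearby points. *)
Let incr z (r e : R) : cdisc z r `<=` D -> 0 < r -> 0 < e -> exists N : nat, forall j k,
  (N <= j)%N -> (N <= k)%N -> forall w v, cdisc z (r / 2) w -> cdisc z (r / 2) v ->
    cabs ((F j w - F k w) - (F j v - F k v)) <= e * cabs (w - v).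
Proof.
move=> rD r0 e0; have [N HN] := unif rD r0 (divr_gt0 e0 (ltr0Sn _ 1)).
exists N => j k Nj Nk w v wr vr.
have := @mean_value_ineq R (lin (F j) (-1) (F k)) z (r / 2) (e / 2) _ v w vr wr.
rewrite !mulN1r [2 * _]mulrA [2 * _]mulrC divfK ?pnatr_eq0//; apply=> u ur; split; last exact: HN.
apply: (@holomorphic_lin _ D) => //; apply: rD; move: ur; rewrite /cdisc/=; lra.
Qed.

(** The points where the values form a Cauchy sequence make up a subset of [D] that is open and
    closed in [D] and contains [zeta], hence all of [D] by connectedness. *)
Lemma energy_cauchy_cvg zeta : connected D -> D zeta -> (forall k, F k zeta = 0) ->
  exists f, [/\ holomorphic_on D f, forall z, D z -> F k z @[k --> \oo] --> f z
    & forall z, D z -> derive1 (F k) z @[k --> \oo] --> derive1 f z].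
Proof.
move=> cD Dz Fz; pose S := [set z | D z /\ cauchy_sq (fun k => F k z)].
have step z w v (r : R) : 0 < r -> cdisc z r `<=` D -> cdisc z (r / 2) w -> cdisc z (r / 2) v ->
    cauchy_sq (fun k => F k v) -> cauchy_sq (fun k => F k w).
  move=> r0 rD wr vr vC e e0.
  have e2 : 0 < e / 2 by rewrite divr_gt0.
  have [N1 H1] := incr rD r0 (divr_gt0 e2 r0); have [N2 H2] := vC _ e2.
  exists (maxn N1 N2) => j k; rewrite !geq_max => /andP[j1 j2] /andP[k1 k2].
  have a1 := H1 j k j1 k1 w v wr vr; have a2 := H2 j k j2 k2.
  have wv : cabs (w - v) <= r.
    by have := cabsBB z w v; move: wr vr; rewrite /cdisc/= (cabsB z v); lra.
  have a3 : e / 2 / r * cabs (w - v) <= e / 2.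
    by rewrite -[leRHS](divfK (lt0r_neq0 r0)) ler_wpM2l// divr_ge0// ltW.
  have -> : F j w - F k w = (F j w - F k w - (F j v - F k v)) + (F j v - F k v) by rewrite subrK.
  by apply: (le_trans (cabsD _ _)); lra.
have SD : S = D.
  apply: cD.
  - by exists zeta; split => // e e0; exists 0%N => m k _ _; rewrite !Fz subrr cabs0 ltW.
  - exists (interior S); first exact: open_interior.
    apply/seteqP; split => [z [Dz' zC]|z [_ /interior_subset//]]; split => //.
    have [r r0 rD] := open_cdiscP oD Dz'; have r20 : 0 < r / 2 by rewrite divr_gt0.
    apply/nbhs_cplxP; exists (r / 2) => // w wr; split.
      by apply: rD; rewrite /cdisc/=; lra.
    exact: step (cdisc_center z r20) zC.
  - exists (closure S); first exact: closed_closure.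
    apply/seteqP; split => [z zS|z [Dz' zS]].
      by split; [exact: zS.1|exact: subset_closure].
    have [r r0 rD] := open_cdiscP oD Dz'; have r20 : 0 < r / 2 by rewrite divr_gt0.
    have zn : nbhs z (cdisc z (r / 2)) by apply/nbhs_cplxP; exists (r / 2).
    have [w [[_ wC] wr]] := zS _ zn.
    split => //; exact: step (cdisc_center z r20) wr wC.
have DC z : D z -> cauchy_sq (fun k => F k z) by rewrite -{1}SD => -[].
have DC' z : D z -> cauchy_sq (fun k => derive1 (F k) z).
  move=> Dz' e e0; have [r r0 rD] := open_cdiscP oD Dz'.
  have [N HN] := unif rD r0 e0; exists N => j k Nj Nk; rewrite -dF//.
  by apply: HN => //; apply: cdisc_center; rewrite divr_gt0.
have [f fl] : exists f : C -> C, forall z, D z -> F k z @[k --> \oo] --> f z.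
  have H z : exists l : C, D z -> F k z @[k --> \oo] --> l.
    have [Dz'|] := pselect (D z); last by move=> nD; exists 0 => /nD.
    by have [l Hl] := cauchy_sq_cvg (DC _ Dz'); exists l.
  by have [f Hf] := choice H; exists f.
have [g gl] : exists g : C -> C, forall z, D z -> derive1 (F k) z @[k --> \oo] --> g z.
  have H z : exists l : C, D z -> derive1 (F k) z @[k --> \oo] --> l.
    have [Dz'|] := pselect (D z); last by move=> nD; exists 0 => /nD.
    by have [l Hl] := cauchy_sq_cvg (DC' _ Dz'); exists l.
  by have [g Hg] := choice H; exists g.
(* The increments and derivatives of a single [F k] approximate those of all later terms, hence of
   the limit; its own differentiability at [z] does the rest. *)
have fg z : D z -> is_cd f z (g z).
  move=> Dz'; have [r r0 rD] := open_cdiscP oD Dz'; apply/cdP => e e0.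
  have e4 : 0 < e / 4 by rewrite divr_gt0.
  have [N1 H1] := incr rD r0 e4; have [N2 H2] := unif rD r0 e4.
  pose k := maxn N1 N2; have k1 : (N1 <= k)%N by rewrite leq_maxl.
  have k2 : (N2 <= k)%N by rewrite leq_maxr.
  have [d d0 Hd] := (cdP _ _ _).1 (cd_ex (@FD k z Dz')) _ e4.
  have r20 : 0 < r / 2 by rewrite divr_gt0.
  have zr := cdisc_center z r20.
  exists (Num.min d (r / 2)); first by rewrite lt_min d0.
  move=> w; rewrite lt_min => /andP[wd wr].
  have a1 := Hd w wd.
  have Dw : D w by apply: rD; rewrite /cdisc/=; lra.
  have a2 : cabs ((f w - f z) - (F k w - F k z)) <= e / 4 * cabs (w - z).
    apply: (@seq_lim_le R (fun j => F j w - F j z) _ _ _ N1).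
      exact: (cvgB (fl _ Dw) (fl _ Dz')).
    move=> j Nj; have := H1 j k Nj k1 w z wr zr; congr (cabs _ <= _); ring.
  have a3 : cabs (g z - derive1 (F k) z) <= e / 4.
    apply: (@seq_lim_le R (fun j => derive1 (F j) z) _ _ _ N2); first exact: gl.
    by move=> j Nj; rewrite -dF//; exact: H2.
  have -> : f w - f z - g z * (w - z) = ((f w - f z) - (F k w - F k z)) +
    ((F k w - F k z - derive1 (F k) z * (w - z)) - (g z - derive1 (F k) z) * (w - z)) by ring.
  apply: (le_trans (cabsD _ _)).
  have a4 := cabsBD (F k w - F k z - derive1 (F k) z * (w - z)) ((g z - derive1 (F k) z) * (w - z)).
  have a5 : cabs ((g z - derive1 (F k) z) * (w - z)) <= e / 4 * cabs (w - z).
    by rewrite cabsM ler_wpM2r ?cabs_ge0.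
  move: a1 a2 a4 a5; have := cabs_ge0 (w - z).
  move: (cabs (w - z)) (cabs (_ * _)) (cabs (_ - _)) (cabs (_ - _ * _)) => t x y s; nra.
exists f; split => [z /fg/cd_derivable//|//|z Dz'].
by rewrite (cd_val (fg _ Dz')); exact: gl.
Qed.

End Limit.

(** The bound may fail for the first [N] terms, so Fatou's lemma is applied to the shifted
    sequence. *)
Lemma energy_fatou F f (B : R) N : (forall k, holomorphic_on D (F k)) ->
  (forall z, D z -> derive1 (F k) z @[k --> \oo] --> derive1 f z) ->
  (forall k, (N <= k)%N -> (energy D (F k) <= B%:E)%E) -> (energy D f <= B%:E)%E.
Proof.
move=> FD Ff FB; pose P : set (M * M) := of_pair @^-1` D.
have mP : measurable P by exact: open_plane_set.
pose u k (w : M * M) := ((cabs (derive1 (F (k + N)%N) (of_pair w)) ^+ 2)%:E).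
have mu' k : measurable_fun P (u k).
  apply: measurableT_comp => //; apply: (pmeas_cts (u := fun z => cabs (derive1 (F (k + N)%N) z) ^+ 2) oD).
  by move=> z Dz; apply: cvg_cabs_sqr; exact: (holomorphic_derive oD (@FD _)).
have u0 k (w : M * M) : P w -> (0 <= u k w)%E by move=> _; rewrite lee_fin sqr_ge0.
have L (w : M * M) : P w -> limn_einf (u^~ w) = ((cabs (derive1 f (of_pair w)) ^+ 2)%:E).
  move=> Pw; apply: (cvg_limn_einf_sup _).1; apply/cvg_EFin.
    by apply: nearW => k.
  apply: (@cvg_comp _ _ _ _ (fun x : R => x ^+ 2)); last exact: exprn_continuous.
  have c := cvg_cabs eventually_filter (Ff _ Pw).
  exact: (cvg_comp _ _ (cvg_addnr N) c).
have := fatou area mP mu' u0.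
have -> : (\int[area]_(x in P) limn_einf (u^~ x) = energy D f)%E.
  by apply: eq_integral => w; rewrite inE => /L.
move=> H; apply: (le_trans H); rewrite limn_einf_lim; apply: lime_le; first exact: is_cvg_einfs.
apply: nearW => k; apply: (@le_trans _ _ (energy D (F (k + N)%N))); last first.
  by apply: FB; rewrite leq_addl.
by apply: ereal_inf_lbound; exists k => //=.
Qed.

End EnergyLimits.

(** * Existence of the representer and its extremal property *)

Section Kernel.
Context {R : realType}.
Local Notation C := (Cplx R).
Variables (D : set C) (zeta : C) (n : nat).
Hypotheses (domD : domain D) (Dz : D zeta) (n0 : (0 < n)%N).
Implicit Types (f g h : C -> C) (z w c : C).

Local Notation lin f c g := (fun x : C => f x + c * g x).
Local Notation ADz := (AD D zeta n).
Local Notation N f := (nrg D f).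
Local Notation dn f := (derive1n n f zeta).

Let oD : open D. Proof. by case: domD. Qed.

Lemma AD_finite_energy f : ADz f -> finite_energy D f.
Proof. by case. Qed.

Lemma AD_lin f c g : ADz f -> ADz g -> ADz (lin f c g).
Proof.
move=> fA gA; have [hD hoo] := finite_energy_lin oD c (AD_finite_energy fA) (AD_finite_energy gA).
split => //; case: fA => fD f0 _; case: gA => gD g0 _ k kn.
by rewrite (derive1n_lin c k oD fD gD Dz) f0// g0// mulr0 addr0.
Qed.

Lemma AD_derive1n_lin f c g : ADz f -> ADz g -> dn (lin f c g) = dn f + c * dn g.
Proof. by move=> [fD _ _] [gD _ _]; exact: (derive1n_lin c n oD fD gD Dz). Qed.

Lemma AD_derive1n_bound : exists2 k : R, 0 < k & forall f, ADz f -> cabs (dn f) ^+ 2 * k <= N f.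
Proof.
have [r r0 rD] := open_cdiscP oD Dz.
exists (pi * (r * 4^-1) ^+ (2 * n) / (n`!%:R * n.-1`!%:R)).
  rewrite divr_gt0 ?mulr_gt0 ?pi_gt0 ?exprn_gt0 ?ltr0n ?fact_gt0//.
  by rewrite mulr_gt0// invr_gt0.
move=> f fA; have [fD f0 _] := fA; rewrite -lee_fin -(energy_nrg (AD_finite_energy fA)).
exact: energy_derive1n.
Qed.

Lemma re_cre_mul (t : R) z : complex.Re (cconj (cre t) * z) = t * complex.Re z.
Proof. by rewrite /cconj !reimE; ring. Qed.

Let midpoint_identity (a b d x : R) : b = a + 2 * (1 * x) + 1 ^+ 2 * d ->
  d = 2 * a + 2 * b - 4 * (a + 2 * (2^-1 * x) + `|2^-1| ^+ 2 * d).
Proof. by rewrite ger0_norm ?invr_ge0// => ->; field. Qed.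

(** The parallelogram law: the inner product is eliminated between the expansions of the energy of
    [f + t (g - f)] at [t = 1] and [t = 1/2]. *)
Lemma nrg_midpoint f g : ADz f -> ADz g ->
  N (lin g (-1) f) = 2 * N f + 2 * N g - 4 * N (lin f (cre 2^-1) (lin g (-1) f)).
Proof.
move=> fA gA; have fF := AD_finite_energy fA; have gF := AD_finite_energy gA.
have dF := finite_energy_lin oD (-1) gF fF.
have := nrg_lin oD (cre 1) fF dF; rewrite (nrg_lin oD (cre 2^-1) fF dF) !re_cre_mul !cabs_cre normr1.
have -> : N (lin f (cre 1) (lin g (-1) f)) = N g.
  by congr (N _); apply/funext => x; rewrite cre1; ring.
exact: midpoint_identity.
Qed.

Let minimizing_gap (a b d t m x y e : R) : d = 2 * a + 2 * b - 4 * t -> m <= t ->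
  a < m + x -> b < m + y -> x < e / 4 -> y < e / 4 -> d <= e.
Proof. by move=> ->; lra. Qed.

(* By the parallelogram law a minimizing sequence is Cauchy in energy; Fatou's lemma shows that
   its limit is a minimizer. *)
Lemma exists_minimizer : (exists2 f, ADz f & dn f = 1) ->
  exists f0, [/\ ADz f0, dn f0 = 1 & forall f, ADz f -> dn f = 1 -> N f0 <= N f].
Proof.
case=> ft ftA ft1; pose A := [set x : R | exists f, [/\ ADz f, dn f = 1 & x = N f]].
have lA : has_lbound A by exists 0 => _ [f [_ _ ->]]; exact: nrg_ge0.
have iA : has_inf A by split => //; exists (N ft), ft.
pose m := inf A; have mA f : ADz f -> dn f = 1 -> m <= N f.
  by move=> fA f1; apply: ge_inf => //; exists f.
have [F HF] : exists F : nat -> C -> C, forall k, [/\ ADz (F k), dn (F k) = 1 & N (F k) < m + k.+1%:R^-1].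
  have H (k : nat) : exists f, [/\ ADz f, dn f = 1 & N f < m + k.+1%:R^-1].
    have [|_ [f [fA f1 ->]] fm] := @inf_adherent _ A (k.+1%:R^-1) _ iA; first by rewrite invr_gt0.
    by exists f.
  by have [F HF] := choice H; exists F.
have FA k : ADz (F k) by case: (HF k).
have FD k : holomorphic_on D (F k) by case: (FA k).
have F1 k : dn (F k) = 1 by case: (HF k).
have FC : energy_cauchy D F.
  move=> d d0; have [K HK] := invn_lt (divr_gt0 d0 (ltr0Sn _ 3)).
  exists K => j k Kj Kk; rewrite (energy_nrg (AD_finite_energy (AD_lin (-1) (FA j) (FA k)))).
  have [_ _ mk] := HF k; have [_ _ mj] := HF j.
  have dA := AD_lin (-1) (FA j) (FA k); have hA := AD_lin (cre 2^-1) (FA k) dA.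
  have h1 : dn (lin (F k) (cre 2^-1) (lin (F j) (-1) (F k))) = 1.
    rewrite (AD_derive1n_lin (cre 2^-1) (FA k) dA) (AD_derive1n_lin (-1) (FA j) (FA k)) !F1.
    by rewrite mulr1 subrr mulr0 addr0.
  rewrite lee_fin.
  exact: (minimizing_gap (nrg_midpoint (FA k) (FA j)) (mA _ hA h1) mk mj (HK _ Kk) (HK _ Kj)).
have Fz k : F k zeta = 0 by case: (FA k) => _ /(_ 0%N n0).
have [_ _ cD] := domD.
have [f [fD Ff Ff']] := energy_cauchy_cvg oD FD FC cD Dz Fz.
have fm (e : R) : 0 < e -> (energy D f <= (m + e)%:E)%E.
  move=> e0; have [K HK] := invn_lt e0.
  apply: (@energy_fatou _ _ oD F f _ K FD Ff') => k Kk.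
  rewrite (energy_nrg (AD_finite_energy (FA k))).
  rewrite lee_fin; have [_ _ /ltW/le_trans] := HF k; apply.
  by rewrite lerD2l ltW// HK.
have fF : finite_energy D f by split => //; apply: le_lt_trans (fm _ ltr01) _; rewrite ltry.
have FF k := AD_finite_energy (FA k).
(* Convergence in energy: Fatou's lemma applied to [F j - F K] as [j] grows. *)
have dk (d : R) : 0 < d -> exists k, (energy D (lin f (-1) (F k)) <= d%:E)%E.
  move=> d0; have [K HK] := FC _ d0; exists K.
  apply: (@energy_fatou _ _ oD (fun j => lin (F j) (-1) (F K)) _ _ K).
  - by move=> j; exact: (@holomorphic_lin _ D (F j) (-1) (F K) (@FD j) (@FD K)).
  - move=> z Dz'; rewrite (cd_val (cd_lin (-1) fD (@FD K) Dz')).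
    under eq_fun => j do rewrite (cd_val (cd_lin (-1) (@FD j) (@FD K) Dz')).
    exact: (cvgD (Ff' _ Dz') (cvg_cst _)).
  - by move=> j Kj; exact: HK.
(* By induction on the order: the lower derivatives of [f - F k] at [zeta] vanish, so
   [energy_derive1n] bounds the [i]-th one by an energy that can be made arbitrarily small. *)
have fn i : (i <= n)%N -> derive1n i f zeta = derive1n i (F 0%N) zeta.
  elim/ltn_ind: i => i IH; case: (posnP i) => [-> _|i0 iN].
    rewrite !derive1n0 Fz; have := Ff _ Dz; under eq_fun do rewrite Fz.
    move=> /(@cvg_unique _ _ (0 @[_ --> \oo]) _); apply => //; exact: cvg_cst.
  have Fi k l : (l <= n)%N -> derive1n l (F k) zeta = derive1n l (F 0%N) zeta.
    rewrite leq_eqVlt => /orP[/eqP->|ln]; first by rewrite !F1.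
    by case: (FA k) => _ -> //; case: (FA 0%N) => _ ->.
  have [r r0 rD] := open_cdiscP oD Dz.
  pose c := pi * (r * 4^-1) ^+ (2 * i) / (i`!%:R * i.-1`!%:R).
  have c0 : 0 < c.
    rewrite divr_gt0 ?mulr_gt0 ?pi_gt0 ?exprn_gt0 ?ltr0n ?fact_gt0//.
    by rewrite mulr_gt0// invr_gt0.
  have H (d : R) : 0 < d -> cabs (derive1n i f zeta - derive1n i (F 0%N) zeta) ^+ 2 * c <= d.
    move=> d0; have [k Hk] := dk _ d0; rewrite -lee_fin; apply: le_trans Hk.
    have hd := derive1n_lin (-1) i oD fD (@FD k) Dz; rewrite mulN1r (Fi k i iN) in hd.
    rewrite -hd.
    apply: (energy_derive1n oD (@holomorphic_lin _ D f (-1) (F k) fD (@FD k)) rD r0 i0).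
    move=> l li; have ln := leq_trans (ltnW li) iN.
    by rewrite (derive1n_lin (-1) l oD fD (@FD k) Dz) (IH l li ln) (Fi k l ln) mulN1r subrr.
  apply/eqP; rewrite -subr_eq0 -cabs_eq0 -sqrf_eq0 eq_le sqr_ge0 andbT.
  rewrite -(pmulr_lle0 _ c0); apply/ler_addgt0Pl => e e0; rewrite addr0; exact: H.
have f1 : dn f = 1 by rewrite fn.
have fA : ADz f.
  split => //; last exact: fF.2.
  by move=> k kn; rewrite (fn k (ltnW kn)); case: (FA 0%N) => _ FA0 _; exact: FA0.
exists f; split; [exact: fA|exact: f1|move=> g gA g1]; apply: le_trans (mA _ gA g1).
apply/ler_addgt0Pr => e e0; rewrite -lee_fin -(energy_nrg fF); exact: fm.
Qed.

Lemma energy_fin f (B : R) : (energy D f <= B%:E)%E -> (energy D f < +oo)%E.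
Proof. by move=> /le_lt_trans; apply; rewrite ltry. Qed.

(** Without such a function the minimization would be over an empty set. It comes from
    [moebius_test] with a pole far from [D]. *)
Lemma exists_normalized : bounded_set D -> exists2 f, ADz f & dn f = 1.
Proof.
move=> bD; have [B B0 DB] : exists2 B : R, 0 < B & forall z, D z -> cabs z <= B.
  (* The bound provided by [bounded_set] is a complex number known to be real. *)
  have [K [Kreal HK]] := bD; exists (`|complex.Re K| + 1); first by rewrite ltr_wpDl.
  move=> z Dz'; have Kr : complex.Im K = 0 by case: K Kreal {HK} => a b; rewrite complex_real => /eqP.
  have lK : K < cre (`|complex.Re K| + 1).
    by rewrite ltcE /= Kr eqxx (le_lt_trans (ler_norm _))// ltrDl.
  by have := HK _ lK z Dz'; rewrite /= normE lecE /= => /andP[].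
(* Points of [D] are within [2 * B] of [zeta], so this pole stays at distance at least 1 from
   [D]. *)
pose kap := 2 * B + 1; pose rho := 2 * B.
have k0 : 0 < kap by rewrite /kap; lra.
have rho0 : 0 < rho by rewrite /rho; lra.
have [|f [fD f0 fn fE]] := @moebius_test R D zeta kap rho n oD Dz n0 k0 rho0.
  move=> z Dz'; have h1 : cabs (z - zeta) <= 2 * B.
    by have := cabsBD z zeta; have := DB _ Dz'; have := DB _ Dz; lra.
  have h2 : 1 <= cabs (z - (zeta + cre kap)).
    have := cabsBB z (zeta + cre kap) zeta; rewrite addrAC subrr add0r cabs_cre gtr0_norm//.
    by rewrite cabsB /kap; lra.
  split; last by apply: (le_trans h1); rewrite ler_peMr// ltW.
  by rewrite -subr_eq0 -cabs_gt0; exact: lt_le_trans h2.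
have fA : ADz f by split => //; exact: energy_fin fE.
have fn0 : dn f != 0.
  by rewrite -cabs_gt0 fn divr_gt0 ?exprn_gt0// ltr0n fact_gt0.
exists (lin f ((dn f)^-1 - 1) f); first exact: AD_lin.
by rewrite (AD_derive1n_lin _ fA fA) mulrBl mul1r mulVf// addrC subrK.
Qed.

Let quadratic_bound (a b k : R) : 0 <= a -> 0 <= b -> 0 <= k ->
  (forall t : R, 0 <= a - 2 * t * b + t ^+ 2 * b * k) -> b <= a * k.
Proof.
move=> a0 b0 k0 H; have [kp|] := ltrP 0 k.
  have := H k^-1; rewrite -(ler_pM2r kp).
  have -> : (a - 2 * k^-1 * b + k ^- 1 ^+ 2 * b * k) * k = a * k - b by field; rewrite gt_eqF.
  by rewrite mul0r subr_ge0.
move=> k0'; have kz : k = 0 by apply/eqP; rewrite eq_le k0' k0.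
(* If [k = 0] and [b > 0], the expression is affine in [t] and takes the value -1 at this [t]. *)
rewrite kz in H *; rewrite mulr0 leNgt; apply/negP => bp; have := H ((a + 1) / (2 * b)).
have -> : a - 2 * ((a + 1) / (2 * b)) * b + ((a + 1) / (2 * b)) ^+ 2 * b * 0 = - 1 by field; rewrite gt_eqF.
by lra.
Qed.

(* Expand [0 <= N (f - t lambda g)] with [lambda = <f, g>]. *)
Lemma sqr_AD_inner_le f g (a : R) : ADz f -> ADz g -> 0 <= a ->
  (forall c, N f - a <= N (lin f c g)) -> cabs (AD_inner D f g) ^+ 2 <= a * N g.
Proof.
move=> fA gA a0 H; have fF := AD_finite_energy fA; have gF := AD_finite_energy gA.
apply: quadratic_bound => //; [exact: sqr_ge0|exact: nrg_ge0|move=> t].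
pose x := AD_inner D f g.
have := H (cre (- t) * x); rewrite (nrg_lin oD _ fF gF) -/x cabsM cabs_cre exprMn real_normK ?num_real//.
have -> : complex.Re (cconj (cre (- t) * x) * x) = - t * cabs x ^+ 2.
  by rewrite /cconj cabs_sqr !reimE; ring.
by rewrite sqrrN; move: (N f) (N g) (cabs x ^+ 2) => p q s; lra.
Qed.

(* A minimizer is orthogonal to the functions with vanishing [n]-th derivative at [zeta], so a
   multiple of it represents. *)
Lemma exists_representer : bounded_set D -> exists m, is_representer D n zeta m.
Proof.
move=> /exists_normalized/exists_minimizer[f0 [f0A f01 f0m]].
have f0F := AD_finite_energy f0A.
have [k k0 kb] := AD_derive1n_bound.
have N0 : 0 < N f0 by apply: lt_le_trans (kb _ f0A); rewrite f01 cabs1 expr1n mul1r.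
have orth g : ADz g -> dn g = 0 -> AD_inner D f0 g = 0.
  move=> gA g0; apply/eqP; rewrite -cabs_eq0 -sqrf_eq0 eq_le sqr_ge0 andbT.
  (* Slack 0 is allowed because adding a multiple of [g] keeps the [n]-th derivative equal to 1, so
     the energy cannot drop below its minimum. *)
  rewrite -(mul0r (N g)); apply: (sqr_AD_inner_le f0A gA (lexx 0)) => c; rewrite subr0.
  by apply: f0m; [exact: AD_lin|rewrite (AD_derive1n_lin _ f0A gA) f01 g0 mulr0 addr0].
(* Chosen so that [f0 + c f0] is [f0] divided by its energy. *)
pose c : R := (N f0)^-1 - 1.
exists (lin f0 (cre c) f0); split; first exact: AD_lin.
move=> f fA; have fF := AD_finite_energy fA.
have gA := AD_lin (- dn f) fA f0A.
have H1 : AD_inner D f0 (lin f (- dn f) f0) = 0.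
  by apply: orth => //; rewrite (AD_derive1n_lin _ fA f0A) f01 mulr1 subrr.
have := AD_inner_lin oD (- dn f) fF f0F f0F.
rewrite (AD_inner_conj oD f0F (AD_finite_energy gA)) H1 (AD_inner_self oD f0F).
have -> : cconj 0 = 0 :> C by apply: cplx_ext; rewrite !reimE ?oppr0.
move=> /esym/eqP; rewrite mulNr subr_eq0 => /eqP H2.
rewrite (AD_inner_conj oD (AD_finite_energy (AD_lin (cre c) f0A f0A)) fF) (AD_inner_lin oD _ f0F f0F fF).
have -> : AD_inner D f0 f + cre c * AD_inner D f0 f = cre (N f0)^-1 * AD_inner D f0 f.
  by rewrite /c creB cre1 mulrBl mul1r addrC subrK.
have cM (x : R) z : cconj (cre x * z) = cre x * cconj z.
  by apply: cplx_ext; rewrite /cconj !reimE; ring.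
rewrite cM -(AD_inner_conj oD f0F fF) H2 mulrCA -creM mulVf ?gt_eqF// cre1 mulr1//.
Qed.

(** The extremal function is kept along with [K]: inserting it into the energy lower bound is what
    bounds [K] from above. *)
Lemma kernel_diagonal : bounded_set D -> exists K : R, [/\
  reduced_bergman_deriv D n n.-1 zeta zeta = cre K, 0 <= K,
  forall f, ADz f -> cabs (dn f) ^+ 2 <= N f * K &
  exists f, [/\ ADz f, cabs (dn f) = K & N f = K]].
Proof.
move=> bD; have [m0 m0R] := exists_representer bD.
pose m := representer D n zeta; have [mA mR] : is_representer D n zeta m.
  exact: (@getPex _ (is_representer D n zeta) (ex_intro _ m0 m0R)).
have mF := AD_finite_energy mA.
have mm : dn m = cre (N m) by rewrite mR// AD_inner_self.
have m0' : 0 <= N m by exact: nrg_ge0.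
exists (N m); split => //.
- by rewrite -mm -(prednK n0) derive1Sn prednK.
(* With slack equal to the energy of [f] the condition is trivial and the bound is the
   Cauchy-Schwarz inequality. *)
- move=> f fA; rewrite (mR _ fA); apply: (sqr_AD_inner_le fA mA (nrg_ge0 D f)) => c.
  by rewrite subrr; exact: nrg_ge0.
- by exists m; rewrite mm cabs_cre ger0_norm.
Qed.

End Kernel.

(** * Local geometry of the boundary *)

Section DefiningFunction.
Context {R : realType}.
Local Notation C := (Cplx R).
Implicit Types (h psi : C -> R) (U : set C) (z w p zeta : C).

Lemma is_derive_partial_x h (x y : R) : derivable (h \o of_pair) (x, y) (1, 0) ->
  is_derive x 1 (fun s => h (cpt s y)) (partial_x h (cpt x y)).
Proof.
move=> hd; have E : (fun t : R => t^-1 *: ((h \o of_pair) (t *: (1, 0) + (x, y)) - (h \o of_pair) (x, y))) =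
    (fun t : R => t^-1 *: ((fun s => h (cpt s y)) (t *: 1 + x) - (fun s => h (cpt s y)) x)).
  apply/funext => t; congr (_ *: (h _ - _)); rewrite /of_pair /cpt /=.
  by rewrite [t *: 0]mulr0 add0r.
split; first by rewrite /derivable -E.
by rewrite /partial_x /derive E.
Qed.

Lemma is_derive_partial_y h (x y : R) : derivable (h \o of_pair) (x, y) (0, 1) ->
  is_derive y 1 (fun s => h (cpt x s)) (partial_y h (cpt x y)).
Proof.
move=> hd; have E : (fun t : R => t^-1 *: ((h \o of_pair) (t *: (0, 1) + (x, y)) - (h \o of_pair) (x, y))) =
    (fun t : R => t^-1 *: ((fun s => h (cpt x s)) (t *: 1 + y) - (fun s => h (cpt x s)) y)).
  apply/funext => t; congr (_ *: (h _ - _)); rewrite /of_pair /cpt /=.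
  by rewrite [t *: 0]mulr0 add0r.
split; first by rewrite /derivable -E.
by rewrite /partial_y /derive E.
Qed.

Lemma mvt_affine (u du : R -> R) (l e a b : R) :
  (forall s, Num.min a b <= s <= Num.max a b -> is_derive s 1 u (du s) /\ `|du s - l| <= e) ->
  `|u b - u a - l * (b - a)| <= e * `|b - a|.
Proof.
wlog ab : a b / a <= b.
  move=> H; have /orP[ab|ba] := le_total a b; first exact: H.
  rewrite minC maxC => /(H _ _ ba); rewrite [`|a - b|]distrC.
  by rewrite (_ : u b - u a - _ = - (u a - u b - l * (a - b))) ?normrN//; ring.
rewrite min_l// max_r// => H.
have ud s : s \in `[a, b]%R -> is_derive s 1 u (du s).
  by rewrite in_itv/= => /H[].
have ud' s : s \in `]a, b[%R -> is_derive s 1 u (du s).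
  by move=> sab; apply: ud; apply: subset_itv_oo_cc sab.
have uc : {within `[a, b], continuous u}.
  by apply: derivable_within_continuous => s /ud sd; exact: ex_derive.
have [c cab ->] := MVT_segment ab ud' uc; rewrite -mulrBl normrM ler_wpM2r//.
by move: cab; rewrite in_itv/= => /H[].
Qed.

Let between_dist_lt (a b c s d : R) : Num.min a b <= s <= Num.max a b ->
  `|a - c| < d -> `|b - c| < d -> `|s - c| < d.
Proof.
rewrite !ltr_norml ge_min le_max => /andP[/orP s1 /orP s2] /andP[a1 a2] /andP[b1 b2].
by case: s1 => s1; case: s2 => s2; apply/andP; split; lra.
Qed.

(** The gradient is frozen at [p] while both points vary: this uniformity allows an expansion around
    the moving point [zeta]. *)
Lemma C1_affine_approx U h p (e : R) : open U -> U p -> C1_on U h -> 0 < e ->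
  exists2 r : R, 0 < r & cdisc p r `<=` U /\
    forall z w, cdisc p r z -> cdisc p r w ->
    `|h w - h z - (partial_x h p * complex.Re (w - z) + partial_y h p * complex.Im (w - z))|
      <= e * cabs (w - z).
Proof.
move=> oU Up hU e0; have e2 : 0 < e / 2 by rewrite divr_gt0.
have [_ _ _ xc yc] := hU _ Up.
have /cvgrPdist_lt/(_ _ e2)/nbhs_cplxP[r1 r10 H1] := xc.
have /cvgrPdist_lt/(_ _ e2)/nbhs_cplxP[r2 r20 H2] := yc.
have [r3 r30 H3] := open_cdiscP oU Up.
pose r := Num.min r1 (Num.min r2 r3).
have r0 : 0 < r by rewrite !lt_min r10 r20.
have rP z : cdisc p r z -> [/\ U z, `|partial_x h z - partial_x h p| <= e / 2
    & `|partial_y h z - partial_y h p| <= e / 2].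
  rewrite /cdisc/= !lt_min => /and3P[z1 z2 z3]; split; first exact: H3.
    by rewrite distrC ltW// H1.
  by rewrite distrC ltW// H2.
(* The path from [z] to [w] is horizontal, then vertical; it may leave the half-size disc but not
   the disc of radius [r]. *)
clearbody r; exists (r / 2); first by rewrite divr_gt0.
have half z : cdisc p (r / 2) z -> cdisc p r z by rewrite /cdisc/=; lra.
split; first by move=> z /half/rP[].
move=> z w zr wr.
have cross (x y : R) : `|x - complex.Re p| < r / 2 -> `|y - complex.Im p| < r / 2 -> cdisc p r (cpt x y).
  move=> xr yr; rewrite /cdisc/=; apply: le_lt_trans (cabs_re_im _) _; rewrite !reimE; lra.
have re_r v : cdisc p (r / 2) v -> `|complex.Re v - complex.Re p| < r / 2.
  by apply: le_lt_trans; rewrite -reN -reD re_cabs.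
have im_r v : cdisc p (r / 2) v -> `|complex.Im v - complex.Im p| < r / 2.
  by apply: le_lt_trans; rewrite -imN -imD im_cabs.
have btw a b c s := @between_dist_lt a b c s (r / 2).
have A1 := @mvt_affine (fun s => h (cpt s (complex.Im z))) (fun s => partial_x h (cpt s (complex.Im z)))
  (partial_x h p) (e / 2) (complex.Re z) (complex.Re w).
have A2 := @mvt_affine (fun s => h (cpt (complex.Re w) s)) (fun s => partial_y h (cpt (complex.Re w) s))
  (partial_y h p) (e / 2) (complex.Im z) (complex.Im w).
have d1 s : Num.min (complex.Re z) (complex.Re w) <= s <= Num.max (complex.Re z) (complex.Re w) ->
    cdisc p r (cpt s (complex.Im z)).
  by move=> /btw H; apply: cross; [apply: H; exact: re_r|exact: im_r].
have d2 s : Num.min (complex.Im z) (complex.Im w) <= s <= Num.max (complex.Im z) (complex.Im w) ->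
    cdisc p r (cpt (complex.Re w) s).
  by move=> /btw H; apply: cross; [exact: re_r|apply: H; exact: im_r].
have {}A1 : `|h (cpt (complex.Re w) (complex.Im z)) - h (cpt (complex.Re z) (complex.Im z)) - partial_x h p * (complex.Re w - complex.Re z)| <= e / 2 * `|complex.Re w - complex.Re z|.
  apply: A1 => s /d1/rP[Us xs _]; split; last exact: xs.
  have [dx _ _ _ _] := hU _ Us; exact: (is_derive_partial_x dx).
have {}A2 : `|h (cpt (complex.Re w) (complex.Im w)) - h (cpt (complex.Re w) (complex.Im z)) - partial_y h p * (complex.Im w - complex.Im z)| <= e / 2 * `|complex.Im w - complex.Im z|.
  apply: A2 => s /d2/rP[Us _ ys]; split; last exact: ys.
  have [_ dy _ _ _] := hU _ Us; exact: (is_derive_partial_y dy).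
move: A1 A2; rewrite !cpt_re_im => A1 A2.
have b1 := re_cabs (w - z); have b2 := im_cabs (w - z); rewrite !reimE in b1 b2 *.
have -> : h w - h z - (partial_x h p * (complex.Re w - complex.Re z) + partial_y h p * (complex.Im w - complex.Im z)) =
  (h (cpt (complex.Re w) (complex.Im z)) - h z - partial_x h p * (complex.Re w - complex.Re z)) +
  (h w - h (cpt (complex.Re w) (complex.Im z)) - partial_y h p * (complex.Im w - complex.Im z)) by ring.
apply: (le_trans (ler_normD _ _)); apply: (le_trans (lerD A1 A2)).
rewrite -mulrDr [e in leRHS](_ : e = e / 2 * 2); last by rewrite divfK.
by rewrite -mulrA ler_wpM2l ?(ltW e2)// mulr_natl mulr2n lerD.
Qed.

Lemma wirtinger1 h p : wirtinger h p = 1 -> partial_x h p = 2 /\ partial_y h p = 0.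
Proof.
move=> /(congr1 (fun z => z * 2)); rewrite divfK ?pnatr_eq0// mul1r => E.
have E2 : (2 : C) = cre 2 by rewrite -[2%R]/(1 + 1 : C) -cre1 -creD.
by move: E; rewrite E2 => -[-> /eqP]; rewrite oppr_eq0 => /eqP.
Qed.

(* With [t = |z - zeta|], [s = |z - zeta - kap|] one has
   [kap - 2 Re (z - zeta) = (s^2 - t^2) / kap], so the sign of the first order approximation of
   [psi] at [z] is the sign of [t - s]. *)
Lemma cabs_shift z zeta (kap : R) :
  cabs (z - (zeta + cre kap)) ^+ 2 =
  cabs (z - zeta) ^+ 2 - 2 * kap * complex.Re (z - zeta) + kap ^+ 2.
Proof. by rewrite !cabs_sqr !reimE; ring. Qed.

(** Here [y] is [psi z]. The main term satisfies [s^2 - t^2 >= e s (s + t)]; since [k <= s + t] and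
    [t <= s], the error multiplied by [k] is at most a quarter of that. *)
Let inner_sign (s t k e x y : R) : 0 < k -> 0 < e -> e < 1 -> 0 <= s -> 0 <= t -> k <= s + t ->
  s ^+ 2 = t ^+ 2 - 2 * k * x + k ^+ 2 -> t < (1 - e) * s ->
  `|y - (- k) - 2 * x| <= e / 4 * t -> y < 0.
Proof.
move=> k0 e0 e1 s0 t0 kst E ts; rewrite ler_norml => /andP[_ h].
rewrite -(pmulr_rlt0 _ k0).
have h1 : k * y <= - (s ^+ 2 - t ^+ 2) + k * (e / 4 * t).
  have : k * y <= k * (- k + 2 * x + e / 4 * t) by rewrite ler_pM2l//; lra.
  nra.
apply: (le_lt_trans h1).
have h2 : e * s * (s + t) <= s ^+ 2 - t ^+ 2 by nra.
have sp : 0 < s by nra.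
have ts' : t <= s by nra.
have h3 : e * (k * t) <= e * s * (s + t).
  have : k * t <= (s + t) * s by apply: ler_pM => //; exact: ltW.
  by rewrite -mulrA [s * (s + t)]mulrC ler_pM2l.
have h4 : 0 < e * s * (s + t) by rewrite !mulr_gt0// ltr_pwDl.
lra.
Qed.

Let outer_sign (s t k e x y : R) : 0 < k -> 0 < e -> e < 1 -> 0 <= s -> 0 <= t -> k <= s + t ->
  s ^+ 2 = t ^+ 2 - 2 * k * x + k ^+ 2 -> (1 + e) * s < t ->
  `|y - (- k) - 2 * x| <= e / 4 * t -> 0 < y.
Proof.
move=> k0 e0 e1 s0 t0 kst E ts; rewrite ler_norml => /andP[h _].
rewrite -(pmulr_rgt0 _ k0).
have h1 : (t ^+ 2 - s ^+ 2) - k * (e / 4 * t) <= k * y.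
  have : k * (- k + 2 * x - e / 4 * t) <= k * y by rewrite ler_pM2l//; lra.
  nra.
apply: lt_le_trans h1.
have tp : 0 < t by nra.
have h2 : e * t <= 2 * (t - s).
  have h5 : 0 <= (t - (1 + e) * s) * (2 - e) by apply: mulr_ge0; lra.
  have h6 : 0 <= e * (1 - e) * s by rewrite !mulr_ge0//; lra.
  nra.
have h3 : e * (k * t) <= e * t * (s + t).
  by rewrite -mulrA [t * (s + t)]mulrC ler_pM2l// ler_pM2r.
have h4 : e * t * (s + t) <= 2 * (t - s) * (s + t) by rewrite ler_wpM2r// addr_ge0.
have h5 : 0 < e * (k * t) by rewrite !mulr_gt0.
nra.
Qed.

(** The inclusions of the overview, multiplied out so that the pole [zeta + kap] is no exception.
    The second one says that [D] avoids a disc containing the pole. *)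
Definition pinched D zeta (e kap : R) :=
  (forall z, cabs (z - zeta) < (1 - e) * cabs (z - (zeta + cre kap)) -> D z) /\
  (forall z, D z -> cabs (z - zeta) <= (1 + e) * cabs (z - (zeta + cre kap))).

Lemma pinched_near D U p psi (e : R) : C2_defining_on D p U psi -> boundary D p ->
  wirtinger psi p = 1 -> 0 < e -> e < 1 ->
  exists2 d : R, 0 < d & forall zeta, D zeta -> cabs (zeta - p) < d ->
    [/\ 0 < - psi zeta, pinched D zeta e (- psi zeta) &
      exists2 b, boundary D b & cabs (b - zeta) <= - psi zeta].
Proof.
move=> [[oU Up] [C1 _ _] DU bU _] bp /wirtinger1[px py] e0 e1.
have e4 : 0 < e / 4 by rewrite divr_gt0.
have [r r0 [rU H]] := C1_affine_approx oU Up C1 e4.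
have DP z : cdisc p r z -> (D z <-> psi z < 0).
  move=> zr; have Uz := rU _ zr; split => [Dz|z0].
    by have : (D `&` U) z by []; rewrite DU => -[].
  by have : [set z | U z /\ psi z < 0] z by []; rewrite -DU => -[].
have p0 : psi p = 0 by have : (boundary D `&` U) p by []; rewrite bU => -[].
have {}H z w : cdisc p r z -> cdisc p r w -> `|psi w - psi z - 2 * complex.Re (w - z)| <= e / 4 * cabs (w - z).
  by move=> zr wr; have := H z w zr wr; rewrite px py mul0r addr0.
(* The sets to control lie within [k (1 + 1 / e)] of [zeta], and [k <= 3 |zeta - p|]; the 4 leaves
   room for this below [r / 2]. *)
pose m := 4 * (1 + e^-1); have ei : 0 < e^-1 by rewrite invr_gt0.
have m0 : 0 < m by rewrite /m; lra.
pose d := r / (2 * m); have d0 : 0 < d by rewrite divr_gt0// mulr_gt0.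
have dm : d * m = r / 2 by rewrite /d; field; rewrite gt_eqF.
have dr : d < r / 2 by rewrite -dm -[ltLHS]mulr1 ltr_pM2l// /m; lra.
exists d => // zeta Dz zd.
have zr : cdisc p r zeta by rewrite /cdisc/=; lra.
have pr : cdisc p r p by exact: cdisc_center.
pose k := - psi zeta; have k0 : 0 < k by rewrite oppr_gt0; exact/(DP _ zr).
have kz : k <= 3 * cabs (zeta - p).
  have := H _ _ pr zr; rewrite p0 ler_norml => /andP[h _].
  have := re_cabs (zeta - p); rewrite ler_norml => /andP[h2 _].
  have := cabs_ge0 (zeta - p); rewrite /k; move: h h2.
  by move: (cabs _) (complex.Re _) (psi _) => x y t; nra.
have near z (A : R) : cabs (z - zeta) <= k + A -> A <= k / e -> cdisc p r z.
  move=> h1 h2; rewrite /cdisc/=; have := cabsBB zeta z p.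
  have : k * (1 + e^-1) < r / 2.
    rewrite -dm /m mulrA ltr_pM2r; last by lra.
    by apply: (le_lt_trans kz); lra.
  by lra.
have kE z : k <= cabs (z - (zeta + cre k)) + cabs (z - zeta).
  have := cabsBB z (zeta + cre k) zeta; rewrite addrAC subrr add0r cabs_cre gtr0_norm//.
  by rewrite (cabsB (zeta + cre k)).
have kE' z : cabs (z - zeta) <= k + cabs (z - (zeta + cre k)).
  have := cabsBB (zeta + cre k) z zeta; rewrite [zeta + cre k - zeta]addrAC subrr add0r cabs_cre gtr0_norm//.
  by rewrite [_ + k]addrC.
have kE2 z : cabs (z - (zeta + cre k)) <= k + cabs (z - zeta).
  have := cabsBB zeta z (zeta + cre k); rewrite (cabsB zeta (zeta + cre k)) [zeta + cre k - zeta]addrAC subrr add0r cabs_cre gtr0_norm//.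
  by rewrite [_ + k]addrC.
have approx z : cdisc p r z -> `|psi z - (- k) - 2 * complex.Re (z - zeta)| <= e / 4 * cabs (z - zeta).
  by move=> zr'; rewrite /k opprK; exact: H.
have outer z : cdisc p r z -> (1 + e) * cabs (z - (zeta + cre k)) < cabs (z - zeta) -> 0 < psi z.
  move=> zr' h; apply: (outer_sign k0 e0 e1 (cabs_ge0 _) (cabs_ge0 _) (kE z) (cabs_shift z zeta k) h).
  exact: approx.
split => //.
  split=> z h.
    have zr' : cdisc p r z.
      apply: (near z (cabs (z - (zeta + cre k)))) => //.
      rewrite ler_pdivlMr//; have := kE2 z; move: h.
      by move: (cabs (z - zeta)) (cabs _) => t s; nra.
    apply/(DP _ zr').
    apply: (inner_sign k0 e0 e1 (cabs_ge0 _) (cabs_ge0 _) (kE z) (cabs_shift z zeta k) h).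
    exact: approx.
  rewrite leNgt; apply/negP => h'.
  have zr' : cdisc p r z.
    apply: (near z (cabs (z - (zeta + cre k)))) => //.
    rewrite ler_pdivlMr//; have := kE' z; move: h'.
    by move: (cabs (z - zeta)) (cabs _) => t s; nra.
  by have := outer _ zr' h'; have /(DP _ zr') := h; lra.
(* Along the horizontal segment from [zeta] to the pole, [psi] passes from negative to positive; its
   zero is a boundary point within [k]. *)
pose g (t : R) := zeta + cre t.
have gz t : 0 <= t -> cabs (g t - zeta) = t.
  by move=> t0; rewrite /g addrC addKr cabs_cre ger0_norm.
have gr t : 0 <= t <= k -> cdisc p r (g t).
  move=> /andP[t0 tk]; apply: (near _ 0); last by rewrite divr_ge0// ltW.
  by rewrite gz// addr0.
have gc t : g x @[x --> t] --> g t.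
  apply: cvgD; first exact: cvg_cst.
  by apply: (@cvg_re_im _ _ (nbhs t)); [exact: cvg_id|exact: cvg_cst].
have uc : {within `[0, k], continuous (psi \o g)}.
  apply: continuous_in_subspaceT => t; rewrite inE/= in_itv/= => /gr/rU Ut.
  have [_ _ c _ _] := C1 _ Ut; exact: (cvg_comp g psi (gc t) c).
have g0 : psi (g 0) <= 0 by rewrite /g cre0 addr0 -oppr_ge0 ltW.
have gk : 0 <= psi (g k).
  apply/ltW/outer; first by apply: gr; rewrite ltW//= lexx.
  by rewrite -/(g k) subrr cabs0 mulr0 gz// ltW.
have [|t] := @IVT R (psi \o g) 0 k 0 (ltW k0) uc.
  by rewrite /= ge_min le_max g0 gk orbT.
rewrite in_itv/= => tk gt0.
exists (g t); last by move: tk => /andP[t0 tk]; rewrite gz.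
have : [set z | U z /\ psi z = 0] (g t) by split => //; apply: rU; exact: gr.
by rewrite -bU => -[].
Qed.

End DefiningFunction.

(** * Two-sided bounds and the limit *)

Section Asymptotics.
Context {R : realType}.
Local Notation C := (Cplx R).
Implicit Types (D : set C) (z w p zeta : C).

Definition kernel_const (n : nat) : R := n`!%:R * n.-1`!%:R / pi.

Lemma kernel_const_gt0 n : 0 < kernel_const n.
Proof. by rewrite divr_gt0 ?pi_gt0// mulr_gt0// ltr0n fact_gt0. Qed.

(** The upper factor involves [1 - 2 e] instead of [1 - e] because the energy bound needs a radius
    strictly inside the disc that is mapped into [D]. *)
Lemma pinched_kernel D zeta (e k : R) n : domain D -> bounded_set D -> D zeta -> (0 < n)%N ->
  0 < k -> 0 < e -> e < 2^-1 -> pinched D zeta e k ->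
  exists2 K : R, reduced_bergman_deriv D n n.-1 zeta zeta = cre K &
    kernel_const n / (1 + e) ^+ (2 * n) <= K * k ^+ (2 * n) <= kernel_const n / (1 - 2 * e) ^+ (2 * n).
Proof.
move=> dD bD Dz n0 k0 e0 e2 [inner outer].
have oD : open D by case: dD.
have e21 : 0 < 1 - 2 * e by lra.
have e11 : 0 < 1 + e by lra.
have [K [KE K0 KN [f [fA fK fN]]]] := kernel_diagonal dD Dz n0 bD.
have nf : 0 < n`!%:R :> R by rewrite ltr0n fact_gt0.
have nf1 : 0 < n.-1`!%:R :> R by rewrite ltr0n fact_gt0.
exists K => //; apply/andP; split.
  have [|g [gD g0 gn gE]] := @moebius_test R D zeta k (1 + e) n oD Dz n0 k0 e11.
    move=> z Dz'; split; last exact: outer.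
    apply/eqP => za; have := outer _ Dz'; rewrite za subrr cabs0 mulr0 addrC addKr cabs_cre gtr0_norm//.
    by rewrite leNgt k0.
  have gA : AD D zeta n g by split => //; exact: energy_fin gE.
  have gF := AD_finite_energy gA.
  have := KN _ gA; rewrite gn => H.
  have gN : nrg D g <= n%:R * pi * (1 + e) ^+ (2 * n) by rewrite -lee_fin -(energy_nrg gF).
  have {H} := le_trans H (ler_wpM2r K0 gN).
  have -> : n`!%:R = n%:R * n.-1`!%:R :> R by rewrite -natrM -{1 2}(prednK n0) factS.
  rewrite ler_pdivrMr ?exprn_gt0// /kernel_const.
  have -> : n`!%:R = n%:R * n.-1`!%:R :> R by rewrite -natrM -{1 2}(prednK n0) factS.
  rewrite expr_div_n -[k ^+ n ^+ 2]exprM [(n * 2)%N]mulnC ler_pdivrMr ?exprn_gt0// => H.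
  have nn : 0 < n%:R :> R by rewrite ltr0n.
  rewrite ler_pdivrMr ?pi_gt0// -(ler_pM2l nn).
  apply: le_trans (le_trans _ H) _; rewrite le_eqVlt; apply/orP; left; apply/eqP; ring.
(* The extremal function gives an inequality of the form [K^2 x <= K], from which a factor [K] is to
   be cancelled. *)
have [->|Kn] := eqVneq K 0.
  by rewrite mul0r divr_ge0 ?exprn_ge0// ltW// kernel_const_gt0.
have Kp : 0 < K by rewrite lt_neqAle eq_sym Kn.
have [fD f0 _] := fA.
have := @moebius_energy_ge R D f zeta k (1 - e) (1 - 2 * e) n oD fD Dz n0 f0 k0 e21 _ _ _.
rewrite (energy_nrg (AD_finite_energy fA)) fK fN lee_fin => H.
have {}H : K ^+ 2 * (pi * (k * (1 - 2 * e)) ^+ (2 * n) / (n`!%:R * (n.-1)`!%:R)) <= K.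
  apply: H; [lra|lra|move=> w we].
  have w1 : w != 1 by apply: cabs_lt1_neq1; lra.
  apply: inner; rewrite /moebius [X in _ < _ * cabs X]addrC addKr.
  rewrite -/(moebius zeta k w) moebiusE// [zeta + _ - _]addrC addKr cabsM ltr_pM2r//.
  rewrite cabs_gt0 mulf_neq0 ?invr_eq0 ?subr_eq0//.
  by rewrite -cabs_eq0 cabs_cre normr_eq0 gt_eqF.
rewrite ler_pdivlMr ?exprn_gt0// /kernel_const ler_pdivlMr ?pi_gt0//.
move: H; rewrite mulrA ler_pdivrMr ?mulr_gt0// expr2 -mulrA -mulrA ler_pM2l// exprMn.
apply: le_trans; rewrite le_eqVlt; apply/orP; left; apply/eqP; ring.
Qed.

(** A point within [k / 4] of [zeta] is more than [3 k / 4] from the pole, so the inner inclusion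
    puts it in the open set [D], off the boundary. *)
Lemma pinched_boundary_dist D zeta (k : R) b : open D -> D zeta -> 0 < k ->
  pinched D zeta 2^-1 k -> boundary D b -> cabs (b - zeta) <= k ->
  k / 4 <= boundary_dist D zeta <= k.
Proof.
move=> oD Dz k0 [inner _] bb bk.
pose S : set R := [set Normc.normc (zeta - w : R[i]) | w in boundary D].
have lbS : lbound S (k / 4).
  move=> _ [w [_ wD] <-]; rewrite -/(cabs _) cabsB leNgt; apply/negP => wz; apply: wD.
  rewrite (interior_id _).1//; apply: inner.
  have := cabsBB w (zeta + cre k) zeta; rewrite addrC addKr cabs_cre gtr0_norm//.
  rewrite (cabsB _ w); lra.
have Sb : S (cabs (b - zeta)) by exists b => //; rewrite -/(cabs _) cabsB.
apply/andP; split; first by apply: lb_le_inf => //; exists (cabs (b - zeta)).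
by apply: le_trans bk; apply: ge_inf => //; exists (k / 4).
Qed.

End Asymptotics.

Theorem theorem1p12 (R : realType) (D : set (Cplx R)) (p : Cplx R)
    (D_domain : domain D) (D_bounded : bounded_set D)
    (p_boundary : boundary D p)
    (D_smooth : C2_smooth_boundary_near D p)
    (psi : Cplx R -> R) (psi_def : C2_defining D p psi)
    (psi_norm : wirtinger psi p = 1) :
  forall n : nat, (0 < n)%N ->
    sim_at D p ((n`!)%:R * (n.-1`!)%:R / pi)%:C
      (fun z => reduced_bergman_deriv D n n.-1 z z)
      (fun z => (1 / psi z ^+ (2 * n))%:C)
    /\
    approx_at D p
      (fun z => (n`!)%:R * (n.-1`!)%:R / pi * (1 / psi z ^+ (2 * n)))
      (fun z => 1 / boundary_dist D z ^+ (2 * n)).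
Proof.
move=> n n0; have [U psiU] := psi_def; rewrite -/(kernel_const n).
have near e : 0 < e -> e < 1 -> exists2 d : R, 0 < d & forall zeta, D zeta -> cabs (zeta - p) < d ->
    [/\ 0 < - psi zeta, pinched D zeta e (- psi zeta) &
      exists2 b, boundary D b & cabs (b - zeta) <= - psi zeta].
  exact: (pinched_near psiU p_boundary psi_norm).
(* The bounds are in terms of the positive quantity [- psi]; the even exponent hides the sign. *)
have even (x : R) : x ^+ (2 * n) = (- x) ^+ (2 * n) by rewrite !exprM sqrrN.
have c0 := @kernel_const_gt0 R n.
split.
  apply/(@cvg_cplxP R _ (within D (nbhs p))) => e e0.
  have qc : kernel_const n / x ^+ (2 * n) @[x --> (1 : R)] --> kernel_const n / 1 ^+ (2 * n).
    apply: cvgM; first exact: cvg_cst.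
    by apply: cvgV; [rewrite expr1n oner_neq0|exact: exprn_continuous].
  move: qc; rewrite expr1n divr1 => /cvgrPdist_lt/(_ e e0)[eta /= eta0 Heta].
  (* Both [1 + t] and [1 - 2 t] are then within [eta] of 1, where the two bounds differ from the
     constant by less than [e]; also [t < 1/2], as [pinched_kernel] demands. *)
  pose t := Num.min (eta / 4) 4^-1.
  have t0 : 0 < t by rewrite lt_min divr_gt0//= invr_gt0.
  have te : t <= eta / 4 by rewrite ge_min lexx.
  have t4 : t <= 4^-1 by rewrite ge_min lexx orbT.
  clearbody t.
  have t1 : t < 1 by lra.
  have [d d0 H] := near t t0 t1.
  apply/nbhs_cplxP; exists d => // z zd Dz; have [k0 pin _] := H z Dz zd.
  have t2 : t < 2^-1 by lra.
  have [K -> /andP[K1 K2]] := pinched_kernel D_domain D_bounded Dz n0 k0 t0 t2 pin.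
  have k20 : 0 < (- psi z) ^+ (2 * n) by rewrite exprn_gt0.
  have -> : cre K / (1 / psi z ^+ (2 * n))%:C = cre (K * (- psi z) ^+ (2 * n)).
    have y0 : cre (1 / psi z ^+ (2 * n)) != 0.
      by rewrite -cabs_eq0 cabs_cre normr_eq0 even div1r invr_eq0 gt_eqF.
    apply: (mulIf y0); rewrite divfK// -creM even div1r -mulrA mulfV ?mulr1// gt_eqF//.
  rewrite -[(kernel_const n)%:C]/(cre (kernel_const n)) -creB cabs_cre ltr_norml.
  have n1 : `|1 - (1 + t)| < eta by rewrite opprD addrA subrr add0r normrN gtr0_norm//; lra.
  have n2 : `|1 - (1 - 2 * t)| < eta by rewrite opprB addrCA subrr addr0 gtr0_norm ?mulr_gt0//; lra.
  have := Heta _ n1; have := Heta _ n2; rewrite !ltr_norml => /andP[a1 a2] /andP[a3 a4].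
  by apply/andP; split; lra.
have i2 : 0 < 2^-1 :> R by rewrite invr_gt0.
have i21 : 2^-1 < 1 :> R by rewrite invf_lt1// ltr1n.
have [d d0 H] := near _ i2 i21.
(* The ratio is the constant times the [2 n]-th power of the boundary distance over [- psi], and
   this quotient lies between 1/4 and 1. *)
exists (kernel_const n * (4^-1) ^+ (2 * n)), (kernel_const n); split => //.
  by rewrite mulr_gt0// exprn_gt0// invr_gt0.
apply/nbhs_cplxP; exists d => // z zd Dz; have [k0 pin [b bb bk]] := H z Dz zd.
have oD : open D by case: D_domain.
have /andP[d1 d2] := pinched_boundary_dist oD Dz k0 pin bb bk.
rewrite (even (psi z)); move: (- psi z) (boundary_dist D z) k0 d1 d2 => k dl k0 d1 d2.
have dl0 : 0 < dl by apply: lt_le_trans d1; rewrite divr_gt0.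
have -> : kernel_const n * (1 / k ^+ (2 * n)) / (1 / dl ^+ (2 * n)) = kernel_const n * (dl / k) ^+ (2 * n).
  by rewrite exprMn exprVn !div1r invrK -mulrA [_^-1 * _]mulrC.
apply/andP; split.
  have q : 4^-1 <= dl / k by rewrite ler_pdivlMr// mulrC.
  have q0 : 0 <= dl / k by rewrite divr_ge0 ?ltW.
  by rewrite ler_pM2l// lerXn2r// nnegrE invr_ge0.
have q : dl / k <= 1 by rewrite ler_pdivrMr// mul1r.
have q0 : 0 <= dl / k by rewrite divr_ge0 ?ltW.
by rewrite ler_piMr ?(ltW c0)// exprn_ile1.
Qed.
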